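(* Assume $\gamma(\beta-1)>\beta+1$. Then, for all $\varepsilon>0$ small enough, the interior global attractor $\mathcal{A}_{0,\varepsilon}$ of system (PS) consists of the unique interior equilibrium $(\overline U_2,\overline V_2)$, the unique periodic orbit surrounding the interior equilibrium, and an infinite number of heteroclinic orbits joining the unique interior equilibrium and the unique periodic orbit.
   Context: Parameters $d,\alpha,\beta,\gamma>0$ with $\gamma(\beta-1)>1$. For $U>-1$ set $F(U,V)=\alpha U(\gamma-U)-\frac{UV}{1+U}$ and $G(U,V)=V\big(\frac{\beta U}{1+U}-1\big)$. The system $U'=F(U,V),\ V'=G(U,V)$ has in $[0,\infty)^2$ exactly the equilibria $(0,0)$, $(\gamma,0)$ and the interior equilibrium $(\overline U_2,\overline V_2)=\big(\frac1{\beta-1},\frac{\alpha\beta[\gamma(\beta-1)-1]}{(\beta-1)^2}\big)$. Fix $R>0$ so large that $\beta F+G<0$ whenever $U,V\ge0$ and $\beta U+V\ge R$, and that $\mathbb{T}=\{(U,V)\in[0,\infty)^2:\beta U+V\le R\}$ contains these equilibria. Truncated system. Let $P(U_1,U_2,V_1,V_2)=\partial_UF(U_1,V_1)[U_2-F(U_1,V_1)]+\partial_VF(U_1,V_1)[V_2-G(U_1,V_1)]$ and $Q(U_1,U_2,V_1,V_2)=\partial_UG(U_1,V_1)[U_2-F(U_1,V_1)]+\partial_VG(U_1,V_1)[V_2-G(U_1,V_1)]$. Let $\mathbb{E}=\{(U_1,U_2,V_1,V_2)\in\mathbb{R}^4:(U_1,V_1)\in\mathbb{T},|U_2-F(U_1,V_1)|\le1,|V_2-G(U_1,V_1)|\le1\}$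 and $L\ge2+\max_{\mathbb{T}}|F|+\max_{\mathbb{T}}|G|+\max_{\mathbb{E}}|P|+\max_{\mathbb{E}}|Q|$. Let $\rho,\chi:\mathbb{R}\to[0,1]$ be $C^\infty$ with $\rho=1$ on $[0,\infty)$, $\rho=0$ on $(-\infty,-1/2]$, $\chi=1$ on $[-L,L]$, $\chi=0$ outside $[-(L+1),L+1]$, and $h(x)=x\chi(x)$. The truncated system on $\mathbb{R}^4$ is $$\text{(TS)}\quad U_1'=\varepsilon h(U_2-F(U_1,V_1))\rho(U_1),\quad dU_2'=-U_2+\varepsilon d\,h(P)\rho(U_1),\quad V_1'=\varepsilon h(V_2-G(U_1,V_1))\rho(U_1),\quad V_2'=-V_2+\varepsilon h(Q)\rho(U_1),$$ where terms multiplied by $\rho(U_1)$ are $0$ for $U_1\le-1/2$. Write $X=(U_1,V_1)$, $Y=(U_2,V_2)$. Center manifold. Fix $\eta\in(0,\min(1,1/d))$. For $\varepsilon\in[0,\widetilde\varepsilon_0]$ let $\Phi_\varepsilon=(\Phi^1_\varepsilon,\Phi^2_\varepsilon):\mathbb{R}^2\to\mathbb{R}^2$ be the center manifold maps of (TS): they are $C^k$ ($k\ge1$), bounded with bounded derivatives up to order $k$, $\Phi_\varepsilon(0)=0$, $\|\Phi_\varepsilon\|_\infty\to0$ and $\|\Phi_\varepsilon\|_{\mathrm{Lip}}\to0$ as $\varepsilon\to0$; (i) if $X=(U_1,V_1)$ solves the reduced system $U_1'=\varepsilon h(\Phi^1_\varepsilon(X)-F(X))\rho(U_1)$, $V_1'=\varepsilon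 h(\Phi^2_\varepsilon(X)-G(X))\rho(U_1)$ on an interval, then $(X,\Phi_\varepsilon(X))$ solves (TS) there; (ii) any solution $(X,Y)$ of (TS) on $\mathbb{R}$ with $\sup_t e^{-\eta|t|}\|(X,Y)(t)\|<\infty$ satisfies $Y(t)=\Phi_\varepsilon(X(t))$ for all $t$. Perturbed planar system. After the time change $t=-\varepsilon s$ the reduced system on $\mathbb{T}$ becomes $$\text{(PS)}\quad U'=F_\varepsilon(U,V):=F(U,V)-\Phi^1_\varepsilon(U,V),\quad V'=G_\varepsilon(U,V):=G(U,V)-\Phi^2_\varepsilon(U,V),$$ with $\Phi_0=0$. There is $\varepsilon_0\in(0,\widetilde\varepsilon_0]$ (fixed) such that for $\varepsilon\in[0,\varepsilon_0]$ the sets $\mathbb{T}$, $\mathbb{T}\cap\{V=0\}$, $\mathbb{T}\cap\{U=0\}$ and $\mathbb{T}^0=\{(U,V)\in\mathbb{T}:U>0,V>0\}$ are positively invariant for (PS). Then $T_\varepsilon(t)$, $t\ge0$, denotes the semiflow of (PS) on $\mathbb{T}$; $(\varepsilon,t,X)\mapsto T_\varepsilon(t)X$ is continuous on $[0,\varepsilon_0]\times[0,\infty)\times\mathbb{T}$. Put $\partial\mathbb{T}^0=\mathbb{T}\setminus\mathbb{T}^0$. Interior attractor. Fix $\varepsilon_1\in(0,\varepsilon_0]$ and $\Theta>0$ such that $\liminf_{t\to\infty}\mathrm{dist}(T_\varepsilon(t)X,\partial\mathbb{T}^0)\ge\Theta$ for all $X\in\mathbb{T}^0$, $\varepsilon\in[0,\varepsilon_1]$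 (such numbers exist). For $\varepsilon\in[0,\varepsilon_1]$, $\mathcal{A}_{0,\varepsilon}\subset\mathbb{T}^0$ is the global attractor of $T_\varepsilon$ in $\mathbb{T}^0$: the compact invariant subset of $\mathbb{T}^0$ attracting all compact subsets of $\mathbb{T}^0$. For $\gamma(\beta-1)>\beta+1$ and $\varepsilon>0$ small, (PS) has exactly one non-constant periodic orbit in $\mathbb{T}$, and it surrounds the interior equilibrium. A heteroclinic orbit joining the interior equilibrium and the periodic orbit is the orbit of a complete solution with $\alpha$-limit set $\{(\overline U_2,\overline V_2)\}$ and $\omega$-limit set the periodic orbit. *)

(* Defs.v *)
From HB Require Import structures.
From mathcomp Require Import all_boot all_order all_algebra.
From mathcomp Require Import all_classical all_reals all_analysis.

Set Implicit Arguments.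
Unset Strict Implicit.
Unset Printing Implicit Defensive.

Import Order.TTheory GRing.Theory Num.Theory.
Import numFieldNormedType.Exports.

Local Open Scope classical_set_scope.
Local Open Scope ring_scope.

Section General.
Context {R : realType}.
Implicit Types (f : R * R -> R * R) (x : R -> R * R) (S K A : set (R * R)).

Definition smooth (g : R -> R) : Prop :=
  forall n t, derivable (derive1n n g) t 1.

Fixpoint Ck_bounded (k : nat) f : Prop :=
  [/\ continuous f,
      exists M : R, forall X, `|f X| <= M
    & if k is k'.+1 then
        [/\ forall X, derivable f X (1, 0) /\ derivable f X (0, 1),
            Ck_bounded k' ('D_(1, 0) f) & Ck_bounded k' ('D_(0, 1) f)]
      else True].

(* Two-sided derivatives are meant: [I] is always an open interval below. *)
Definition solves_on {V : normedModType R} (f : V -> V) (I : set R)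
    (x : R -> V) : Prop :=
  forall t, I t -> is_derive t 1 x (f (x t)).

Definition pos_invariant f S : Prop :=
  forall (a b : R) x, a < 0 -> 0 < b -> solves_on f `]a, b[ x -> S (x 0) ->
    forall t : R, 0 <= t < b -> S (x t).

(* [T t X] is only constrained for [0 <= t] and [S X]. *)
Definition is_semiflow f S (T : R -> R * R -> R * R) : Prop :=
  forall X, S X ->
    [/\ T 0 X = X,
        forall t : R, 0 <= t -> S (T t X),
        {within `[0, +oo[, continuous (T ^~ X)}
      & solves_on f `]0, +oo[ (T ^~ X)].

Definition attracts (T : R -> R * R -> R * R) A K : Prop :=
  forall e : R, 0 < e -> exists t0 : R, forall t : R, 0 <= t -> t0 <= t ->
    forall X, K X -> exists2 Z, A Z & `|T t X - Z| < e.

Definition is_global_attractor (T : R -> R * R -> R * R) S A : Prop :=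
  [/\ compact A,
      A `<=` S,
      forall t : R, 0 <= t -> T t @` A = A
    & forall K, compact K -> K `<=` S -> attracts T A K].

Definition complete_orbit f S x : Prop :=
  solves_on f setT x /\ range x `<=` S.

Definition periodic_orbit f S (Gam : set (R * R)) : Prop :=
  exists x, [/\ complete_orbit f S x,
                exists2 p : R, 0 < p & forall t, x (t + p) = x t,
                exists t, x t <> x 0
              & Gam = range x].

(* [E] lies in a bounded component of the complement of [Gam]. *)
Definition surrounds (Gam : set (R * R)) (E : R * R) : Prop :=
  ~ Gam E /\ bounded_set (connected_component (~` Gam) E).

(* The alpha- and omega-limit sets of [x] are the cluster sets of [x] at
   [-oo] and [+oo]. *)
Definition heteroclinic_orbit f S (E : R * R) (Gam H : set (R * R)) : Prop :=
  exists x, [/\ complete_orbit f S x,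
                cluster (x @ -oo) = [set E],
                cluster (x @ +oo) = Gam
              & H = range x].

End General.

Section Model.
Context {R : realType}.
Variables (d al be ga : R).

(* At [u = -1], where the quotients are meaningless, every use of [F] and [G]
   is multiplied by [rho u = 0]. *)
Definition F (u v : R) : R := al * u * (ga - u) - u * v / (1 + u).
Definition G (u v : R) : R := v * (be * u / (1 + u) - 1).

Definition interior_eq : R * R :=
  ((be - 1)^-1, al * be * (ga * (be - 1) - 1) / (be - 1) ^+ 2).

Definition triangle (r : R) : set (R * R) :=
  [set X | [/\ 0 <= X.1, 0 <= X.2 & be * X.1 + X.2 <= r]].

Definition triangle0 (r : R) : set (R * R) :=
  [set X | [/\ triangle r X, 0 < X.1 & 0 < X.2]].

Definition bdry0 (r : R) : set (R * R) := triangle r `\` triangle0 r.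

Definition P (u1 u2 v1 v2 : R) : R :=
  derive1 (F ^~ v1) u1 * (u2 - F u1 v1) + derive1 (F u1) v1 * (v2 - G u1 v1).

Definition Q (u1 u2 v1 v2 : R) : R :=
  derive1 (G ^~ v1) u1 * (u2 - F u1 v1) + derive1 (G u1) v1 * (v2 - G u1 v1).

(* A point of R^4 is a pair [(X, Y)] with [X = (U1, V1)] and [Y = (U2, V2)]. *)
Definition Eset (r : R) : set ((R * R) * (R * R)) :=
  [set Z | [/\ triangle r Z.1,
               `|Z.2.1 - F Z.1.1 Z.1.2| <= 1
             & `|Z.2.2 - G Z.1.1 Z.1.2| <= 1]].

Definition max_abs {T : Type} (A : set T) (g : T -> R) : R :=
  sup [set `|g z| | z in A].

Definition L_bound (r : R) : R :=
  2 + max_abs (triangle r) (fun X => F X.1 X.2)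
    + max_abs (triangle r) (fun X => G X.1 X.2)
    + max_abs (Eset r) (fun Z => P Z.1.1 Z.2.1 Z.1.2 Z.2.2)
    + max_abs (Eset r) (fun Z => Q Z.1.1 Z.2.1 Z.1.2 Z.2.2).

Definition is_rho (rho : R -> R) : Prop :=
  [/\ smooth rho, forall x : R, 0 <= rho x <= 1,
      forall x : R, 0 <= x -> rho x = 1 & forall x, x <= - (1 / 2) -> rho x = 0].

Definition is_chi (L : R) (chi : R -> R) : Prop :=
  [/\ smooth chi, forall x : R, 0 <= chi x <= 1,
      forall x, `|x| <= L -> chi x = 1 & forall x, L + 1 < `|x| -> chi x = 0].

Section Truncated.
Variables (rho chi : R -> R).

Definition h (x : R) : R := x * chi x.

Definition ts_field (eps : R) (Z : (R * R) * (R * R)) : (R * R) * (R * R) :=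
  let: ((u1, v1), (u2, v2)) := Z in
  ((eps * h (u2 - F u1 v1) * rho u1,
    eps * h (v2 - G u1 v1) * rho u1),
   ((- u2 + eps * d * h (P u1 u2 v1 v2) * rho u1) / d,
    - v2 + eps * h (Q u1 u2 v1 v2) * rho u1)).

Definition reduced_field (eps : R) (phi : R * R -> R * R) (X : R * R) : R * R :=
  (eps * h ((phi X).1 - F X.1 X.2) * rho X.1,
   eps * h ((phi X).2 - G X.1 X.2) * rho X.1).

(* The last two clauses, invariance and capture of the solutions of moderate
   growth, only concern solutions whose X-component stays in the triangle.
   They cannot be required on all of R^2 when [eps > 0]: the partial
   derivatives of F are unbounded, so far from the triangle there are points X
   at which h(U2 - F), h(V2 - G) and h(Q) vanish while
   U2 = eps d h(P(X, (U2, 0))) has several roots U2, hence several constant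
   solutions of the truncated system over the same X. *)
Definition center_manifold_maps (r eta epst : R) (k : nat)
    (Phi : R -> R * R -> R * R) : Prop :=
  [/\ forall eps : R, 0 <= eps <= epst ->
        Ck_bounded k (Phi eps) /\ Phi eps (0, 0) = (0, 0),
      forall del : R, 0 < del -> exists2 e : R, 0 < e &
        forall eps : R, 0 <= eps <= epst -> eps < e ->
          (forall X, `|Phi eps X| <= del) /\ del.-lipschitz (Phi eps),
      forall eps : R, 0 <= eps <= epst ->
        forall (I : set R) (x : R -> R * R), open I -> is_interval I ->
          (forall t, I t -> triangle r (x t)) ->
          solves_on (reduced_field eps (Phi eps)) I x ->
          solves_on (ts_field eps) I (fun t => (x t, Phi eps (x t)))
    & forall eps : R, 0 <= eps <= epst ->
        forall x y : R -> R * R,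
          (forall t, triangle r (x t)) ->
          solves_on (ts_field eps) setT (fun t => (x t, y t)) ->
          (exists M : R, forall t, expR (- eta * `|t|) * `|(x t, y t)| <= M) ->
          forall t, y t = Phi eps (x t)].

End Truncated.

Definition ps_field (phi : R * R -> R * R) (X : R * R) : R * R :=
  (F X.1 X.2 - (phi X).1, G X.1 X.2 - (phi X).2).

End Model.

(* Main.v *)
(* Put E = (U2, V2). The half line {U = U2, 0 < V < V2} is crossed from left to
   right only, and in each quadrant around E an explicit linear or logarithmic
   combination of U and V grows at a rate bounded below by the distance to E;
   hence every orbit of T^0 other than E returns to the half line again and
   again, with bounded return times on compact sets. The first return map is
   continuous and injective on an interval, so it is monotone, the iterates of
   its square converge, and their limit is the trace of a periodic orbit, which
   is unique by hypothesis. Therefore every orbit except E is attracted by the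
   periodic orbit, and a backward orbit in the attractor that does not enter a
   small neighbourhood of E is periodic.
   Near E a quadratic Lyapunov function W satisfies W' >= kap * W, so complete
   orbits that come close to E have E as alpha-limit. For small t the map
   T_t is close to the identity, hence maps onto a neighbourhood of E, so all
   points near E have complete orbits and belong to the attractor. Such an
   orbit meets each small level curve of W only once, and the curve has
   infinitely many points. *)

Require Import Defs.
From HB Require Import structures.
From mathcomp Require Import all_boot all_order all_algebra.
From mathcomp Require Import all_classical all_reals all_analysis.
From mathcomp Require Import ring lra.
Import Order.TTheory GRing.Theory Num.Theory.
Import numFieldNormedType.Exports.
Local Open Scope classical_set_scope.
Local Open Scope ring_scope.

Set Implicit Arguments.
Unset Strict Implicit.
Unset Printing Implicit Defensive.

(** * Scalar calculus *)

(** The perturbation is measured by one number, a Lipschitz constant [del] of [Phi eps], and two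
    facts make its smallness effective. First, [Phi eps] vanishes at E, because (E, 0) is a bounded
    constant solution of the truncated system and hence lies on the center manifold. The
    perturbation is therefore at most [del] times the distance to E and can be absorbed by any
    estimate linear in that distance. Second, the semiflow cannot leave the triangle, so on the axes
    the perturbation has a sign, and its components are at most [del * U] and [del * V] from above.
    This one-sided bound is needed because below E the rates are taken for [ln V] or [ln U]: [G]
    vanishes with [V] and [F] with [U], but [G / V] and [F / U] do not degenerate there. The
    condition [be + 1 < ga * (be - 1)] says that the prey nullcline rises at E; this makes E
    repelling. Time runs forward only for a semiflow on the triangle. Backward orbits are therefore
    assembled from preimages, and time is reversed in arguments only through injectivity, which
    comes from a lower Gronwall bound. *)

Section ScalarCalculus.
Context {R : realType}.
Implicit Types (g dg : R -> R) (x : R -> R * R).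

Lemma is_derive_fst x (t : R) d :
  is_derive t 1 x d -> is_derive t 1 (fun s => (x s).1) d.1.
Proof.
case=> dx <-.
have H : (fun h : R => h^-1 *: ((x (h *: 1 + t)).1 - (x t).1)) @ 0^' --> ('D_1 x t).1.
  exact: (@cvg_comp _ _ _ _ _ _ (nbhs ('D_1 x t)) _ dx (@cvg_fst _ _ (nbhs ('D_1 x t).1) (nbhs ('D_1 x t).2) _)).
by split; [apply/cvg_ex; exists ('D_1 x t).1|exact: cvg_lim].
Qed.

Lemma is_derive_snd x (t : R) d :
  is_derive t 1 x d -> is_derive t 1 (fun s => (x s).2) d.2.
Proof.
case=> dx <-.
have H : (fun h : R => h^-1 *: ((x (h *: 1 + t)).2 - (x t).2)) @ 0^' --> ('D_1 x t).2.
  exact: (@cvg_comp _ _ _ _ _ _ (nbhs ('D_1 x t)) _ dx (@cvg_snd _ _ (nbhs ('D_1 x t).1) (nbhs ('D_1 x t).2) _)).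
by split; [apply/cvg_ex; exists ('D_1 x t).2|exact: cvg_lim].
Qed.

Lemma within_itv_ed g (a b : R) : {within `[a, b], continuous g} ->
  forall t, a <= t <= b -> forall e : R, 0 < e ->
  exists2 d : R, 0 < d & forall s, a <= s <= b -> `|s - t| < d -> `|g s - g t| < e.
Proof.
move=> /subspace_continuousP cg t tab e e0.
have /cvgrPdist_lt/(_ _ e0) : g @ within `[a, b] (nbhs t) --> g t by apply: cg; rewrite /= ?in_itv /=.
rewrite near_withinE => /nbhs_ballP[d d0 H]; exists d => // s sab st.
rewrite distrC; apply: H; last by rewrite ?in_itv /=.
by rewrite /ball /= distrC.
Qed.

Lemma mvt_ge g dg (a b c : R) : a <= b ->
  {within `[a, b], continuous g} ->
  (forall t, a < t < b -> is_derive t 1 g (dg t)) ->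
  (forall t, a < t < b -> c <= dg t) -> c * (b - a) <= g b - g a.
Proof.
rewrite le_eqVlt => /orP[/eqP <-|ab] cg gd dgc; first by rewrite !subrr mulr0.
have gd' t : t \in `]a, b[ -> is_derive t 1 g (dg t) by rewrite in_itv /= => /gd.
have [t tab ->] := MVT ab gd' cg.
by apply: ler_wpM2r; [rewrite subr_ge0 ltW|apply: dgc; move: tab; rewrite in_itv].
Qed.

Lemma mvt_le g dg (a b c : R) : a <= b ->
  {within `[a, b], continuous g} ->
  (forall t, a < t < b -> is_derive t 1 g (dg t)) ->
  (forall t, a < t < b -> dg t <= c) -> g b - g a <= c * (b - a).
Proof.
rewrite le_eqVlt => /orP[/eqP <-|ab] cg gd dgc; first by rewrite !subrr mulr0.
have gd' t : t \in `]a, b[ -> is_derive t 1 g (dg t) by rewrite in_itv /= => /gd.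
have [t tab ->] := MVT ab gd' cg.
by apply: ler_wpM2r; [rewrite subr_ge0 ltW|apply: dgc; move: tab; rewrite in_itv].
Qed.

(** The time is the supremum of [[set t | a <= t <= b /\ c <= g t]]; continuity excludes both
    [g s < c] and [c < g s]. *)
Lemma last_time_ge g (a b c : R) : a <= b ->
  {within `[a, b], continuous g} -> c <= g a -> g b < c ->
  exists s, [/\ a <= s < b, g s = c & forall t, s < t <= b -> g t < c].
Proof.
move=> ab /within_itv_ed cg ga gb.
pose A := [set t | a <= t <= b /\ c <= g t].
have Aa : A a by split; rewrite ?lexx ?ab.
have hA : has_sup A by split; [exists a|exists b => t [/andP[]]].
pose s := sup A.
have as_ : a <= s by apply: ub_le_sup => //; case: hA.
have sb : s <= b by apply: ge_sup; [exists a|move=> t [/andP[]]].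
have sab : a <= s <= b by rewrite as_.
have after t : s < t <= b -> g t < c.
  move=> /andP[st tb]; rewrite ltNge; apply/negP => gt.
  suff : t <= s by rewrite leNgt st.
  by apply: ub_le_sup => //; [case: hA|split => //; rewrite tb (le_trans as_ (ltW st))].
have gs : c <= g s.
  rewrite leNgt; apply/negP => gsc.
  have [|d d0 H] := cg s sab (c - g s); first by rewrite subr_gt0.
  have [t [/andP[at_ tb] gt] std] := sup_adherent d0 hA.
  have ts : t <= s by apply: ub_le_sup => //; [case: hA|split => //; rewrite at_].
  have hts : `|t - s| < d by rewrite ltr_norml; apply/andP; split; move: std; rewrite -/s; lra.
  by have := H t _ hts; rewrite at_ tb ltr_norml => /(_ isT)/andP[]; lra.
have {}sb : s < b.
  by rewrite lt_neqAle sb andbT; apply: contraTneq gs => ->; rewrite -ltNge.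
exists s; split => //; first by rewrite as_.
apply/eqP; rewrite eq_le gs andbT leNgt; apply/negP => gsc.
have [|d d0 H] := cg s sab (g s - c); first by rewrite subr_gt0.
pose t := Num.min b (s + d / 2).
have st : s < t by rewrite lt_min sb ltrDl divr_gt0.
have tb : t <= b by rewrite ge_min lexx.
have tsd : t <= s + d / 2 by rewrite ge_min lexx orbT.
have := H t; rewrite tb (le_trans as_ (ltW st)) => /(_ isT).
rewrite gtr0_norm ?subr_gt0// => /(_ ltac:(lra)).
rewrite ltr_norml => /andP[+ _]; have := after t; rewrite st tb => /(_ isT); lra.
Qed.

Lemma within_opp g (a b : R) : {within `[a, b], continuous g} ->
  {within `[- b, - a], continuous (fun t => g (- t))}.
Proof.
move=> cg; have {}cg := within_itv_ed cg.
apply/subspace_continuousP => t; rewrite /= in_itv /= => tab.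
apply/cvgrPdist_lt => e e0; rewrite near_withinE.
have [|d d0 H] := cg (- t) _ e e0; first by rewrite lerNr lerNl andbC.
apply/nbhs_ballP; exists d => //= s; rewrite /ball /= => st.
rewrite in_itv /= => sab; rewrite distrC; apply: H; first by rewrite lerNr lerNl andbC.
by rewrite opprK addrC.
Qed.

(** Time reversal reduces this to [last_time_ge]. *)
Lemma first_time_ge g (a b c : R) : a <= b ->
  {within `[a, b], continuous g} -> g a < c -> c <= g b ->
  exists s, [/\ a < s <= b, g s = c & forall t, a <= t < s -> g t < c].
Proof.
move=> ab cg ga gb.
have [||||s [sab gs after]] := @last_time_ge (fun t => g (- t)) (- b) (- a) c.
- by rewrite lerN2.
- exact: within_opp.
- by rewrite /= opprK.
- by rewrite /= opprK.
exists (- s); split=> //; first by move: sab; rewrite ltrNr lerNl andbC.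
by move=> t tab; rewrite -[t]opprK; apply: after; rewrite ltrNr lerN2 andbC.
Qed.

Lemma within_sub g (a b a' b' : R) : a <= a' -> b' <= b ->
  {within `[a, b], continuous g} -> {within `[a', b'], continuous g}.
Proof.
move=> aa bb; apply: continuous_subspaceW => t; rewrite /= !in_itv /= => /andP[h1 h2].
by rewrite (le_trans aa)// (le_trans h2).
Qed.

(** After the last time at which [g] reaches [c], it would stay below [c] and hence be
    nondecreasing, so it could not end below [c]. The sign of [dg] is thus required only where
    [g < c]. *)
Lemma barrier g dg (a b c : R) : a <= b ->
  {within `[a, b], continuous g} ->
  (forall t, a < t < b -> is_derive t 1 g (dg t)) ->
  (forall t, a < t < b -> g t < c -> 0 <= dg t) -> c <= g a -> c <= g b.
Proof.
move=> ab cg gd dg0 ga; rewrite leNgt; apply/negP => gb.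
have [s [/andP[as_ sb] gs after]] := last_time_ge ab cg ga gb.
suff : 0 * (b - s) <= g b - g s by rewrite gs mul0r subr_ge0 leNgt gb.
have sub t : s < t < b -> a < t < b by move=> /andP[h ->]; rewrite (le_lt_trans as_).
apply: (@mvt_ge _ dg) => //; [exact: ltW|exact: (within_sub as_ _ cg)|..].
- by move=> t /sub; exact: gd.
- by move=> t h; apply: dg0; [exact: sub|apply: after; case/andP: h => -> /ltW].
Qed.

Lemma derive_pos_local g (t d : R) : is_derive t 1 g d -> 0 < d ->
  exists2 e : R, 0 < e & (forall s, t - e < s < t -> g s < g t) /\
                     (forall s, t < s < t + e -> g t < g s).
Proof.
move=> [dg <-] d0; move/cvgrPdist_lt: dg => /(_ _ d0).
rewrite near_withinE => /nbhs_ballP[e e0 H]; exists e => //.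
have {}H h : h != 0 -> `|h| < e -> 0 < h^-1 * (g (h + t) - g t).
  move=> h0 he; have := H h; rewrite /ball /= sub0r normrN => /(_ he h0).
  rewrite /GRing.scale /= mulr1 ltr_norml => /andP[_].
  rewrite -[X in _ < X]addr0 ltrD2l oppr_lt0 => //.
split=> s /andP[h1 h2].
- have := H (s - t); rewrite subr_eq0 lt_eqF// subrK ltr0_norm ?subr_lt0//.
  move=> /(_ isT) /(_ ltac:(lra)); rewrite nmulr_rgt0 ?invr_lt0 ?subr_lt0//.
- have := H (s - t); rewrite subr_eq0 gt_eqF// subrK gtr0_norm ?subr_gt0//.
  move=> /(_ isT) /(_ ltac:(lra)); rewrite pmulr_rgt0 ?invr_gt0 ?subr_gt0//.
Qed.

(** At a first zero the derivative would be positive, so [g] would be negative just before, although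
    it is positive until then. The sign condition concerns the zero set only, which is the
    information available when an orbit crosses a line through E. *)
Lemma barrier_strict g dg (a b : R) : a <= b ->
  {within `[a, b], continuous g} ->
  (forall t, a < t <= b -> is_derive t 1 g (dg t)) ->
  (forall t, a < t <= b -> g t = 0 -> 0 < dg t) -> 0 < g a -> 0 < g b.
Proof.
move=> ab cg gd dg0 ga; rewrite ltNge; apply/negP => gb.
have [||||s [sab gs before]] := @first_time_ge (- g) a b 0.
- by [].
- by move=> t; apply: continuousN; exact: cg.
- by rewrite oppr_lt0.
- by rewrite oppr_ge0.
have {}gs : g s = 0 by apply/eqP; rewrite -oppr_eq0; apply/eqP.
have [e e0 [H _]] := derive_pos_local (gd s sab) (dg0 s sab gs).
case/andP: sab => as_ sb.
pose t := Num.max a (s - e / 2).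
have at_ : a <= t by rewrite le_max lexx.
have t2 : s - e / 2 <= t by rewrite le_max lexx orbT.
have ts : t < s by rewrite gt_max as_; lra.
have := H t; have := before t; rewrite at_ ts gs oppr_lt0 => /(_ isT).
by move=> /lt_trans h /(_ ltac:(lra)) /h; rewrite ltxx.
Qed.

End ScalarCalculus.

(** * First return maps *)

(* [lra] fails on disequalities between pairs. *)
Ltac plra := repeat match goal with
  | H : ~ (@eq (_ * _) _ _) |- _ => clear H
  | H : @eq (_ * _) _ _ |- _ => clear H end; lra.

(** * The max-norm distance in the plane *)

Section PairNorm.
Context {R : realType}.
Implicit Types (X Y Z : R * R).

Definition dist X Y : R := `|X - Y|.

Lemma dist_fst X Y : `|X.1 - Y.1| <= dist X Y.
Proof. by rewrite /dist [leRHS]prod_normE /= le_max lexx. Qed.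

Lemma dist_snd X Y : `|X.2 - Y.2| <= dist X Y.
Proof. by rewrite /dist [leRHS]prod_normE /= le_max lexx orbT. Qed.

Lemma dist_le X Y (e : R) : `|X.1 - Y.1| <= e -> `|X.2 - Y.2| <= e -> dist X Y <= e.
Proof. by move=> h1 h2; rewrite /dist [leLHS]prod_normE /= ge_max h1. Qed.

Lemma dist_col (u v w : R) : dist (u, v) (u, w) = `|v - w|.
Proof. by rewrite /dist prod_normE /= subrr normr0; apply/max_idPr. Qed.

Lemma dist_refl X : dist X X = 0. Proof. by rewrite /dist subrr normr0. Qed.

Lemma dist_sym X Y : dist X Y = dist Y X. Proof. exact: distrC. Qed.

Lemma dist_ge0 X Y : 0 <= dist X Y. Proof. exact: normr_ge0. Qed.

Lemma dist_tri Z X Y : dist X Y <= dist X Z + dist Z Y. Proof. exact: ler_distD. Qed.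

Lemma dist_small_eq X Y : (forall e : R, 0 < e -> dist X Y < e) -> X = Y.
Proof.
move=> H; apply/eqP; rewrite -subr_eq0 -normr_le0 leNgt; apply/negP => h.
by have := H _ h; rewrite ltxx.
Qed.

End PairNorm.

Lemma dist_small_eqR {R : realType} (x y : R) : (forall e : R, 0 < e -> `|x - y| < e) -> x = y.
Proof.
move=> H; apply/eqP; rewrite -subr_eq0 -normr_le0 leNgt; apply/negP => h.
by have := H _ h; rewrite ltxx.
Qed.

Lemma lipschitz_within {R : realType} (g : R -> R) (M a b : R) : 0 < M ->
  (forall s t, a <= s <= b -> a <= t <= b -> `|g s - g t| <= M * `|s - t|) ->
  {within `[a, b], continuous g}.
Proof.
move=> M0 H; apply/subspace_continuousP => t; rewrite /= in_itv /= => tab.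
apply/cvgrPdist_lt => e e0; rewrite near_withinE; apply/nbhs_ballP.
exists (e / M) => /=; first by rewrite divr_gt0.
move=> s; rewrite /ball /= in_itv /= => st sab.
by rewrite (le_lt_trans (H _ _ tab sab))// mulrC -ltr_pdivlMr.
Qed.

(** The bounds are asked only from some index on, since orbits are trapped only eventually. *)
Lemma mono_conv {R : realType} (u : nat -> R) (a b : R) :
  (forall n, u n <= u n.+1) \/ (forall n, u n.+1 <= u n) ->
  (exists N, forall n, (N <= n)%N -> a <= u n <= b) ->
  exists2 l, a <= l <= b & forall e : R, 0 < e ->
    exists N, forall n, (N <= n)%N -> `|u n - l| < e.
Proof.
wlog up : u a b / forall n, u n <= u n.+1.
  move=> H [up|dn] [N hN]; first by apply: H => //; [left|exists N].
  have up' n : - u n <= - u n.+1 by rewrite lerN2.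
  have [|l lab hl] := H (fun n => - u n) (- b) (- a) up' (or_introl up').
    by exists N => n /hN; rewrite !lerN2 andbC.
  exists (- l); first by rewrite lerNr lerNl andbC.
  by move=> e /hl[N' hN']; exists N' => n /hN'; rewrite -opprD normrN opprK.
move=> _ [N hN].
have mono m n : (m <= n)%N -> u m <= u n by move=> mn; exact: (homo_leq le_refl le_trans up).
have ub n : u n <= b.
  have [h1 h2] := (leq_maxl n N, leq_maxr n N).
  by apply: le_trans (mono _ _ h1) _; case/andP: (hN _ h2).
have hA : has_sup (range u) by split; [exists (u 0%N), 0%N|exists b => _ [n _ <-]].
exists (sup (range u)).
  apply/andP; split; last by apply: ge_sup; [exists (u 0%N), 0%N|move=> _ [n _ <-]].
  case/andP: (hN _ (leqnn N)) => h _; apply: (le_trans h).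
  by apply: ub_le_sup; [case: hA|exists N].
move=> e e0; have [_ [N' _ <-] h] := sup_adherent e0 hA.
exists N' => n hn; rewrite ltr_norml; apply/andP; split.
  by rewrite ltrBrDl; apply: lt_le_trans (mono _ _ hn).
rewrite ltrBlDl; apply: (@le_lt_trans _ _ (sup (range u))); last by rewrite ltrDl.
by apply: ub_le_sup; [case: hA|exists n].
Qed.

(** * An abstract semiflow turning around the point [(us, vs)] *)

Section Return.
Context {R : realType}.
Variables (S : set (R * R)) (T : R -> R * R -> R * R) (us vs : R).
Implicit Types (X Y Z : R * R) (t s w : R).

Definition below X := X.1 = us /\ X.2 < vs.

Hypothesis T0 : forall X, S X -> T 0 X = X.
Hypothesis TS : forall X t, S X -> 0 <= t -> S (T t X).
Hypothesis TD : forall X s t, S X -> 0 <= s -> 0 <= t -> T (s + t) X = T t (T s X).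
Hypothesis Tinj : forall X Y t, S X -> S Y -> 0 <= t -> T t X = T t Y -> X = Y.
Hypothesis Tlip : forall D : R, exists2 K : R, 0 < K & forall X Y t, S X -> S Y ->
  0 <= t <= D -> dist (T t X) (T t Y) <= K * dist X Y.
Variable M : R.
Hypothesis M0 : 0 < M.
Hypothesis Tmod : forall X s t, S X -> 0 <= s -> 0 <= t -> dist (T s X) (T t X) <= M * `|s - t|.
Hypothesis S_pos : forall X, S X -> 0 < X.2.
Hypothesis secS : forall w, 0 < w < vs -> S (us, w).
Hypothesis SE : S (us, vs).
Hypothesis TE : forall t, 0 <= t -> T t (us, vs) = (us, vs).
(** Transversality, uniform over all nearby starting points and all short times. It bounds return
    times from below, isolates the crossings and fixes their direction. *)
Hypothesis up : forall w, 0 < w < vs -> exists2 d : R, 0 < d & forall Z, S Z ->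
  dist Z (us, w) < d -> forall t, 0 < t < d -> Z.1 < (T t Z).1.
Hypothesis hit : forall X, S X -> X <> (us, vs) -> forall t0, exists t, [/\ t0 < t, 0 < t & below (T t X)].

Lemma TnE X t : S X -> X <> (us, vs) -> 0 <= t -> T t X <> (us, vs).
Proof. by move=> SX XE t0 h; apply: XE; apply: (@Tinj _ _ t) => //; rewrite h TE. Qed.

Lemma below_nE X : below X -> X <> (us, vs).
Proof. by move=> [_ +] h; rewrite h /= ltxx. Qed.

Lemma below_col w : w < vs -> below (us, w).
Proof. by []. Qed.

Lemma belowE X : S X -> below X -> exists2 w, 0 < w < vs & X = (us, w).
Proof.
move=> SX [h1 h2]; exists X.2; first by rewrite S_pos.
by rewrite -h1; case: X {SX h1 h2}.
Qed.

(** The only limit point missing from the half line is its endpoint E. Limits of crossings along an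
    orbit avoid E, because an orbit does not reach E in finite time ([TnE]). *)
Lemma below_closed Z : Z <> (us, vs) ->
  (forall e : R, 0 < e -> exists2 Y, below Y & dist Y Z < e) -> below Z.
Proof.
move=> ZE H.
have h1 : Z.1 = us.
  apply: dist_small_eqR => e /H[Y [Y1 _]]; apply: le_lt_trans.
  by rewrite -Y1 distrC; exact: dist_fst.
split => //; rewrite lt_neqAle; apply/andP; split.
  by apply/eqP => h2; apply: ZE; rewrite -h1 -h2; case: (Z).
rewrite leNgt; apply/negP => h2.
have [|Y [_ Y2]] := H (Z.2 - vs); first by rewrite subr_gt0.
move=> h; have := le_lt_trans (dist_snd Y Z) h.
by rewrite ltr_norml => /andP[h3 h4]; plra.
Qed.

(** The infimum of the positive crossing times is positive by [up]. It is attained because the half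
    line is closed away from E and orbits are Lipschitz in time. *)
Lemma first_return w : 0 < w < vs -> exists tp : R * R,
  [/\ 0 < tp.1, T tp.1 (us, w) = (us, tp.2), 0 < tp.2 < vs
    & forall t, 0 < t < tp.1 -> ~ below (T t (us, w))].
Proof.
move=> w0; have SX := secS w0; set X := (us, w) in SX *.
have XE : X <> (us, vs) by apply: below_nE; case/andP: w0.
have [d d0 hd] := up w0.
pose A := [set t | 0 < t /\ below (T t X)].
have Ad t : A t -> d <= t.
  move=> [t0 [h _]]; rewrite leNgt; apply/negP => td.
  have := hd X SX; rewrite dist_refl => /(_ d0 t); rewrite t0 td => /(_ isT).
  by rewrite h ltxx.
have hA : has_inf A.
  split; last by exists d => t /Ad.
  by have [t [_ t0 ht]] := hit SX XE 0; exists t.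
pose tau := inf A.
have taud : d <= tau by apply: lb_le_inf; [case: hA|move=> t /Ad].
have tau0 : 0 < tau by apply: lt_le_trans taud.
have Ah : below (T tau X).
  apply: below_closed; first by apply: TnE => //; exact: ltW.
  move=> e e0; have [|t [t0 ht] tt] := @inf_adherent _ A (e / M) _ hA; first by rewrite divr_gt0.
  exists (T t X) => //; apply: le_lt_trans (Tmod SX (ltW t0) (ltW tau0)) _.
  rewrite mulrC -ltr_pdivlMr// ger0_norm; first by rewrite ltrBlDl.
  by rewrite subr_ge0; apply: ge_inf; [case: hA|].
have [p p0 hp] := belowE (TS SX (ltW tau0)) Ah.
exists (tau, p); split => //= t /andP[t0 tt] ht.
by have : tau <= t; [apply: ge_inf; [case: hA|]|rewrite leNgt tt].
Qed.

(** * The return map [Pi] and the return time [tau] *)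

Section Map.
Variables (tau Pi : R -> R).
Hypothesis HR : forall w, 0 < w < vs ->
  [/\ 0 < tau w, T (tau w) (us, w) = (us, Pi w), 0 < Pi w < vs
    & forall t, 0 < t < tau w -> ~ below (T t (us, w))].

Ltac slra := clear -T0 TS TD Tinj Tlip M0 Tmod S_pos secS SE TE up hit HR; lra.

Lemma tau_gt0 w : 0 < w < vs -> 0 < tau w. Proof. by case/HR. Qed.
Lemma Pi_itv w : 0 < w < vs -> 0 < Pi w < vs. Proof. by case/HR. Qed.
Lemma tauE w : 0 < w < vs -> T (tau w) (us, w) = (us, Pi w). Proof. by case/HR. Qed.

Lemma tau_min w t : 0 < w < vs -> 0 < t -> below (T t (us, w)) -> tau w <= t.
Proof.
move=> w0 t0 ht; rewrite leNgt; apply/negP => h.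
by have [_ _ _ /(_ t)] := HR w0; rewrite t0 h => /(_ isT).
Qed.

Lemma first_return_unique w t w' : 0 < w < vs -> 0 < t -> T t (us, w) = (us, w') -> w' < vs ->
  (forall s, 0 < s < t -> ~ below (T s (us, w))) -> t = tau w /\ w' = Pi w.
Proof.
move=> w0 t0 ht w's hs.
have tt : t = tau w.
  apply/eqP; rewrite eq_le tau_min// ?ht// andbT leNgt; apply/negP => h.
  apply: (hs (tau w)); first by rewrite tau_gt0.
  by rewrite tauE//; split => //=; case/andP: (Pi_itv w0).
by split=> //; move: ht; rewrite tt tauE// => -[].
Qed.

(** Transversality replaces an implicit function theorem. An orbit starting nearby cannot cross
    before [d1] by [up], nor between [d1] and [t - eta], where the reference orbit keeps clear of
    the half line. It must cross between [t - eta] and [t + eta], because there it passes from the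
    left to the right of the line [us]. *)
Lemma Pi_continuous w0 : 0 < w0 < vs -> forall e : R, 0 < e ->
  exists2 d : R, 0 < d & forall w, 0 < w < vs -> `|w - w0| < d ->
    `|Pi w - Pi w0| < e /\ `|tau w - tau w0| < e.
Proof.
move=> hw0 e e0.
have SX := secS hw0; set X := (us, w0) in SX *.
have XE : X <> (us, vs) by apply: below_nE; case/andP: hw0.
have [d1 d10 up1] := up hw0.
have [d2 d20 up2] := up (Pi_itv hw0).
have [t0 hY /andP[p0 pvs] nbelow] := HR hw0.
move: (tau w0) t0 hY nbelow => t t0 hY nbelow.
have d1t : d1 <= t.
  rewrite leNgt; apply/negP => td.
  have := up1 X SX; rewrite dist_refl => /(_ d10 t); rewrite t0 td => /(_ isT).
  by rewrite hY /= ltxx.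
have [g [g0 ge_ gd gv]] : exists g, [/\ 0 < g, g <= e, g <= d2 & g <= vs - Pi w0].
  exists (Num.min (Num.min e d2) (vs - Pi w0)); split; rewrite ?ge_min ?lexx ?orbT//.
  by rewrite !lt_min e0 d20 subr_gt0.
(* [eta] keeps [t - eta] at or above [d1 / 2], and the reference orbit moves by at most [g / 4]
   within this time; [g] in turn is below [e], [d2] and the gap [vs - Pi w0]. *)
have [eta [eta0 etad etag etaM]] : exists eta,
    [/\ 0 < eta, eta <= d1 / 2, eta <= g / 2 & M * eta <= g / 4].
  exists (Num.min (Num.min (d1 / 2) (g / 2)) (g / (4 * M))).
  split; rewrite ?ge_min ?lexx ?orbT//; first by rewrite !lt_min !divr_gt0 ?mulr_gt0.
  by rewrite mulrC -ler_pdivlMr// ge_min; apply/orP; right; rewrite invfM mulrA.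
have te : 0 <= t - eta by plra.
have Zm : (T (t - eta) X).1 < us.
  have := up2 (T (t - eta) X) (TS SX te).
  rewrite -hY; have := Tmod SX te (ltW t0).
  have -> : t - eta - t = - eta by plra.
  rewrite normrN (gtr0_norm eta0).
  move=> h /(_ ltac:(plra) eta ltac:(plra)).
  by rewrite -TD//; [rewrite subrK hY|plra].
have Zp : us < (T (t + eta) X).1.
  rewrite TD//; [|plra|plra].
  rewrite hY; have := up2 (us, Pi w0) (secS (Pi_itv hw0)).
  by rewrite dist_refl => /(_ d20 eta); apply; plra.
(* [phi s <= 0] holds exactly when the point is on the half line or equal to E. So [phi] is a
   continuous measure of the clearance from the section, and its minimum over a compact time
   interval without crossings is positive. *)
pose phi s := Num.max `|(T s X).1 - us| ((T s X).2 - vs).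
have phi_cont : {within `[d1 / 2, t - eta], continuous phi}.
  apply: (lipschitz_within M0) => r s /andP[r1 _] /andP[s1 _].
  have /(Tmod SX) H : 0 <= r by move: d10 r1; slra.
  have {}/H H : 0 <= s by move: d10 s1; slra.
  have h1 := dist_fst (T r X) (T s X); have h2 := dist_snd (T r X) (T s X).
  move: (le_trans h1 H) (le_trans h2 H); rewrite !ler_norml.
  move=> /andP[a1 a2] /andP[b1 b2].
  have h3 := ler_dist_dist ((T r X).1 - us) ((T s X).1 - us).
  have {h3} : `| `|(T r X).1 - us| - `|(T s X).1 - us| | <= M * `|r - s|.
    by apply: le_trans h3 _; rewrite ler_norml; apply/andP; split; move: a1 a2; slra.
  rewrite ler_norml => /andP[c1 c2]; rewrite /phi.
  by apply/andP; split; case: (leP `|(T r X).1 - us|); case: (leP `|(T s X).1 - us|) ; move: c1 c2 b1 b2; slra.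
have [|r rin rmin] := @EVT_min _ phi (d1 / 2) (t - eta) _ phi_cont; first by plra.
have phi_pos : 0 < phi r.
  rewrite ltNge; apply/negP; rewrite /phi ge_max => /andP[h1 h2].
  move: rin; rewrite in_itv /= => /andP[r1 r2].
  have r0 : 0 <= r by move: d10 r1; slra.
  apply: (TnE SX XE r0).
  have e1 : (T r X).1 = us by apply/eqP; rewrite -subr_eq0 -normr_le0.
  have e2 : (T r X).2 = vs.
    apply/eqP; rewrite eq_le -subr_le0 h2 /= leNgt; apply/negP => h3.
    by apply: (nbelow r); [apply/andP; split; move: d10 eta0 r1 r2; slra|split].
  by rewrite -e1 -e2; case: (T r X).
have [K K0 HK] := Tlip (t + eta).
(* An orbit that stays within [nu] of the reference orbit inherits from it the absence of crossings
   up to [t - eta] and the side of the line at [t - eta] and [t + eta]. *)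
have [nu [nu0 nu1 nu2 [nu3 nu4]]] : exists nu, [/\ 0 < nu, nu <= phi r, nu <= g / 4 &
    nu <= us - (T (t - eta) X).1 /\ nu <= (T (t + eta) X).1 - us].
  exists (Num.min (Num.min (phi r) (g / 4)) (Num.min (us - (T (t - eta) X).1) ((T (t + eta) X).1 - us))).
  split; rewrite ?ge_min ?lexx ?orbT//.
  by rewrite !lt_min phi_pos !subr_gt0 Zm Zp divr_gt0.
exists (Num.min d1 (nu / K)); first by rewrite lt_min d10 divr_gt0.
move=> w hw; rewrite lt_min ltr_pdivlMr// mulrC => /andP[wd1 wd2].
have SW := secS hw; set W := (us, w) in SW *.
have WX : dist W X = `|w - w0| by exact: dist_col.
have near_ s : 0 <= s <= t + eta -> dist (T s W) (T s X) < nu.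
  by move=> hs; apply: le_lt_trans (HK _ _ _ SW SX hs) _; rewrite WX.
have near1 s : 0 <= s <= t + eta -> `|(T s W).1 - (T s X).1| < nu.
  by move=> /near_; apply: le_lt_trans; exact: dist_fst.
have near2 s : 0 <= s <= t + eta -> `|(T s W).2 - (T s X).2| < nu.
  by move=> /near_; apply: le_lt_trans; exact: dist_snd.
have tauw0 := tau_gt0 hw.
have tau_lb : t - eta <= tau w.
  rewrite leNgt; apply/negP => h.
  have hb := tauE hw; case/andP: (Pi_itv hw) => _ pv.
  have [h1|h1] := ltP (tau w) d1.
    have := up1 W SW; rewrite WX => /(_ wd1 (tau w)); rewrite tauw0 h1 => /(_ isT).
    by rewrite hb /= ltxx.
  have hin : tau w \in `[d1 / 2, t - eta] by rewrite in_itv /=; apply/andP; split; move: d10 h h1; slra.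
  have := rmin _ hin; rewrite leNgt => /negP; apply; apply: lt_le_trans nu1.
  have hs : 0 <= tau w <= t + eta by apply/andP; split; move: h eta0 tauw0; slra.
  move: (near1 _ hs) (near2 _ hs); rewrite hb /= distrC => n1; rewrite ltr_norml => /andP[n2 n3].
  by rewrite /phi gt_max n1 /=; move: n2 n3 pv; slra.
have [c] : exists2 c, c \in `[t - eta, t + eta] & (T c W).1 = us.
  apply: (@IVT _ (fun s => (T s W).1)); first by move: eta0; slra.
    apply: (lipschitz_within M0) => r' s /andP[r1 _] /andP[s1 _].
    apply: le_trans (dist_fst _ _) _; apply: Tmod => //; move: te r1 s1; slra.
  have hs1 : 0 <= t - eta <= t + eta by apply/andP; split; move: te eta0; slra.
  have hs2 : 0 <= t + eta <= t + eta by apply/andP; split; move: te eta0; slra.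
  move: (near1 _ hs1) (near1 _ hs2); rewrite !ltr_norml => /andP[q1 q2] /andP[q3 q4].
  by rewrite ge_min le_max; apply/andP; split; apply/orP; [left|right]; move: nu3 nu4 q1 q2 q3 q4; slra.
rewrite in_itv /= => /andP[c1 c2] hc.
have ct : M * `|c - t| <= g / 4.
  by apply: le_trans etaM; rewrite ler_wpM2l ?(ltW M0)// ler_norml; apply/andP; split; move: c1 c2; slra.
have cs : 0 <= c <= t + eta by apply/andP; split; move: te c1 c2; slra.
have bc : below (T c W).
  split => //; have c0 : 0 <= c by move: te c1; slra.
  have := le_trans (dist_snd _ _) (Tmod SX c0 (ltW t0)).
  rewrite hY ler_norml /= => /andP[_ m1].
  have := near2 _ cs; rewrite ltr_norml => /andP[_ m2]; move: m1 m2 ct nu2 gv g0; slra.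
have tau_ub : tau w <= c by apply: tau_min => //; plra.
have tt : `|tau w - t| <= eta by rewrite ler_norml; apply/andP; split; move: tau_lb tau_ub c2; slra.
split; last by apply: le_lt_trans tt _; move: etag ge_ g0; slra.
rewrite -(dist_col us) -tauE// -hY -/W.
have hs : 0 <= tau w <= t + eta by apply/andP; split; move: tauw0 tau_ub c2; slra.
have h1 := near_ _ hs; have h2 := Tmod SX (ltW tauw0) (ltW t0).
have h3 : M * `|tau w - t| <= g / 4 by apply: le_trans etaM; rewrite ler_wpM2l ?(ltW M0).
have := dist_tri (T (tau w) X) (T (tau w) W) (T t X); move: h1 h2 h3 nu2 ge_ g0; slra.
Qed.

(** Go backwards from the common image. By injectivity of the semiflow the start with the shorter
    return time lies on the orbit of the other one, and would be an earlier return of it unless both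
    times agree. *)
Lemma Pi_inj w w' : 0 < w < vs -> 0 < w' < vs -> Pi w = Pi w' -> w = w'.
Proof.
wlog tt : w w' / tau w <= tau w'.
  by move=> H hw hw' e; have [h|/ltW h] := leP (tau w) (tau w'); [|symmetry]; apply: H.
move=> hw hw' e; have t0 := tau_gt0 hw; have t0' := tau_gt0 hw'.
have SW : S (T (tau w' - tau w) (us, w')) by apply: TS; [exact: secS|rewrite subr_ge0].
have h : (us, w) = T (tau w' - tau w) (us, w').
  apply: (Tinj (secS hw) SW (ltW t0)).
  rewrite -TD ?subrK ?subr_ge0//; [by rewrite !tauE// e|exact: secS|exact: ltW].
move: tt; rewrite le_eqVlt => /orP[/eqP tt|tt].
  by move: h; rewrite tt subrr T0; [case|exact: secS].
have := @tau_min w' (tau w' - tau w) hw'; rewrite subr_gt0 tt -h => /(_ isT).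
by case/andP: (hw) => _ wv /(_ (below_col wv)); rewrite lerBrDl gerDr leNgt t0.
Qed.

Lemma Pi_mono :
  (forall w w', 0 < w < vs -> 0 < w' < vs -> w < w' -> Pi w < Pi w') \/
  (forall w w', 0 < w < vs -> 0 < w' < vs -> w < w' -> Pi w' < Pi w).
Proof.
have cont : {within `]0, vs[, continuous Pi}.
  apply/subspace_continuousP => w; rewrite /= in_itv /= => hw.
  apply/cvgrPdist_lt => e e0; rewrite near_withinE; apply/nbhs_ballP.
  have [d d0 H] := Pi_continuous hw e0; exists d => // w'; rewrite /ball /= in_itv /= => h hw'.
  by rewrite distrC; apply: (H _ hw' _).1; rewrite distrC.
have inj : {in `]0, vs[ &, injective Pi}.
  by move=> x y; rewrite !in_itv /=; exact: Pi_inj.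
case: (itv_continuous_inj_mono cont inj) => H; [left|right] => w w' hw hw' h.
  by apply: H; rewrite ?in_itv.
by apply: H; rewrite ?in_itv.
Qed.

Definition PiPi w := Pi (Pi w).

Lemma PiPi_lt w w' : 0 < w < vs -> 0 < w' < vs -> w < w' -> PiPi w < PiPi w'.
Proof. by move=> hw hw' h; case: Pi_mono => H; exact: H (Pi_itv _) (Pi_itv _) (H _ _ hw _ h). Qed.

Lemma PiPi_continuous w0 : 0 < w0 < vs -> forall e : R, 0 < e ->
  exists2 d : R, 0 < d & forall w, 0 < w < vs -> `|w - w0| < d ->
    `|PiPi w - PiPi w0| < e.
Proof.
move=> hw e e0; have [d1 d10 H1] := Pi_continuous (Pi_itv hw) e0.
have [d d0 H] := Pi_continuous hw d10; exists d => // w hw' h.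
by apply: (H1 _ (Pi_itv hw') _).1; apply: (H _ hw' h).1.
Qed.

Lemma PiPi_period w : 0 < w < vs -> T (tau w + tau (Pi w)) (us, w) = (us, PiPi w).
Proof.
move=> hw; rewrite TD ?tauE// ?Pi_itv//; [exact: secS|exact/ltW/tau_gt0|].
exact/ltW/tau_gt0/Pi_itv.
Qed.

(** The form in which uniqueness of the periodic orbit enters the study of [Pi]. *)
Hypothesis one_orbit : forall p q th th', 0 < p < vs -> 0 < q < vs -> 0 < th -> 0 < th' ->
  T th (us, p) = (us, p) -> T th' (us, q) = (us, q) ->
  exists2 t, 0 <= t & T t (us, p) = (us, q).
Variables a b : R.
Hypothesis a0 : 0 < a.
Hypothesis bv : b < vs.
Hypothesis trap : forall X, S X -> X <> (us, vs) -> exists t0, forall t, t0 <= t -> 0 <= t ->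
  below (T t X) -> a <= (T t X).2 <= b.

(** Subtract whole periods until [t] is smaller than [tau p + tau (Pi p)]. Within one period the
    only crossings are the start and the first return. *)
Lemma orbit_hits p q t : 0 < p < vs -> 0 < q < vs -> PiPi p = p -> 0 <= t ->
  T t (us, p) = (us, q) -> q = p \/ q = Pi p.
Proof.
move=> hp hq fp t0; set th := tau p + tau (Pi p).
have [tp tpp] := (tau_gt0 hp, tau_gt0 (Pi_itv hp)).
have th0 : 0 < th by rewrite addr_gt0.
have Tth : T th (us, p) = (us, p) by rewrite PiPi_period// fp.
have [n tn] : exists n : nat, t < th * n%:R.
  exists (Num.bound (t / th)); rewrite mulrC -ltr_pdivrMr//.
  by have := archi_boundP (divr_ge0 t0 (ltW th0)).
elim: n t t0 tn => [|n IH] t t0 tn ht; first by exfalso; move: tn; rewrite mulr0; lra.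
have [tth|tth] := leP th t.
  apply: (IH (t - th)); rewrite ?subr_ge0//.
    by move: tn; rewrite mulrS; lra.
  have SP := secS hp.
  have e : t = th + (t - th) by rewrite addrC subrK.
  by rewrite -ht [in RHS]e (TD SP (ltW th0)) ?subr_ge0// Tth.
case/andP: (hq) => _ /below_col bq.
move: t0; rewrite le_eqVlt => /orP[/eqP t0|t0].
  by left; move: ht; rewrite -t0 T0; [case|exact: secS].
have := tau_min hp t0; rewrite ht => /(_ bq); rewrite le_eqVlt => /orP[/eqP e|tpt].
  by right; move: ht; rewrite -e tauE// => -[].
have h : T (t - tau p) (us, Pi p) = (us, q).
  have SP := secS hp.
  by rewrite -tauE// -(TD SP (ltW tp)) ?subr_ge0 ?(ltW tpt)// addrC subrK.
have := @tau_min (Pi p) (t - tau p) (Pi_itv hp); rewrite h subr_gt0 => /(_ tpt bq).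
by move: tth; rewrite /th; lra.
Qed.

(** Two fixed points [p < q] lie on one orbit, so [Pi] exchanges them, which an increasing map
    cannot do. In the decreasing case the intermediate value theorem gives a fixed point [c] of [Pi]
    between them; its orbit meets the half line only at [c], which forces [p = c = q]. *)
Lemma PiPi_fix_unique p q : 0 < p < vs -> 0 < q < vs -> PiPi p = p -> PiPi q = q -> p = q.
Proof.
wlog pq : p q / p < q.
  by move=> H hp hq fp fq; have [h|h|//] := ltgtP p q; [|symmetry]; apply: H.
move=> hp hq fp fq.
have per r : 0 < r < vs -> PiPi r = r -> exists2 th, 0 < th & T th (us, r) = (us, r).
  move=> hr fr; exists (tau r + tau (Pi r)); last by rewrite PiPi_period// fr.
  by rewrite addr_gt0 ?tau_gt0 ?Pi_itv.
have fix2 r r' : 0 < r < vs -> 0 < r' < vs -> PiPi r = r -> PiPi r' = r' -> r' = r \/ r' = Pi r.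
  move=> hr hr' fr fr'; have [th th0 Tth] := per _ hr fr; have [th' th0' Tth'] := per _ hr' fr'.
  have [t t0 ht] := one_orbit hr hr' th0 th0' Tth Tth'.
  exact: (orbit_hits hr hr' fr t0 ht).
have [e|qp] := fix2 _ _ hp hq fp fq; first by rewrite e ltxx in pq.
have pq' : Pi q = p by rewrite qp.
case: Pi_mono => mono.
  by have := mono _ _ hp hq pq; rewrite -qp pq' => /lt_trans/(_ pq); rewrite ltxx.
have [||c] := @IVT _ (fun r => Pi r - r) p q 0 (ltW pq).
- apply/subspace_continuousP => w; rewrite /= in_itv /= => /andP[pw wq].
  have hw : 0 < w < vs by case/andP: hp => p0 _; case/andP: hq => _ qv; apply/andP; split; lra.
  apply: cvgB; last exact: cvg_within.
  apply/cvgrPdist_lt => e e0; rewrite near_withinE; apply/nbhs_ballP.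
  have [d d0 H] := Pi_continuous hw e0; exists d => // w'; rewrite /ball /= in_itv /= => h /andP[pw' wq'].
  have hw' : 0 < w' < vs by case/andP: hp => p0 _; case/andP: hq => _ qv; apply/andP; split; lra.
  by rewrite distrC; apply: (H _ hw' _).1; rewrite distrC.
- by rewrite ge_min le_max -qp pq'; apply/andP; split; apply/orP; [right|left]; lra.
rewrite in_itv /= => /andP[pc cq] /eqP; rewrite subr_eq0 => /eqP fc.
have hc : 0 < c < vs by case/andP: hp => p0 _; case/andP: hq => _ qv; apply/andP; split; lra.
have fc2 : PiPi c = c by rewrite /PiPi fc.
have [e1|e1] := fix2 _ _ hc hp fc2 fp; have [e2|e2] := fix2 _ _ hc hq fc2 fq;
  by move: pq; rewrite e1 e2 ?fc ltxx.
Qed.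

Fixpoint ctime w n : R := if n is k.+1 then ctime w k + tau (iter k Pi w) else 0.

Lemma iter_Pi_itv n w : 0 < w < vs -> 0 < iter n Pi w < vs.
Proof. by move=> hw; elim: n => //= n; exact: Pi_itv. Qed.

Lemma ctime_lt n w : 0 < w < vs -> ctime w n < ctime w n.+1.
Proof. by move=> hw; rewrite /= ltrDl tau_gt0// iter_Pi_itv. Qed.

Lemma ctime_ge0 n w : 0 < w < vs -> 0 <= ctime w n.
Proof. by move=> hw; elim: n => // n /le_trans; apply; exact/ltW/ctime_lt. Qed.

Lemma ctime_homo w m n : 0 < w < vs -> (m <= n)%N -> ctime w m <= ctime w n.
Proof.
move=> hw mn.
exact: (@homo_leq _ (ctime w) _ le_refl le_trans (fun k => ltW (ctime_lt k hw)) _ _ mn).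
Qed.

Lemma ctimeE n w : 0 < w < vs -> T (ctime w n) (us, w) = (us, iter n Pi w).
Proof.
move=> hw; elim: n => [|n IH] /=; first by rewrite T0//; exact: secS.
rewrite TD ?ctime_ge0 ?IH ?tauE ?iter_Pi_itv//; first exact: secS.
exact/ltW/tau_gt0/iter_Pi_itv.
Qed.

(** Return times cannot accumulate: at a finite limit [s] the orbit would be on the half line, and
    [up] near that point forbids two crossings in quick succession. *)
Lemma ctime_unbounded w B : 0 < w < vs -> exists n, B < ctime w n.
Proof.
move=> hw; apply: contrapT => /forallNP H.
have {}H n : ctime w n <= B by rewrite leNgt; apply/negP.
have SX := secS hw; set X := (us, w) in SX.
have XE : X <> (us, vs) by apply: below_nE; case/andP: hw.
have hA : has_sup (range (ctime w)).
  by split; [exists 0, 0%N|exists B => _ [n _ <-]].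
pose s := sup (range (ctime w)).
have cs n : ctime w n <= s by apply: ub_le_sup; [case: hA|exists n].
have s0 : 0 <= s by apply: le_trans (cs 0%N).
have bel n : below (T (ctime w n) X).
  by rewrite ctimeE//; case/andP: (iter_Pi_itv n hw) => _ /below_col.
have close e : 0 < e -> exists n, dist (T (ctime w n) X) (T s X) < e.
  move=> e0; have [|_ [n _ <-] hn] := @sup_adherent _ _ (e / M) _ hA; first by rewrite divr_gt0.
  exists n; apply: le_lt_trans (Tmod SX (ctime_ge0 n hw) s0) _.
  rewrite mulrC -ltr_pdivlMr// distrC ger0_norm ?subr_ge0//.
  by move: hn; rewrite -/s; lra.
have : below (T s X).
  apply: below_closed; first exact: TnE.
  by move=> e /close[n hn]; exists (T (ctime w n) X).
move=> /(belowE (TS SX s0))[z hz sz]; have [d d0 hd] := up hz.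
have [|_ [n _ <-] hn] := @sup_adherent _ _ (Num.min d (d / M)) _ hA.
  by rewrite lt_min d0 divr_gt0.
have {hn} [hn1 hn2] : s - ctime w n < d /\ s - ctime w n < d / M.
  have : s - ctime w n < Num.min d (d / M) by move: hn; rewrite -/s; lra.
  by rewrite lt_min => /andP[].
have c0 := ctime_ge0 n hw.
have cn := ctime_lt n hw.
have := hd _ (TS SX c0); rewrite -sz.
have -> : dist (T (ctime w n) X) (T s X) < d.
  apply: le_lt_trans (Tmod SX c0 s0) _; rewrite mulrC -ltr_pdivlMr// distrC ger0_norm ?subr_ge0//.
have r0 : 0 <= ctime w n.+1 - ctime w n by rewrite subr_ge0 ltW.
have er : ctime w n + (ctime w n.+1 - ctime w n) = ctime w n.+1 by rewrite addrC subrK.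
move=> /(_ isT (ctime w n.+1 - ctime w n)).
rewrite -(TD SX c0 r0) er (bel n).1 (bel n.+1).1 ltxx subr_gt0 cn.
move=> F; suff : false by []; apply: F; apply: le_lt_trans hn1; rewrite lerD2r.
exact: cs.
Qed.

Lemma iter_Pi_trap w : 0 < w < vs -> exists N, forall n, (N <= n)%N -> a <= iter n Pi w <= b.
Proof.
move=> hw; have SX := secS hw.
have [|t0 ht] := trap SX; first by apply: below_nE; case/andP: hw.
have [N hN] := ctime_unbounded t0 hw; exists N => n Nn.
have := ht (ctime w n) (le_trans (ltW hN) (ctime_homo hw Nn)) (ctime_ge0 n hw).
by rewrite ctimeE//; apply; case/andP: (iter_Pi_itv n hw) => _ /below_col.
Qed.

Lemma iter_PiPi n w : iter n PiPi w = iter n.*2 Pi w.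
Proof. by elim: n => //= n ->. Qed.

(** [PiPi] is increasing whichever way [Pi] is monotone, so its iterates form a monotone sequence.
    [trap] keeps them away from both ends of the section, so the limit is again a point of the
    section, and continuity makes it a fixed point. *)
Lemma iter_PiPi_conv w : 0 < w < vs -> exists m, [/\ 0 < m < vs, PiPi m = m &
  forall e : R, 0 < e -> exists N, forall n, (N <= n)%N -> `|iter n PiPi w - m| < e].
Proof.
move=> hw; have [N hN] := iter_Pi_trap hw.
have it n : 0 < iter n PiPi w < vs by rewrite iter_PiPi iter_Pi_itv.
have [||m mab hm] := @mono_conv _ (fun n => iter n PiPi w) a b.
- have [h|h|h] := ltgtP w (PiPi w).
  + by left; elim=> [|n IH]; [exact: ltW|move: IH; rewrite !le_eqVlt => /orP[/eqP e|/PiPi_lt IH]; apply/orP; [left; rewrite iterS e|right; exact: IH]].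
  + by right; elim=> [|n IH]; [exact: ltW|move: IH; rewrite !le_eqVlt => /orP[/eqP e|/PiPi_lt IH]; apply/orP; [left; rewrite [X in _ == X]iterS -e|right; exact: IH]].
  + by left=> n; rewrite iterSr -h.
- by exists N => n Nn; rewrite iter_PiPi hN// (leq_trans Nn)// -addnn leq_addr.
have hm0 : 0 < m < vs by case/andP: mab => h1 h2; rewrite (lt_le_trans a0 h1) (le_lt_trans h2 bv).
exists m; split => //; apply: dist_small_eqR => e e0.
have e20 : 0 < e / 2 by rewrite divr_gt0.
have [d d0 Hd] := PiPi_continuous hm0 e20.
have [N1 h1] := hm _ d0; have [N2 h2] := hm _ e20.
pose n := maxn N1 N2.
have := Hd _ (it n) (h1 n (leq_maxl _ _)); rewrite -[PiPi (iter _ _ _)]iterS.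
have := h2 n.+1 (leqW (leq_maxr _ _)).
rewrite !ltr_norml => /andP[q1 q2] /andP[q3 q4]; apply/andP; split; lra.
Qed.

(** [Pi m] is also fixed by [PiPi], so uniqueness gives [Pi m = m]. The even and odd iterates of
    [Pi] are iterates of [PiPi] started at [w] and at [Pi w]; both tend to [m]. *)
Lemma Pi_fixpoint : 0 < vs -> exists m, [/\ 0 < m < vs, Pi m = m &
  forall w, 0 < w < vs -> forall e : R, 0 < e -> exists N, forall n, (N <= n)%N -> `|iter n Pi w - m| < e].
Proof.
move=> vs0.
have [|m [hm fm _]] := @iter_PiPi_conv (vs / 2); first by apply/andP; split; lra.
have uniq p : 0 < p < vs -> PiPi p = p -> p = m by move=> hp fp; exact: PiPi_fix_unique.
have pm : Pi m = m by apply: uniq; [exact: Pi_itv|rewrite -[in RHS]fm].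
exists m; split => // w hw e e0.
have [m1 [hm1 /(uniq _ hm1)-> /(_ _ e0)[N1 hN1]]] := iter_PiPi_conv hw.
have [m2 [hm2 /(uniq _ hm2)-> /(_ _ e0)[N2 hN2]]] := iter_PiPi_conv (Pi_itv hw).
exists (maxn N1 N2).*2.+1 => n hn; rewrite -[n]odd_double_half.
have hn2 : (maxn N1 N2 <= n./2)%N.
  by rewrite -leq_double; have := odd_double_half n; case: odd => /=; rewrite ?add0n ?add1n => h; [rewrite -ltnS h|rewrite h]; apply: leq_trans hn.
case: odd; rewrite ?add1n ?add0n.
  by rewrite iterSr -iter_PiPi; apply: hN2; apply: leq_trans hn2; exact: leq_maxr.
by rewrite -iter_PiPi; apply: hN1; apply: leq_trans hn2; exact: leq_maxl.
Qed.

(** * Forward and backward orbits relative to the fixed point of [Pi] *)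

Section Attraction.
Variable m : R.
Hypothesis hm : 0 < m < vs.
Hypothesis Pim : Pi m = m.
Hypothesis conv_m : forall w, 0 < w < vs -> forall e : R, 0 < e ->
  exists N, forall n, (N <= n)%N -> `|iter n Pi w - m| < e.

Lemma PiPim : PiPi m = m. Proof. by rewrite /PiPi !Pim. Qed.

Lemma iter_PiPi_lt r n : 0 < r < vs -> PiPi r < r -> iter n PiPi r <= r.
Proof.
move=> hr h; have it k : 0 < iter k PiPi r < vs by rewrite iter_PiPi iter_Pi_itv.
elim: n => [|n]; first exact: lexx.
rewrite le_eqVlt => /orP[/eqP e|/PiPi_lt IH]; first by rewrite iterS e ltW.
by rewrite iterS ltW// (lt_trans (IH _ _) h).
Qed.

Lemma iter_PiPi_gt r n : 0 < r < vs -> PiPi r > r -> iter n PiPi r >= r.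
Proof.
move=> hr h; have it k : 0 < iter k PiPi r < vs by rewrite iter_PiPi iter_Pi_itv.
elim: n => [|n]; first exact: lexx.
rewrite le_eqVlt => /orP[/eqP e|/PiPi_lt IH]; first by rewrite iterS -e ltW.
by rewrite iterS ltW// (lt_trans h (IH _ _)).
Qed.

Lemma PiPi_fix r : 0 < r < vs -> PiPi r = r -> r = m.
Proof. by move=> hr fr; apply: PiPi_fix_unique => //; exact: PiPim. Qed.

(** Otherwise the iterates of [PiPi] would stay at or below [r] and could not converge to [m]. *)
Lemma PiPi_lt_of r : 0 < r < vs -> r < m -> r < PiPi r.
Proof.
move=> hr rm; have [//|h|h] := ltgtP r (PiPi r); last first.
  by move: rm; rewrite [X in X < _]PiPi_fix ?ltxx// -h.
have mr : 0 < m - r by rewrite subr_gt0.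
have [N hN] := conv_m hr mr.
have := hN N.*2; rewrite -addnn leq_addr => /(_ isT).
have := iter_PiPi_lt N hr h; rewrite iter_PiPi -addnn; set q := iter _ _ _ => qr.
by rewrite ltr_norml => /andP[q1 q2]; lra.
Qed.

Lemma PiPi_gt_of r : 0 < r < vs -> m < r -> PiPi r < r.
Proof.
move=> hr rm; have [h|//|h] := ltgtP r (PiPi r); last first.
  by move: rm; rewrite [X in _ < X]PiPi_fix ?ltxx// -h.
have mr : 0 < r - m by rewrite subr_gt0.
have [N hN] := conv_m hr mr.
have := hN N.*2; rewrite -addnn leq_addr => /(_ isT).
have := iter_PiPi_gt N hr h; rewrite iter_PiPi -addnn; set q := iter _ _ _ => qr.
by rewrite ltr_norml => /andP[q1 q2]; lra.
Qed.

(** [PiPi] moves points towards [m], so backwards they move away from it. Every second term of [q]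
    then forms a monotone sequence in a compact part of the section; its limit is fixed by [PiPi],
    hence equal to [m], and this is impossible for a sequence receding from [m]. *)
Lemma backward_fix (q : nat -> R) (a' b' : R) : 0 < a' -> b' < vs ->
  (forall n, a' <= q n <= b') -> (forall n, Pi (q n.+1) = q n) -> q 0%N = m.
Proof.
move=> a'0 b'v hq Pq; pose r n := q n.*2.
have hr n : 0 < r n < vs by have /andP[h1 h2] := hq n.*2; rewrite (lt_le_trans a'0)//= (le_lt_trans h2).
have Pr n : PiPi (r n.+1) = r n by rewrite /PiPi /r doubleS !Pq.
have lt_of n : r n < m -> r n.+1 < r n.
  move=> h; rewrite -(Pr n); apply: PiPi_lt_of => //; rewrite ltNge; apply/negP.
  rewrite le_eqVlt => /orP[/eqP e|/PiPi_lt h'].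
    by move: h; rewrite -Pr -e PiPim ltxx.
  by have := lt_trans (h' hm (hr _)) (_ : _ < m); rewrite Pr => /(_ h); rewrite PiPim ltxx.
have gt_of n : m < r n -> r n < r n.+1.
  move=> h; rewrite -(Pr n); apply: PiPi_gt_of => //; rewrite ltNge; apply/negP.
  rewrite le_eqVlt => /orP[/eqP e|/PiPi_lt h'].
    by move: h; rewrite -Pr e PiPim ltxx.
  by have := lt_trans (_ : m < _) (h' (hr _) hm); rewrite Pr => /(_ h); rewrite PiPim ltxx.
have lim : (forall n, r n <= r n.+1) \/ (forall n, r n.+1 <= r n) ->
    forall e : R, 0 < e -> exists N, forall n, (N <= n)%N -> `|r n - m| < e.
  move=> mono; have [|l lab hl] := mono_conv mono (a := a') (b := b').
    by exists 0%N => n _; exact: hq.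
  suff <- : l = m by [].
  have hl0 : 0 < l < vs.
    by case/andP: lab => h1 h2; rewrite (lt_le_trans a'0 h1) (le_lt_trans h2 b'v).
  apply: PiPi_fix => //; apply: dist_small_eqR => e e0.
  have e20 : 0 < e / 2 by rewrite divr_gt0.
  have [d d0 Hd] := PiPi_continuous hl0 e20.
  have [N1 h1] := hl _ d0; have [N2 h2] := hl _ e20.
  pose n := maxn N1 N2.
  have := Hd _ (hr n.+1) (h1 n.+1 (leqW (leq_maxl _ _))); rewrite Pr.
  have := h2 n (leq_maxr _ _).
  rewrite !ltr_norml => /andP[q1 q2] /andP[q3 q4]; apply/andP; split; lra.
have [h|h|//] := ltgtP (r 0%N) m.
- have rm n : r n < m by elim: n => // n IH; exact: lt_trans (lt_of _ IH) IH.
  have [|N hN] := lim (or_intror (fun n => ltW (lt_of n (rm n)))) (m - r 0%N).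
    by rewrite subr_gt0.
  have r0 n : r n <= r 0%N by elim: n => // n; apply: le_trans; exact/ltW/lt_of.
  by have := hN N (leqnn N); have := r0 N; rewrite ltr_norml => q0 /andP[q1 q2]; lra.
- have rm n : m < r n by elim: n => // n IH; exact: lt_trans IH (gt_of _ IH).
  have [|N hN] := lim (or_introl (fun n => ltW (gt_of n (rm n)))) (r 0%N - m).
    by rewrite subr_gt0.
  have r0 n : r 0%N <= r n by elim: n => // n /le_trans; apply; exact/ltW/gt_of.
  by have := hN N (leqnn N); have := r0 N; rewrite ltr_norml => q0 /andP[q1 q2]; lra.
Qed.

Lemma hit_col X : S X -> X <> (us, vs) -> exists t w, [/\ 0 <= t, 0 < w < vs & T t X = (us, w)].
Proof.
move=> SX XE; have [t [_ t0 ht]] := hit SX XE 0.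
have [w hw e] := belowE (TS SX (ltW t0)) ht.
by exists t, w; split => //; exact: ltW.
Qed.

(** From its last crossing before [t] on, the orbit is compared with that of [(us, m)]. By
    continuity of [tau] the time since that crossing is at most [tau m + 1], so one Lipschitz
    constant serves for all late [t]. *)
Lemma omega_upper X : S X -> X <> (us, vs) -> forall e : R, 0 < e -> exists t0,
  forall t, t0 <= t -> 0 <= t -> exists2 s, 0 <= s & dist (T t X) (T s (us, m)) < e.
Proof.
move=> SX XE e e0; have [t1 [w [t10 hw ht]]] := hit_col SX XE.
have [K K0 HK] := Tlip (tau m + 1).
have [d1 d10 Hd] := Pi_continuous hm ltr01.
have [|N hN] := conv_m hw (e := Num.min d1 (e / K)); first by rewrite lt_min d10 divr_gt0.
exists (t1 + ctime w N) => t tN t0.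
pose r := t - t1; have rN : ctime w N <= r by rewrite /r; lra.
have [B hB] := ctime_unbounded r hw.
have ex : exists k, r < ctime w k by exists B.
(* The least index whose return time exceeds [r] is the successor of the last crossing [n]; it is
   not 0, since [ctime w 0] is 0. *)
case: (ex_minnP ex) => -[|n]; first by rewrite ltNge => /negP; case; exact: le_trans (ctime_ge0 N hw) rN.
move=> hn min; have nr : ctime w n <= r by rewrite leNgt; apply/negP => /min; rewrite ltnn.
have Nn : (N <= n)%N.
  rewrite leqNgt; apply/negP => nN.
  by have := lt_le_trans hn (ctime_homo hw nN); rewrite ltNge rN.
have := hN _ Nn; rewrite lt_min => /andP[n1 n2].
have hit_ := iter_Pi_itv n hw.
have [_ ] := Hd _ hit_ n1; rewrite ltr_norml => /andP[_ tn].
pose s := r - ctime w n; have s0 : 0 <= s by rewrite subr_ge0.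
exists s => //.
have -> : T t X = T s (us, iter n Pi w).
  have c0 := ctime_ge0 n hw; have SW := secS hw.
  have r0 : 0 <= r := le_trans c0 nr.
  rewrite -ctimeE// -(TD SW c0 s0) -ht -(TD SX t10); last exact: addr_ge0.
  by congr T; rewrite /s /r; lra.
have sm : 0 <= s <= tau m + 1 by rewrite s0 /=; move: hn; rewrite /= /s; lra.
apply: le_lt_trans (HK _ _ _ (secS hit_) (secS hm) sm) _.
by rewrite dist_col mulrC -ltr_pdivlMr.
Qed.

(** After a late crossing, which is close to [(us, m)], the orbit follows that of [(us, m)] for the
    fixed time [s]. *)
Lemma omega_lower X : S X -> X <> (us, vs) -> forall s, 0 <= s -> forall e : R, 0 < e ->
  forall t0, exists t, [/\ t0 <= t, 0 <= t & dist (T t X) (T s (us, m)) < e].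
Proof.
move=> SX XE s s0 e e0 t0; have [t1 [w [t10 hw ht]]] := hit_col SX XE.
have [K K0 HK] := Tlip s.
have [|N1 hN1] := conv_m hw (e := e / K); first by rewrite divr_gt0.
have [N2 hN2] := ctime_unbounded t0 hw.
pose n := maxn N1 N2; have c0 := ctime_ge0 n hw.
have c2 := ctime_homo hw (leq_maxr N1 N2); rewrite -/n in c2.
have h := iter_Pi_itv n hw.
exists (t1 + (ctime w n + s)); split; [lra|lra|].
rewrite TD ?ht ?addr_ge0// TD ?ctimeE//; last exact: secS.
apply: le_lt_trans (HK _ _ s (secS h) (secS hm) _) _; first by rewrite s0 lexx.
by rewrite dist_col mulrC -ltr_pdivlMr//; apply: hN1; exact: leq_maxl.
Qed.

(** Since crossings do not accumulate, each one has an immediate predecessor. Following predecessors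
    produces a backward orbit of [Pi], to which [backward_fix] applies. *)
Lemma backward_crossing (x : R -> R * R) (a' b' : R) : (forall t, S (x t)) ->
  (forall t s, 0 <= s -> x (t + s) = T s (x t)) ->
  (forall t, exists2 s, s < t & below (x s)) -> 0 < a' -> b' < vs ->
  (forall t, below (x t) -> a' <= (x t).2 <= b') ->
  forall t, below (x t) -> x t = (us, m).
Proof.
move=> Sx Tx back a'0 b'v hab t0 ht0.
have xE s t : s <= t -> x t = T (t - s) (x s).
  by move=> st; rewrite -Tx ?subr_ge0// addrC subrK.
have pred t : exists s, below (x t) -> [/\ s < t, below (x s) & Pi (x s).2 = (x t).2].
  have [bt|nbt] := pselect (below (x t)); last by exists t.
  have [s0 s0t bs0] := back t.
  have [p hp ep] := belowE (Sx t) bt.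
  have [d d0 hd] := up hp.
  pose A := [set s | s < t /\ below (x s)].
  have hA : has_sup A by split; [exists s0|exists t => s [/ltW]].
  pose s := sup A.
  (* Division by [1 + M] makes both the elapsed time and the distance travelled smaller than [d], as
     [up] demands. *)
  have gap u : A u -> u <= t - d / (1 + M).
    move=> [ut bu]; rewrite leNgt; apply/negP => h.
    have M1 : 0 < 1 + M by rewrite addr_gt0.
    have hdt : (t - u) * (1 + M) < d by rewrite -ltr_pdivlMr//; lra.
    have tu0 : 0 < t - u by rewrite subr_gt0.
    have := hd _ (Sx u); rewrite -ep => H.
    have : (x u).1 < (T (t - u) (x u)).1.
      apply: H; last by rewrite tu0 /=; have := mulr_gt0 tu0 M0; lra.
      have := Tmod (Sx u) (lexx 0) (ltW tu0).
      rewrite (T0 (Sx u)) -(xE u t (ltW ut)) sub0r normrN (gtr0_norm tu0) => h'.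
      by apply: le_lt_trans h' _; lra.
    by rewrite -xE ?ltW// bu.1 bt.1 ltxx.
  have st : s < t.
    apply: (@le_lt_trans _ _ (t - d / (1 + M))); first by apply: ge_sup; [exists s0|exact: gap].
    by rewrite ltrBlDr ltrDl divr_gt0// addr_gt0.
  have As u : A u -> u <= s by move=> Au; apply: ub_le_sup => //; case: hA.
  have bs : below (x s).
    apply: below_closed.
      move=> e; have := below_nE bt; rewrite (xE s t (ltW st)) e TE//.
      by rewrite subr_ge0 ltW.
    move=> e e0; have [|u [ut bu] us'] := @sup_adherent _ A (e / M) _ hA; first by rewrite divr_gt0.
    exists (x u) => //; have {}As := As u (conj ut bu).
    have su : 0 <= s - u by rewrite subr_ge0.
    have := Tmod (Sx u) (lexx 0) su.
    rewrite (T0 (Sx u)) -(xE u s As) sub0r normrN (ger0_norm su) => h'.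
    by apply: le_lt_trans h' _; rewrite mulrC -ltr_pdivlMr//; move: us'; rewrite -/s; lra.
  exists s => _; split => //.
  have [q hq eq] := belowE (Sx s) bs.
  have h := xE s t (ltW st); rewrite eq ep in h.
  have [|||_] := @first_return_unique q (t - s) p hq _ (esym h).
  - by rewrite subr_gt0.
  - by case/andP: hp.
  - move=> u /andP[u0 us']; rewrite -eq -Tx ?(ltW u0)// => bu.
    have : s + u <= s by apply: As; split => //; rewrite addrC -ltrBrDr.
    by rewrite gerDl leNgt u0.
  by rewrite eq ep => <-.
have /choice[f hf] := pred.
have bf n : below (x (iter n f t0)) by elim: n => //= n /hf[].
have h := @backward_fix (fun n => (x (iter n f t0)).2) a' b' a'0 b'v
  (fun n => hab _ (bf n)) (fun n => let: And3 _ _ e := hf _ (bf n) in e).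
by move: h; rewrite /= => <-; rewrite -ht0.1; case: (x t0).
Qed.

End Attraction.
End Map.

(** Exports what the return map yields in terms of the semiflow alone: two inclusions for
    omega-limit sets, and the identification of complete orbits that have crossed infinitely often
    in the past. *)
Theorem return_dynamics : 0 < vs ->
  (forall p q th th', 0 < p < vs -> 0 < q < vs -> 0 < th -> 0 < th' ->
    T th (us, p) = (us, p) -> T th' (us, q) = (us, q) ->
    exists2 t, 0 <= t & T t (us, p) = (us, q)) ->
  (exists a b : R, [/\ 0 < a, b < vs &
    forall X, S X -> X <> (us, vs) -> exists t0, forall t, t0 <= t -> 0 <= t ->
    below (T t X) -> a <= (T t X).2 <= b]) ->
  exists m th : R, [/\ 0 < m < vs, 0 < th & T th (us, m) = (us, m)] /\
  [/\ forall X, S X -> X <> (us, vs) -> forall e : R, 0 < e -> exists t0,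
        forall t, t0 <= t -> 0 <= t -> exists2 s, 0 <= s & dist (T t X) (T s (us, m)) < e,
      forall X, S X -> X <> (us, vs) -> forall s, 0 <= s -> forall e : R, 0 < e ->
        forall t0, exists t, [/\ t0 <= t, 0 <= t & dist (T t X) (T s (us, m)) < e]
    & forall (x : R -> R * R) (a' b' : R), (forall t, S (x t)) ->
      (forall t s, 0 <= s -> x (t + s) = T s (x t)) ->
      (forall t, exists2 s, s < t & below (x s)) -> 0 < a' -> b' < vs ->
      (forall t, below (x t) -> a' <= (x t).2 <= b') ->
      forall t, below (x t) -> x t = (us, m)].
Proof.
move=> vs0 one_orbit [a [b [a0 bv trap]]].
have /choice[f hf] : forall w, exists tp : R * R, 0 < w < vs ->
  [/\ 0 < tp.1, T tp.1 (us, w) = (us, tp.2), 0 < tp.2 < vs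
    & forall t, 0 < t < tp.1 -> ~ below (T t (us, w))].
  move=> w; have [hw|nw] := boolP (0 < w < vs); last by exists (0, 0).
  by have [tp H] := first_return hw; exists tp.
have [m [hm Pm conv]] := @Pi_fixpoint (fun w => (f w).1) (fun w => (f w).2) hf one_orbit a b a0 bv trap vs0.
have := hf _ hm; rewrite Pm => -[t0 tm _ _].
exists m, (f m).1; split; first by split.
split.
- exact: (omega_upper hf hm conv).
- exact: (omega_lower hf hm conv).
- exact: (backward_crossing hf one_orbit hm Pm conv).
Qed.

End Return.

(** * Semiflows of Lipschitz planar fields *)

Lemma is_derive_ext {R : realType} (g h : R -> R) (t d d' : R) :
  is_derive t 1 g d -> (forall s, h s = g s) -> d' = d -> is_derive t 1 h d'.
Proof. by move=> gd hg ->; rewrite (funext hg : h = g). Qed.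

Lemma within_continuousD {R : realType} (A : set R) (g h : R -> R) :
  {within A, continuous g} -> {within A, continuous h} ->
  {within A, continuous (fun t => g t + h t)}.
Proof. by move=> cg ch t; apply: continuousD; [exact: cg|exact: ch]. Qed.

Lemma within_continuousB {R : realType} (A : set R) (g h : R -> R) :
  {within A, continuous g} -> {within A, continuous h} ->
  {within A, continuous (fun t => g t - h t)}.
Proof. by move=> cg ch t; apply: continuousB; [exact: cg|exact: ch]. Qed.

Lemma within_continuousM {R : realType} (A : set R) (g h : R -> R) :
  {within A, continuous g} -> {within A, continuous h} ->
  {within A, continuous (fun t => g t * h t)}.
Proof. by move=> cg ch t; apply: continuousM; [exact: cg|exact: ch]. Qed.

Section Flow.
Context {R : realType}.
Variables (f : R * R -> R * R) (S : set (R * R)).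
Implicit Types (X Y Z : R * R) (x y : R -> R * R) (t s : R).

Lemma within_fst (A : set R) x :
  {within A, continuous x} -> {within A, continuous (fun t => (x t).1)}.
Proof.
move=> cx t; apply: (@cvg_comp _ _ _ _ _ _ (nbhs (x t)) _ (cx t)).
exact: (@cvg_fst _ _ (nbhs (x t).1) (nbhs (x t).2) _).
Qed.

Lemma within_snd (A : set R) x :
  {within A, continuous x} -> {within A, continuous (fun t => (x t).2)}.
Proof.
move=> cx t; apply: (@cvg_comp _ _ _ _ _ _ (nbhs (x t)) _ (cx t)).
exact: (@cvg_snd _ _ (nbhs (x t).1) (nbhs (x t).2) _).
Qed.

Lemma is_derive_translate x t s d :
  is_derive (s + t) 1 x d -> is_derive t 1 (fun u => x (s + u)) d.
Proof.
case=> dx <-.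
have e : (fun h : R => h^-1 *: ((fun u => x (s + u)) (h *: 1 + t) - x (s + t))) =
         (fun h => h^-1 *: (x (h *: 1 + (s + t)) - x (s + t))).
  by apply: funext => h; rewrite addrCA.
split; first by move: dx; rewrite /derivable -e.
by rewrite /derive /= -[in RHS]e.
Qed.

(** Derivatives are two-sided, so the equation is imposed at positive times only; time 0 is covered
    by one-sided continuity. *)
Definition traj x := [/\ {within `[0, +oo[, continuous x},
  solves_on f `]0, +oo[ x & forall t, 0 <= t -> S (x t)].

Lemma traj_S x t : traj x -> 0 <= t -> S (x t).
Proof. by case=> _ _; apply. Qed.

Lemma traj_derive x t : traj x -> 0 < t -> is_derive t 1 x (f (x t)).
Proof. by case=> _ h _ t0; apply: h; rewrite /= in_itv /= t0. Qed.

Lemma traj_derive1 x t : traj x -> 0 < t ->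
  is_derive t 1 (fun s => (x s).1) (f (x t)).1.
Proof. by move=> h t0; exact: is_derive_fst (traj_derive h t0). Qed.

Lemma traj_derive2 x t : traj x -> 0 < t ->
  is_derive t 1 (fun s => (x s).2) (f (x t)).2.
Proof. by move=> h t0; exact: is_derive_snd (traj_derive h t0). Qed.

Lemma traj_cont x (a b : R) : traj x -> 0 <= a -> {within `[a, b], continuous x}.
Proof.
case=> cx _ _ a0; apply: continuous_subspaceW cx => t.
by rewrite /= !in_itv /= andbT => /andP[at_ _]; exact: le_trans at_.
Qed.

Lemma traj_cont1 x (a b : R) : traj x -> 0 <= a ->
  {within `[a, b], continuous (fun t => (x t).1)}.
Proof. by move=> h a0; exact/within_fst/traj_cont. Qed.

Lemma traj_cont2 x (a b : R) : traj x -> 0 <= a ->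
  {within `[a, b], continuous (fun t => (x t).2)}.
Proof. by move=> h a0; exact/within_snd/traj_cont. Qed.

Lemma traj_shift x s : traj x -> 0 <= s -> traj (fun t => x (s + t)).
Proof.
move=> [cx dx Sx] s0; split.
- apply/subspace_continuousP => t; rewrite /= in_itv /= andbT => t0.
  move/subspace_continuousP: cx => /(_ (s + t)); rewrite /= in_itv /= andbT => /(_ (addr_ge0 s0 t0)) cx.
  apply: cvg_trans cx; move=> A; rewrite /nbhs /= /nbhs /= => /nbhs_ballP[e e0 H].
  apply/nbhs_ballP; exists e => // u; rewrite /ball /= => tu; rewrite in_itv /= andbT => u0.
  apply: H; last by rewrite /= in_itv /= andbT addr_ge0.
  by rewrite /ball /= opprD addrACA subrr add0r.
- move=> t; rewrite /= in_itv /= andbT => t0; apply: is_derive_translate.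
  by apply: dx; rewrite /= in_itv /= andbT ltr_wpDl.
- by move=> t t0; apply: Sx; rewrite addr_ge0.
Qed.

Lemma complete_traj x s : solves_on f setT x -> (forall t, S (x t)) -> traj (fun t => x (s + t)).
Proof.
move=> dx Sx; have h t : is_derive t 1 (fun t => x (s + t)) (f (x (s + t))).
  by apply: is_derive_translate; exact: dx.
split=> //; apply: derivable_within_continuous => t _; exact: (@ex_derive _ _ _ _ _ _ _ (h t)).
Qed.

Variable Lf : R.
Hypothesis Lf0 : 0 < Lf.
Hypothesis f_lip : forall X Y, S X -> S Y -> dist (f X) (f Y) <= Lf * dist X Y.
Variable M : R.
Hypothesis M0 : 0 < M.
Hypothesis f_bound : forall X, S X -> `|(f X).1| <= M /\ `|(f X).2| <= M.

(** The squared Euclidean distance: it is differentiable along orbits, which the max norm [dist] is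
    not, and it agrees with the square of [dist] up to a factor 2. *)
Definition sqd X Y := (X.1 - Y.1) ^+ 2 + (X.2 - Y.2) ^+ 2.

Lemma sqd_ge0 X Y : 0 <= sqd X Y. Proof. by rewrite addr_ge0 ?sqr_ge0. Qed.

Lemma dist_sqd X Y : dist X Y ^+ 2 <= sqd X Y.
Proof.
have [h|h] : dist X Y = `|X.1 - Y.1| \/ dist X Y = `|X.2 - Y.2|.
- by rewrite /dist prod_normE /=; case: leP => _; [right|left].
- by rewrite h real_normK ?num_real// lerDl sqr_ge0.
- by rewrite h real_normK ?num_real// lerDr sqr_ge0.
Qed.

Lemma sqd_dist X Y : sqd X Y <= 2 * dist X Y ^+ 2.
Proof.
have h (a b : R) : `|a| <= b -> a ^+ 2 <= b ^+ 2.
  by move=> ab; rewrite -(real_normK (num_real a)) lerXn2r// nnegrE ?(le_trans _ ab).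
by rewrite mulrDl !mul1r lerD// h ?dist_fst ?dist_snd.
Qed.

Definition dsqd X Y := 2 * (X.1 - Y.1) * ((f X).1 - (f Y).1) + 2 * (X.2 - Y.2) * ((f X).2 - (f Y).2).

Lemma dsqd_le X Y : S X -> S Y -> `|dsqd X Y| <= 4 * Lf * sqd X Y.
Proof.
move=> SX SY; have h := f_lip SX SY.
have d0 := dist_ge0 X Y.
apply: (@le_trans _ _ (4 * Lf * dist X Y ^+ 2)); last first.
  by rewrite ler_pM2l ?dist_sqd// mulr_gt0.
have e (a b : R) : `|a| <= dist X Y -> `|b| <= Lf * dist X Y -> `|2 * a * b| <= 2 * Lf * dist X Y ^+ 2.
  move=> ha hb; rewrite !normrM ger0_norm//.
  have := ler_pM (normr_ge0 _) (normr_ge0 _) ha hb.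
  have -> : 2 * Lf * dist X Y ^+ 2 = 2 * (dist X Y * (Lf * dist X Y)) by ring.
  by rewrite -mulrA ler_pM2l.
apply: le_trans (ler_normD _ _) _.
have := e _ _ (dist_fst X Y) (le_trans (dist_fst _ _) h).
have := e _ _ (dist_snd X Y) (le_trans (dist_snd _ _) h).
by rewrite /dsqd; lra.
Qed.

Lemma sqd_derive x y t : traj x -> traj y -> 0 < t ->
  is_derive t 1 (fun s => sqd (x s) (y s)) (dsqd (x t) (y t)).
Proof.
move=> hx hy t0.
have h1 := is_deriveB (traj_derive1 hx t0) (traj_derive1 hy t0).
have h2 := is_deriveB (traj_derive2 hx t0) (traj_derive2 hy t0).
apply: (is_derive_ext (is_deriveD (is_deriveX 2 h1) (is_deriveX 2 h2))) => [s|].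
  by rewrite !fctE.
by rewrite /GRing.scale /= /dsqd !fctE /= !expr1.
Qed.

Lemma sqd_cont x y (a b : R) : traj x -> traj y -> 0 <= a ->
  {within `[a, b], continuous (fun s => sqd (x s) (y s))}.
Proof.
move=> hx hy a0.
have h1 := within_continuousB (traj_cont1 (b := b) hx a0) (traj_cont1 (b := b) hy a0).
have h2 := within_continuousB (traj_cont2 (b := b) hx a0) (traj_cont2 (b := b) hy a0).
exact: within_continuousD (within_continuousM h1 h1) (within_continuousM h2 h2).
Qed.

Lemma exp_sqd_derive c x y s : traj x -> traj y -> 0 < s ->
  is_derive s 1 (fun u => expR (c * u) * sqd (x u) (y u))
    (expR (c * s) * (dsqd (x s) (y s) + c * sqd (x s) (y s))).
Proof.
move=> hx hy s0; have h1 := sqd_derive hx hy s0.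
have h2 : is_derive s 1 (fun s => expR (c * s)) (expR (c * s) * c).
  apply: (@is_derive1_comp _ expR (fun s => c * s)).
  apply: (is_derive_ext (is_deriveM (is_derive_cst c s 1) (is_derive_id s 1))) => //.
  by rewrite scaler0 addr0 /GRing.scale /= mulr1.
apply: (is_derive_ext (is_deriveM h2 h1)) => //.
by rewrite /GRing.scale /=; ring.
Qed.

Lemma exp_sqd_cont c x y (t : R) : traj x -> traj y ->
  {within `[0, t], continuous (fun u => expR (c * u) * sqd (x u) (y u))}.
Proof.
move=> hx hy; apply: within_continuousM; last exact: sqd_cont.
apply: continuous_subspaceT.
move=> u; apply: continuous_comp; last exact: continuous_expR.
by apply: cvgM; [exact: cvg_cst|exact: cvg_id].
Qed.

Lemma gronwall_upper x y t : traj x -> traj y -> 0 <= t ->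
  sqd (x t) (y t) <= sqd (x 0) (y 0) * expR (4 * Lf * t).
Proof.
move=> hx hy t0.
have := mvt_le t0 (exp_sqd_cont (c := - (4 * Lf)) hx hy)
  (fun u h => exp_sqd_derive (- (4 * Lf)) hx hy (proj1 (andP h))) (c := 0).
rewrite mul0r mulr0 expR0 mul1r subr_le0 mulNr expRN => H.
rewrite mulrC -ler_pdivrMl ?expR_gt0//; apply: H => u /andP[u0 _].
rewrite pmulr_rle0 ?expR_gt0// mulNr subr_le0.
by apply: le_trans (ler_norm _) (dsqd_le _ _); apply: traj_S => //; exact: ltW.
Qed.

(** This bound gives backward uniqueness, hence injectivity of the semiflow. *)
Lemma gronwall_lower x y t : traj x -> traj y -> 0 <= t ->
  sqd (x 0) (y 0) <= sqd (x t) (y t) * expR (4 * Lf * t).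
Proof.
move=> hx hy t0.
have := mvt_ge t0 (exp_sqd_cont (c := 4 * Lf) hx hy)
  (fun u h => exp_sqd_derive (4 * Lf) hx hy (proj1 (andP h))) (c := 0).
rewrite mul0r mulr0 expR0 mul1r subr_ge0 => H; rewrite [leRHS]mulrC; apply: H => u /andP[u0 _].
rewrite mulr_ge0 ?expR_ge0//.
have : `|dsqd (x u) (y u)| <= 4 * Lf * sqd (x u) (y u).
  by apply: dsqd_le; apply: traj_S => //; exact: ltW.
by rewrite ler_norml => /andP[h _]; lra.
Qed.

Lemma sqd0 X Y : sqd X Y <= 0 -> X = Y.
Proof.
move=> h; apply/eqP; rewrite -subr_eq0 -normr_eq0 -sqrf_eq0 eq_le sqr_ge0 andbT.
exact: le_trans (dist_sqd X Y) h.
Qed.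

Lemma traj_unique x y t : traj x -> traj y -> x 0 = y 0 -> 0 <= t -> x t = y t.
Proof.
move=> hx hy e t0; apply: sqd0; apply: le_trans (gronwall_upper hx hy t0) _.
by rewrite e /sqd !subrr expr0n addr0 mul0r.
Qed.

Lemma traj_inj x y t : traj x -> traj y -> 0 <= t -> x t = y t -> x 0 = y 0.
Proof.
move=> hx hy t0 e; apply: sqd0; apply: le_trans (gronwall_lower hx hy t0) _.
by rewrite e /sqd !subrr expr0n addr0 mul0r.
Qed.

Lemma traj_lip D : exists2 K : R, 0 < K & forall x y t, traj x -> traj y ->
  0 <= t <= D -> dist (x t) (y t) <= K * dist (x 0) (y 0).
Proof.
have D1 : 1 <= expR (4 * Lf * Num.max D 0).
  by rewrite -expR0 ler_expR mulr_ge0 ?le_max ?lexx ?orbT// mulr_ge0// ltW.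
(* The maximum with 0 gives an exponential [E >= 1] even for negative [D]. Then
   [2 * d0 ^+ 2 * E <= (2 * E * d0) ^+ 2], which avoids square roots. *)
exists (2 * expR (4 * Lf * Num.max D 0)); first by rewrite mulr_gt0// expR_gt0.
move=> x y t hx hy /andP[t0 tD].
set E := expR _ in D1 *; set d0 := dist (x 0) (y 0).
rewrite -ler_sqr ?nnegrE ?dist_ge0// ?mulr_ge0 ?dist_ge0 ?expR_ge0//.
apply: le_trans (dist_sqd _ _) _; apply: le_trans (gronwall_upper hx hy t0) _.
have hE : expR (4 * Lf * t) <= E.
  by rewrite ler_expR ler_pM2l ?mulr_gt0// le_max tD.
apply: (@le_trans _ _ (2 * d0 ^+ 2 * E)).
  by apply: ler_pM; rewrite ?sqd_ge0 ?expR_ge0 ?sqd_dist.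
have -> : (2 * E * d0) ^+ 2 = 2 * d0 ^+ 2 * E * (2 * E) by ring.
rewrite ler_peMr ?mulr_ge0 ?sqr_ge0 ?expR_ge0 ?dist_ge0//.
by move: D1; lra.
Qed.

Lemma traj_modulus x s t : traj x -> 0 <= s -> 0 <= t -> dist (x s) (x t) <= M * `|s - t|.
Proof.
wlog st : s t / s <= t.
  by move=> H hx s0 t0; have [h|/ltW h] := leP s t; [|rewrite dist_sym distrC]; apply: H.
move=> hx s0 t0; rewrite distrC (ger0_norm (_ : 0 <= t - s)) ?subr_ge0//.
have pos u : s < u < t -> 0 < u by move=> /andP[h _]; exact: le_lt_trans h.
have bnd u (h : s < u < t) := f_bound (traj_S hx (ltW (pos u h))).
apply: dist_le; rewrite distrC ler_norml -mulNr; apply/andP; split.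
- apply: (mvt_ge st (traj_cont1 hx s0) (fun u h => traj_derive1 hx (pos u h))).
  by move=> u /bnd[]; rewrite ler_norml => /andP[].
- apply: (mvt_le st (traj_cont1 hx s0) (fun u h => traj_derive1 hx (pos u h))).
  by move=> u /bnd[]; rewrite ler_norml => /andP[].
- apply: (mvt_ge st (traj_cont2 hx s0) (fun u h => traj_derive2 hx (pos u h))).
  by move=> u /bnd[_]; rewrite ler_norml => /andP[].
- apply: (mvt_le st (traj_cont2 hx s0) (fun u h => traj_derive2 hx (pos u h))).
  by move=> u /bnd[_]; rewrite ler_norml => /andP[].
Qed.

Section Semiflow.
Variable T : R -> R * R -> R * R.
Hypothesis HT : is_semiflow f S T.

Lemma flow0 X : S X -> T 0 X = X.
Proof. by case/HT. Qed.

Lemma flow_traj X : S X -> traj (T ^~ X).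
Proof. by case/HT => _ h1 h2 h3; split. Qed.

Lemma flow_S X t : S X -> 0 <= t -> S (T t X).
Proof. by move=> SX; exact: traj_S (flow_traj SX). Qed.

Lemma trajE x t : traj x -> 0 <= t -> x t = T t (x 0).
Proof.
move=> hx t0; have S0 := traj_S hx (lexx 0).
by apply: (traj_unique (y := T ^~ (x 0))) => //; [exact: flow_traj|rewrite flow0].
Qed.

Lemma flowD X s t : S X -> 0 <= s -> 0 <= t -> T (s + t) X = T t (T s X).
Proof.
move=> SX s0 t0; rewrite (trajE (traj_shift (flow_traj SX) s0) t0).
by rewrite addr0.
Qed.

Lemma complete_flow x t s : solves_on f setT x -> (forall t, S (x t)) -> 0 <= s ->
  x (t + s) = T s (x t).
Proof.
by move=> dx Sx s0; rewrite (trajE (complete_traj t dx Sx) s0) addr0.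
Qed.

Lemma flow_inj X Y t : S X -> S Y -> 0 <= t -> T t X = T t Y -> X = Y.
Proof.
move=> SX SY t0 e; rewrite -(flow0 SX) -(flow0 SY).
exact: (traj_inj (flow_traj SX) (flow_traj SY) t0 e).
Qed.

Lemma flow_lip D : exists2 K : R, 0 < K & forall X Y t, S X -> S Y ->
  0 <= t <= D -> dist (T t X) (T t Y) <= K * dist X Y.
Proof.
have [K K0 H] := traj_lip D; exists K => // X Y t SX SY ht.
by have := H _ _ _ (flow_traj SX) (flow_traj SY) ht; rewrite !flow0.
Qed.

Lemma flow_modulus X s t : S X -> 0 <= s -> 0 <= t -> dist (T s X) (T t X) <= M * `|s - t|.
Proof. by move=> SX; exact: traj_modulus (flow_traj SX). Qed.

Lemma flow_fix X t : S X -> f X = (0, 0) -> 0 <= t -> T t X = X.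
Proof.
move=> SX fX t0; rewrite -[LHS](@trajE (fun _ => X))//.
apply: (@complete_traj (fun _ => X) 0) => // u _.
by rewrite fX; exact: is_derive_cst.
Qed.

End Semiflow.
End Flow.

(** * Complete orbits, built backwards from preimages *)

Section Orbits.
Context {R : realType}.
Variables (f : R * R -> R * R) (S : set (R * R)).
Implicit Types (X Y Z : R * R) (x y : R -> R * R) (t s : R).
Variable Lf : R.
Hypothesis Lf0 : 0 < Lf.
Hypothesis f_lip : forall X Y, S X -> S Y -> dist (f X) (f Y) <= Lf * dist X Y.
Variable T : R -> R * R -> R * R.
Hypothesis HT : is_semiflow f S T.

Lemma expR_half_le2 : expR (1 / 2) <= 2 :> R.
Proof.
have := expR_ge1Dx (- (1 / 2) : R); rewrite expRN => h.
have e0 := expR_gt0 (1 / 2 : R).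
rewrite -(ler_pM2r (_ : 0 < (expR (1 / 2))^-1)) ?invr_gt0// mulfV ?gt_eqF//.
by move: h; set q := (expR _)^-1; lra.
Qed.

(** For times up to [1 / (8 * Lf)] the Gronwall factor is at most [expR (1 / 2) <= 2], so two orbits
    at most double their distance. Their velocities then differ by at most [2 * Lf] times the
    initial distance, which integrates to a quarter of it. *)
Lemma flow_near_id Z Z' : S Z -> S Z' ->
  dist (T (1 / (8 * Lf)) Z - Z) (T (1 / (8 * Lf)) Z' - Z') <= 1 / 2 * dist Z Z'.
Proof.
move=> SZ SZ'; set del := 1 / (8 * Lf).
have del0 : 0 < del by rewrite divr_gt0// mulr_gt0.
have hz := flow_traj HT SZ; have hz' := flow_traj HT SZ'.
set d0 := dist Z Z'; have d00 : 0 <= d0 := dist_ge0 _ _.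
have close t : 0 <= t <= del -> dist (T t Z) (T t Z') <= 2 * d0.
  move=> /andP[t0 td]; rewrite -ler_sqr ?nnegrE ?dist_ge0 ?mulr_ge0//.
  apply: le_trans (dist_sqd _ _) _.
  apply: le_trans (gronwall_upper Lf0 f_lip hz hz' t0) _; rewrite !(flow0 HT)//.
  have -> : (2 * d0) ^+ 2 = 2 * d0 ^+ 2 * 2 by ring.
  apply: ler_pM; rewrite ?sqd_ge0 ?expR_ge0 ?sqd_dist//.
  apply: le_trans expR_half_le2; rewrite ler_expR.
  have -> : 1 / 2 = 4 * Lf * del by rewrite /del; field; rewrite gt_eqF.
  by rewrite ler_pM2l// mulr_gt0.
have bnd u : 0 < u < del -> dist (f (T u Z)) (f (T u Z')) <= Lf * (2 * d0).
  move=> /andP[u0 ud]; have Su := flow_S HT SZ (ltW u0); have Su' := flow_S HT SZ' (ltW u0).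
  by apply: le_trans (f_lip Su Su') _; rewrite ler_pM2l// close// !ltW.
have Ed : Lf * (2 * d0) * del <= 1 / 2 * d0.
  have -> : Lf * (2 * d0) * del = 1 / 4 * d0 by rewrite /del; field; rewrite gt_eqF.
  by rewrite ler_wpM2r//; lra.
have pos (u : R) : 0 < u < del -> 0 < u by case/andP.
have h1 u (h : 0 < u < del) := is_deriveB (traj_derive1 hz (pos u h)) (traj_derive1 hz' (pos u h)).
have h2 u (h : 0 < u < del) := is_deriveB (traj_derive2 hz (pos u h)) (traj_derive2 hz' (pos u h)).
have c1 := within_continuousB (traj_cont1 (b := del) hz (lexx 0)) (traj_cont1 (b := del) hz' (lexx 0)).
have c2 := within_continuousB (traj_cont2 (b := del) hz (lexx 0)) (traj_cont2 (b := del) hz' (lexx 0)).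
have b1 u : 0 < u < del -> `|(f (T u Z)).1 - (f (T u Z')).1| <= Lf * (2 * d0).
  by move=> /bnd; apply: le_trans; exact: dist_fst.
have b2 u : 0 < u < del -> `|(f (T u Z)).2 - (f (T u Z')).2| <= Lf * (2 * d0).
  by move=> /bnd; apply: le_trans; exact: dist_snd.
have main (a b c e : R) : a - b - (c - e) <= Lf * (2 * d0) * (del - 0) ->
   - (Lf * (2 * d0)) * (del - 0) <= a - b - (c - e) -> `|a - c - (b - e)| <= 1 / 2 * d0.
  rewrite subr0 mulNr => m1 m2; rewrite ler_norml; apply/andP; split; lra.
apply: dist_le.
- apply: main.
  + have H : _ -> (T del Z).1 - (T del Z').1 - ((T 0 Z).1 - (T 0 Z').1) <= _ :=
      mvt_le (ltW del0) c1 h1 (c := Lf * (2 * d0)).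
    rewrite !(flow0 HT)// in H; apply: H => u /b1.
    by rewrite ler_norml => /andP[].
  + have H : _ -> _ <= (T del Z).1 - (T del Z').1 - ((T 0 Z).1 - (T 0 Z').1) :=
      mvt_ge (ltW del0) c1 h1 (c := - (Lf * (2 * d0))).
    rewrite !(flow0 HT)// in H; apply: H => u /b1.
    by rewrite ler_norml => /andP[].
- apply: main.
  + have H : _ -> (T del Z).2 - (T del Z').2 - ((T 0 Z).2 - (T 0 Z').2) <= _ :=
      mvt_le (ltW del0) c2 h2 (c := Lf * (2 * d0)).
    rewrite !(flow0 HT)// in H; apply: H => u /b2.
    by rewrite ler_norml => /andP[].
  + have H : _ -> _ <= (T del Z).2 - (T del Z').2 - ((T 0 Z).2 - (T 0 Z').2) :=
      mvt_ge (ltW del0) c2 h2 (c := - (Lf * (2 * d0))).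
    rewrite !(flow0 HT)// in H; apply: H => u /b2.
    by rewrite ler_norml => /andP[].
Qed.

Lemma compact_box Z (e : R) : compact [set X | dist X Z <= e].
Proof.
have -> : [set X | dist X Z <= e] = `[Z.1 - e, Z.1 + e] `*` `[Z.2 - e, Z.2 + e].
  apply/seteqP; split=> X /=; rewrite !in_itv /=.
    move=> h; have := le_trans (dist_fst X Z) h; have := le_trans (dist_snd X Z) h.
    by rewrite !ler_norml => /andP[q1 q2] /andP[q3 q4]; split; apply/andP; split; lra.
  move=> [/andP[q1 q2] /andP[q3 q4]].
  by apply: dist_le; rewrite ler_norml; apply/andP; split; lra.
by apply: compact_setX; exact: segment_compact.
Qed.

(* A point minimizing the distance from [T del Z] to [X] must be a preimage of [X]: otherwise replacing [Z] by [Z + (X - T del Z)] would at least halve this distance. *)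
Lemma flow_local_onto E (rho : R) : f E = (0, 0) -> 0 < rho ->
  (forall Z, dist Z E <= rho -> S Z) -> exists2 del : R, 0 < del &
  forall X, dist X E <= rho / 2 -> exists2 Z, dist Z E <= rho & T del Z = X.
Proof.
move=> fE rho0 hS; set del := 1 / (8 * Lf).
have del0 : 0 < del by rewrite divr_gt0// mulr_gt0.
have SE : S E by apply: hS; rewrite dist_refl ltW.
have TE := flow_fix Lf0 f_lip HT SE fE (ltW del0).
exists del => // X hX.
have [K K0 HK] := flow_lip Lf0 f_lip HT del.
pose B := [set Z | dist Z E <= rho].
have [||Z] := @compact_EVT_min _ R (fun Z => dist (T del Z) X) B _ (@compact_box E rho).
- by exists E; rewrite /B /= dist_refl ltW.
- apply/subspace_continuousP => Z BZ; apply/cvgrPdist_lt => e e0.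
  rewrite near_withinE; apply/nbhs_ballP; exists (e / K); first by rewrite /= divr_gt0.
  move=> Y; rewrite prod_norm_ball /ball_ /= => ZY BY.
  have h : dist (T del Z) (T del Y) < e.
    apply: le_lt_trans (HK _ _ del (hS _ BZ) (hS _ BY) _) _; first by rewrite lexx ltW.
    by rewrite mulrC -ltr_pdivlMr.
  suff h2 : `|dist (T del Z) X - dist (T del Y) X| <= dist (T del Z) (T del Y).
    exact: le_lt_trans h2 h.
  have t1 := dist_tri (T del Z) (T del Y) X; have t2 := dist_tri (T del Y) (T del Z) X.
  rewrite (dist_sym (T del Y) (T del Z)) in t1.
  by rewrite ler_norml; apply/andP; split; move: t1 t2; lra.
rewrite inE => BZ min; exists Z => //.
apply/eqP/negPn/negP => /eqP ne.
pose Y := Z + (X - T del Z).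
have half Z1 Z2 : B Z1 -> B Z2 -> dist (T del Z1 - Z1) (T del Z2 - Z2) <= 1 / 2 * dist Z1 Z2.
  by move=> /hS h1 /hS h2; exact: flow_near_id.
(* [Y - E] is [X - E] minus the displacement [T del Z - Z]. The displacement of E is zero, so that
   of [Z] is at most [rho / 2], and so is [X - E]. *)
have BY : B Y.
  rewrite /B /=; have BE : B E by rewrite /B /= dist_refl ltW.
  have := half _ _ BZ BE; rewrite TE subrr.
  have -> : dist Y E <= rho = (dist (X - E) (T del Z - Z) <= rho).
    by rewrite /dist /Y; congr (`|_| <= _); ring.
  move=> h; apply: le_trans (dist_tri 0 _ _) _; rewrite (dist_sym 0).
  have -> : dist (X - E) 0 = dist X E by rewrite /dist subr0.
  by move: BZ; rewrite /B /=; lra.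
have := min Y; rewrite inE => /(_ BY).
have -> : dist (T del Y) X = dist (T del Y - Y) (T del Z - Z).
  by rewrite /dist /Y; congr `|_|; ring.
move=> h; have := le_trans h (half _ _ BY BZ).
have -> : dist Y Z = dist (T del Z) X by rewrite [RHS]dist_sym /dist /Y addrAC subrr add0r.
have : 0 < dist (T del Z) X.
  by rewrite lt_neqAle dist_ge0 andbT eq_sym /dist normr_eq0 subr_eq0; apply/eqP.
by lra.
Qed.

(** The forward orbits of the points [Xs n], shifted in time, agree where they overlap, so any large
    enough [n] may serve to define [x t]. *)
Lemma complete_of_backward (Xs : nat -> R * R) (h : R) : 0 < h ->
  (forall n, S (Xs n)) -> (forall n, T h (Xs n.+1) = Xs n) ->
  exists2 x, solves_on f setT x &
    forall n t, 0 <= t + n%:R * h -> x t = T (t + n%:R * h) (Xs n).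
Proof.
move=> h0 SX TX.
have step n k t : 0 <= t + n%:R * h ->
    T (t + (n + k)%:R * h) (Xs (n + k)%N) = T (t + n%:R * h) (Xs n).
  move=> tn; elim: k => [|k IH]; first by rewrite addn0.
  have e : 0 <= t + (n + k)%:R * h by rewrite natrD mulrDl addrA addr_ge0// mulr_ge0// ltW.
  rewrite -IH addnS -[in RHS](TX (n + k)%N) -(flowD Lf0 f_lip HT (SX _) (ltW h0) e).
  by congr T; rewrite mulrS; ring.
pose N t := Num.bound (`|t| / h).
have hN t : 0 <= t + (N t)%:R * h.
  have := archi_boundP (divr_ge0 (normr_ge0 t) (ltW h0)); rewrite ltr_pdivrMr// => H.
  by move: H; rewrite ltr_norml /N => /andP[H _]; lra.
pose x t := T (t + (N t)%:R * h) (Xs (N t)).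
have xE n t : 0 <= t + n%:R * h -> x t = T (t + n%:R * h) (Xs n).
  move=> tn; rewrite /x; have [nN|/ltnW Nn] := leqP n (N t).
    by rewrite -[in LHS](subnKC nN) step.
  by rewrite -[in RHS](subnKC Nn) step.
exists x => // t _.
(* One index more than [hN] requires makes the time strictly positive, so a whole neighbourhood of
   [t] is covered by a single forward orbit. *)
pose n := (N t).+1.
have tn : 0 < t + n%:R * h.
  by rewrite /n mulrSr mulrDl mul1r addrA ltr_wpDl.
apply: (@near_eq_is_derive _ _ _ (fun u => T (n%:R * h + u) (Xs n))).
  near=> u; rewrite (xE n); first by rewrite addrC.
  rewrite ltW// -ltrBlDr sub0r; near: u; apply: lt_nbhsr.
  by rewrite -subr_gt0 opprK.
have hd := traj_derive (flow_traj HT (SX n)) tn; rewrite addrC in hd.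
by rewrite (xE n) ?(ltW tn)// [t + _]addrC; exact: (is_derive_translate hd).
Unshelve. all: by end_near. Qed.

Lemma complete_of_periodic P th : S P -> 0 < th -> T th P = P ->
  exists x, [/\ solves_on f setT x, x 0 = P, forall t, x (t + th) = x t,
    forall n : nat, x (- (n%:R * th)) = P & forall t, exists2 s, 0 <= s & x t = T s P].
Proof.
move=> SP th0 TP.
have [x dx hx] := @complete_of_backward (fun _ => P) th th0 (fun _ => SP) (fun _ => TP).
have bound t : exists n : nat, 0 <= t + n%:R * th.
  exists (Num.bound (`|t| / th)).
  have := archi_boundP (divr_ge0 (normr_ge0 t) (ltW th0)); rewrite ltr_pdivrMr//.
  by rewrite ltr_norml => /andP[H _]; lra.
exists x; split => //.
- by rewrite (hx 0%N) mul0r addr0// (flow0 HT).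
- move=> t; have [n hn] := bound t.
  have e : t + th + n%:R * th = t + n.+1%:R * th by rewrite mulrSr mulrDl mul1r addrAC addrA.
  have h0 : 0 <= t + th + n%:R * th by rewrite addrAC addr_ge0// ltW.
  by rewrite (hx n) // (hx n.+1) ?e -?e.
- by move=> n; rewrite (hx n) addNr// (flow0 HT).
- by move=> t; have [n hn] := bound t; exists (t + n%:R * th) => //; exact: hx.
Qed.

Lemma periodic_reduce P th s : S P -> 0 < th -> T th P = P -> 0 <= s ->
  exists2 u, 0 <= u <= th & T s P = T u P.
Proof.
move=> SP th0 TP s0.
have [n sn] : exists n : nat, s <= n%:R * th.
  exists (Num.bound (s / th)); rewrite -ler_pdivrMr// ltW//.
  by have := archi_boundP (divr_ge0 s0 (ltW th0)).
elim: n s s0 sn => [|n IH] s s0 sn; first by exists s => //; rewrite s0 (le_trans sn)// mul0r ltW.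
have [h|h] := leP s th; first by exists s => //; rewrite s0.
have sth : 0 <= s - th by rewrite subr_ge0 ltW.
have [|u hu e] := IH (s - th) sth; first by rewrite lerBlDr; move: sn; rewrite mulrSr mulrDl mul1r.
have := flowD Lf0 f_lip HT SP (ltW th0) sth; rewrite TP addrC subrK => ->.
by exists u.
Qed.

End Orbits.

(** * Limit sets and closed sets in terms of distances *)

Section Limits.
Context {R : realType}.
Implicit Types (X Z : R * R) (x : R -> R * R).

Lemma nbhs_dist Z (e : R) : 0 < e -> nbhs Z [set X | dist X Z < e].
Proof.
move=> e0; apply/nbhs_ballP; exists e => // X; rewrite prod_norm_ball /ball_ /= => h.
by rewrite dist_sym.
Qed.

Lemma dist_nbhs Z (B : set (R * R)) : nbhs Z B ->
  exists2 e : R, 0 < e & forall X, dist X Z < e -> B X.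
Proof.
move=> /nbhs_ballP[e e0 H]; exists e => // X h; apply: H.
by rewrite prod_norm_ball /ball_ /= -/(dist _ _) dist_sym.
Qed.

Lemma cluster_pinfty x Z : cluster (x @ +oo) Z <->
  forall e : R, 0 < e -> forall t0, exists2 t, t0 <= t & dist (x t) Z < e.
Proof.
split=> [H e e0 t0|H A B [M [_ hM]] /dist_nbhs[e e0 hB]].
  have [|X [[t /= t0t <-] h]] := H (x @` [set t | t0 <= t]) _ _ (nbhs_dist Z e0).
    by exists t0; split; [exact: num_real|move=> t tt; exists t => //=; exact: ltW].
  by exists t.
have [t Mt h] := H e e0 (M + 1); exists (x t); split; last exact: hB.
by apply: hM; lra.
Qed.

Lemma cluster_ninfty x Z : cluster (x @ -oo) Z <->
  forall e : R, 0 < e -> forall t0, exists2 t, t <= t0 & dist (x t) Z < e.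
Proof.
split=> [H e e0 t0|H A B [M [_ hM]] /dist_nbhs[e e0 hB]].
  have [|X [[t /= t0t <-] h]] := H (x @` [set t | t <= t0]) _ _ (nbhs_dist Z e0).
    by exists t0; split; [exact: num_real|move=> t tt; exists t => //=; exact: ltW].
  by exists t.
have [t Mt h] := H e e0 (M - 1); exists (x t); split; last exact: hB.
by apply: hM; lra.
Qed.

Lemma compact_dist (K : set (R * R)) Z : compact K ->
  (forall e : R, 0 < e -> exists2 X, K X & dist X Z < e) -> K Z.
Proof.
move=> cK H; apply: (compact_closed (@norm_hausdorff _ _) cK) => B /dist_nbhs[e e0 hB].
by have [X KX h] := H e e0; exists X; split => //; exact: hB.
Qed.

End Limits.

(** * Estimates on the vector field *)

Ltac posit := repeat first [done | rewrite invr_gt0 | apply: exprn_gt0 | apply: mulr_gt0 | apply: addr_gt0].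
Ltac nonneg := repeat first [done | exact: sqr_ge0 | apply: mulr_ge0 | apply: addr_ge0].

Section VectorField.
Context {R : realType}.
Implicit Types u v x y n : R.
Variables (al be ga : R).
Hypotheses (hal : 0 < al) (hbe : 0 < be) (hga : 0 < ga).
Hypothesis hcoex : be + 1 < ga * (be - 1).

Definition ustar : R := (be - 1)^-1.
Definition vstar : R := al * be * (ga * (be - 1) - 1) / (be - 1) ^+ 2.
(** The slope at [ustar] of the prey nullcline [V = al * (ga - U) * (1 + U)]. Multiplied by [be - 1]
    and divided by [al] it becomes [ga * (be - 1) - be - 1]. *)
Definition slope : R := al * (ga - 1 - 2 * ustar).
Local Notation us := ustar.
Local Notation vs := vstar.
Local Notation sl := slope.
Local Notation b := (be - 1).
Local Notation p := (us / (1 + us)).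

Lemma be_gt1 : 0 < b.
Proof.
have : 0 < ga * b by move: hbe hcoex; lra.
by rewrite pmulr_rgt0. Qed.
Hint Resolve be_gt1 : core.

Lemma us_gt0 : 0 < us. Proof. by rewrite invr_gt0. Qed.
Hint Resolve us_gt0 : core.

Lemma us1_gt0 : 0 < 1 + us. Proof. by rewrite addr_gt0. Qed.
Hint Resolve us1_gt0 : core.

Lemma vs_gt0 : 0 < vs.
Proof.
by rewrite divr_gt0 ?exprn_gt0// !mulr_gt0//; move: hbe hcoex; lra.
Qed.
Hint Resolve vs_gt0 : core.

Lemma sl_gt0 : 0 < sl.
Proof.
rewrite mulr_gt0// /ustar -(pmulr_lgt0 _ be_gt1).
have -> : (ga - 1 - 2 * b^-1) * b = ga * b - be - 1 by field; rewrite gt_eqF.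
by move: hcoex; lra.
Qed.
Hint Resolve sl_gt0 : core.

Lemma p_gt0 : 0 < p. Proof. by rewrite divr_gt0. Qed.
Hint Resolve p_gt0 : core.

Let al_ge0 : 0 <= al. Proof. exact: ltW. Qed.
Let b_ge0 : 0 <= b. Proof. exact: ltW. Qed.
Let us_ge0 : 0 <= us. Proof. exact: ltW. Qed.
Let vs_ge0 : 0 <= vs. Proof. exact: ltW. Qed.
Let sl_ge0 : 0 <= sl. Proof. exact: ltW. Qed.
Let p_ge0 : 0 <= p. Proof. exact: ltW. Qed.
Hint Resolve al_ge0 b_ge0 us_ge0 vs_ge0 sl_ge0 p_ge0 : core.

(** The bracket is the height of the prey nullcline, a quadratic expanded at [us], minus [v]. *)
Lemma F_eq u v : 0 <= u ->
  F al ga u v = u / (1 + u) * (sl * (u - us) - al * (u - us) ^+ 2 - (v - vs)).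
Proof.
move=> u0; rewrite /F /slope /vstar /ustar; field.
by rewrite !gt_eqF// ltr_pwDl.
Qed.

Lemma G_eq u v : 0 <= u -> G be u v = v * b * (u - us) / (1 + u).
Proof.
move=> u0; rewrite /G /ustar; field.
by rewrite !gt_eqF// ltr_pwDl.
Qed.

Lemma frac_ge u u' : 0 <= u -> u <= u' -> u / (1 + u) <= u' / (1 + u').
Proof.
move=> u0 uu; have u1 : 0 < 1 + u by lra. have u1' : 0 < 1 + u' by lra.
by rewrite ler_pdivrMr// mulrAC ler_pdivlMr//; lra.
Qed.

Lemma frac_itv u : 0 <= u -> 0 <= u / (1 + u) <= 1.
Proof.
move=> u0; have u1 : 0 < 1 + u by lra.
by rewrite divr_ge0 ?(ltW u1)//= ler_pdivrMr//; lra.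
Qed.

(** The unperturbed rate [J] is at least [mu * n], and [del <= mu / (2 * c)] lets the perturbation
    consume at most half of it. *)
Lemma combine (a a2 mu c del n x y J err : R) : mu <= a -> mu <= a2 -> 0 <= x -> 0 <= y -> 0 <= n ->
  n <= x + y -> 0 < mu -> 0 < c -> 0 <= del <= mu / (2 * c) -> `|err| <= c * del * n ->
  a * x + a2 * y <= J -> mu / 2 * n <= J + err.
Proof.
move=> ha hb x0 y0 n0 hn mu0 c0 /andP[d0 hd] herr hJ.
have h1 : mu * x <= a * x by rewrite ler_wpM2r.
have h2 : mu * y <= a2 * y by rewrite ler_wpM2r.
have h3 : mu * n <= mu * (x + y) by rewrite ler_wpM2l// ltW.
have h4 : c * del * n <= mu / 2 * n.
  rewrite ler_wpM2r// mulrC -ler_pdivlMr//; apply: le_trans hd _.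
  by rewrite invfM mulrA.
by move: herr; rewrite ler_norml => /andP[h5 _]; lra.
Qed.

Lemma err_bound (N1 N2 e1 e2 d : R) : 0 <= N1 -> 0 <= N2 -> `|e1| <= d -> `|e2| <= d ->
  `|N1 * e1 + N2 * e2| <= (N1 + N2) * d.
Proof.
move=> h1 h2 he1 he2; apply: le_trans (ler_normD _ _) _; rewrite !normrM (ger0_norm h1) (ger0_norm h2).
by rewrite mulrDl; apply: lerD; exact: ler_wpM2l.
Qed.

Variables (U1 V1 : R).
Hypotheses (hU1 : us <= U1) (hV1 : vs <= V1).

Let U1_gt0 : 0 < U1. Proof. exact: lt_le_trans hU1. Qed.
Let V1_gt0 : 0 < V1. Proof. exact: lt_le_trans hV1. Qed.
Let U11 : 0 < 1 + U1. Proof. by rewrite addr_gt0. Qed.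

(** [n] stands for the max-norm distance to E; only its comparison with the two coordinate
    differences is kept. *)
Definition box_pt (u v n : R) := [/\ 0 <= u <= U1, 0 <= v <= V1,
  `|u - us| <= n, `|v - vs| <= n & n <= `|u - us| + `|v - vs|].

(** [G] alone controls [u - us] but not [v - vs]; subtracting a multiple of [F] supplies the latter.
    [N] is chosen so that the unfavourable term [sl * (u - us)] of [F] costs just half of what [G]
    gives. *)
Lemma quadrant1 : exists N mu D : R, [/\ 0 < N, 0 < mu, 0 < D &
  forall u v n p1 p2 del, box_pt u v n -> us <= u -> vs <= v -> 0 <= del <= D ->
    `|p1| <= del * n -> `|p2| <= del * n ->
    mu * n <= (G be u v - p2) - N * (F al ga u v - p1)].
Proof.
pose k := vs * b / (1 + U1); have k0 : 0 < k by rewrite divr_gt0// mulr_gt0.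
pose N := k / (2 * sl); have N0 : 0 < N by rewrite divr_gt0// mulr_gt0.
pose mu := Num.min (k / 2) (N * p).
have mu0 : 0 < mu by rewrite lt_min divr_gt0//= mulr_gt0.
exists N, (mu / 2), (mu / (2 * (1 + N))).
have N10 : 0 < 1 + N by rewrite addr_gt0.
split => //; rewrite ?divr_gt0 ?mulr_gt0//.
move=> u v n p1 p2 del [/andP[u0 uU] /andP[v0 vV] hx hy hn] hu hv hd h1 h2.
have n0 : 0 <= n := le_trans (normr_ge0 _) hx.
have x0 : 0 <= u - us by rewrite subr_ge0. have y0 : 0 <= v - vs by rewrite subr_ge0.
have u1 : 0 < 1 + u by rewrite ltr_pwDl.
have hG : k * (u - us) <= G be u v.
  rewrite G_eq// /k mulrAC ler_pM ?invr_ge0 ?(ltW U11)//.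
  - by nonneg.
  - by rewrite ler_wpM2r// ler_wpM2r.
  - by rewrite lef_pV2 ?posrE// lerD2l.
have hF : F al ga u v <= sl * (u - us) - p * (v - vs).
  rewrite F_eq//; have /andP[w0 w1] := frac_itv u0.
  have wp := frac_ge (ltW us_gt0) hu.
  move: (u / (1 + u)) w0 w1 wp => w w0 w1 wp.
  have a1 : w * (sl * (u - us)) <= 1 * (sl * (u - us)) by apply: ler_wpM2r => //; nonneg.
  have a2 : 0 <= w * (al * (u - us) ^+ 2) by nonneg.
  have a3 : p * (v - vs) <= w * (v - vs) by rewrite ler_wpM2r.
  by move: a1 a2 a3; rewrite mul1r; lra.
have -> : G be u v - p2 - N * (F al ga u v - p1) = (G be u v - N * F al ga u v) + ((-1) * p2 + N * p1) by ring.
apply: (@combine (k / 2) (N * p) mu (1 + N) del n (u - us) (v - vs)) => //.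
- by rewrite ge_min lexx.
- by rewrite ge_min lexx orbT.
- by move: hn; rewrite !ger0_norm.
- have := @err_bound 1 N (- p2) p1 (del * n) ler01 (ltW N0); rewrite normrN mul1r mulN1r mulrA.
  exact.
- have : N * F al ga u v <= N * (sl * (u - us) - p * (v - vs)) by rewrite ler_pM2l.
  have -> : N * (sl * (u - us) - p * (v - vs)) = k / 2 * (u - us) - N * p * (v - vs).
    by rewrite /N; field; rewrite !gt_eqF.
  by move: hG; lra.
Qed.

(** Here the loss to be paid comes from [u / (1 + u)] being smaller than its value at [us]. It is at
    most [V1 / (1 + us) * (us - u)], and [N] makes it cost half of what [- G] gives. *)
Lemma quadrant2 : exists N mu D : R, [/\ 0 < N, 0 < mu, 0 < D &
  forall u v n p1 p2 del, box_pt u v n -> u <= us -> vs <= v -> 0 <= del <= D ->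
    `|p1| <= del * n -> `|p2| <= del * n ->
    mu * n <= - (G be u v - p2) - N * (F al ga u v - p1)].
Proof.
pose k := vs * b / (1 + us); have k0 : 0 < k by rewrite divr_gt0// mulr_gt0.
pose N := k * (1 + us) / (2 * V1); have N0 : 0 < N by rewrite divr_gt0// mulr_gt0.
pose mu := Num.min (k / 2) (N * p).
have mu0 : 0 < mu by rewrite lt_min divr_gt0//= mulr_gt0.
exists N, (mu / 2), (mu / (2 * (1 + N))).
have N10 : 0 < 1 + N by rewrite addr_gt0.
split => //; rewrite ?divr_gt0 ?mulr_gt0//.
move=> u v n p1 p2 del [/andP[u0 uU] /andP[v0 vV] hx hy hn] hu hv hd h1 h2.
have n0 : 0 <= n := le_trans (normr_ge0 _) hx.
have x0 : 0 <= us - u by rewrite subr_ge0. have y0 : 0 <= v - vs by rewrite subr_ge0.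
have u1 : 0 < 1 + u by rewrite ltr_pwDl.
have hG : k * (us - u) <= - G be u v.
  rewrite G_eq// /k -mulNr -mulrN opprB mulrAC ler_pM ?invr_ge0 ?(ltW us1_gt0)//.
  - by nonneg.
  - by rewrite ler_wpM2r// ler_wpM2r.
  - by rewrite lef_pV2 ?posrE// lerD2l.
have hF : p * (v - vs) - V1 / (1 + us) * (us - u) <= - F al ga u v.
  rewrite F_eq//.
  have wp : u / (1 + us) <= u / (1 + u).
    by rewrite ler_wpM2l// lef_pV2 ?posrE// lerD2l.
  have a1 : u / (1 + us) * (v - vs) <= u / (1 + u) * (v - vs) by rewrite ler_wpM2r.
  have a2 : 0 <= u / (1 + u) * (sl * (us - u) + al * (u - us) ^+ 2).
    by apply: mulr_ge0; [rewrite divr_ge0// ltW|nonneg].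
  have a3 : (us - u) / (1 + us) * (v - vs) <= (us - u) / (1 + us) * V1.
    by apply: ler_wpM2l; [rewrite divr_ge0// ltW|have := vs_gt0; lra].
  have -> : p * (v - vs) = u / (1 + us) * (v - vs) + (us - u) / (1 + us) * (v - vs).
    by field; rewrite gt_eqF.
  have -> : V1 / (1 + us) * (us - u) = (us - u) / (1 + us) * V1 by ring.
  by lra.
have -> : - (G be u v - p2) - N * (F al ga u v - p1) = (- G be u v + N * - F al ga u v) + (1 * p2 + N * p1) by ring.
apply: (@combine (k / 2) (N * p) mu (1 + N) del n (us - u) (v - vs)) => //.
- by rewrite ge_min lexx.
- by rewrite ge_min lexx orbT.
- by move: hn; rewrite distrC !ger0_norm.
- by have := @err_bound 1 N p2 p1 (del * n) ler01 (ltW N0); rewrite mulrA; exact.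
- have : N * (p * (v - vs) - V1 / (1 + us) * (us - u)) <= N * - F al ga u v by rewrite ler_pM2l.
  have -> : N * (p * (v - vs) - V1 / (1 + us) * (us - u)) = N * p * (v - vs) - k / 2 * (us - u).
    by rewrite /N; field; rewrite !gt_eqF.
  by move: hG; lra.
Qed.

(** For [w >= w0 / 2] divide the bound in terms of [n]. For smaller [w] the distance [n] is at least
    [w0 / 2], so the bound [q / w <= del] is again of order [del * n]. *)
Lemma div_bound (q w w0 del n : R) : 0 < w0 -> 0 < w -> 0 <= n -> 0 <= del -> `|w - w0| <= n ->
  q <= del * n -> q <= del * w -> q / w <= 2 / w0 * (del * n).
Proof.
move=> w00 w0' n0 d0 hw q1 q2; rewrite ler_pdivrMr//.
have dn : 0 <= del * n by rewrite mulr_ge0.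
have [h|h] := leP (w0 / 2) w.
  apply: le_trans q1 _.
  have -> : 2 / w0 * (del * n) * w = del * n * (w / (w0 / 2)) by field; rewrite gt_eqF.
  by rewrite ler_peMr// ler_pdivlMr ?divr_gt0// mul1r.
apply: le_trans q2 _.
have -> : 2 / w0 * (del * n) * w = del * w * (n / (w0 / 2)) by field; rewrite gt_eqF.
rewrite ler_peMr ?mulr_ge0 ?(ltW w0')// ler_pdivlMr ?divr_gt0// mul1r.
by move: hw; rewrite ler_norml => /andP[h1 _]; lra.
Qed.

(** The rate of [ln v + N * u]: unlike [G], the quotient [G / v] is bounded below by a multiple of
    [u - us] uniformly in [v]. Dividing [p2] by [v] is harmless thanks to [p2 <= del * v]. *)
Lemma quadrant4 : exists N mu D : R, [/\ 0 < N, 0 < mu, 0 < D &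
  forall u v n p1 p2 del, box_pt u v n -> 0 < v -> us <= u -> v <= vs -> 0 <= del <= D ->
    `|p1| <= del * n -> `|p2| <= del * n -> p2 <= del * v ->
    mu * n <= (G be u v - p2) / v + N * (F al ga u v - p1)].
Proof.
pose k := b / (1 + U1); have k0 : 0 < k by rewrite divr_gt0.
pose N := k / (2 * (al * U1)); have N0 : 0 < N by rewrite divr_gt0// !mulr_gt0.
pose mu := Num.min (k / 2) (N * p).
have mu0 : 0 < mu by rewrite lt_min divr_gt0//= mulr_gt0.
have N10 : 0 < 2 / vs + N by rewrite addr_gt0// divr_gt0.
exists N, (mu / 2), (mu / (2 * (2 / vs + N))).
split => //; rewrite ?divr_gt0 ?mulr_gt0//.
move=> u v n p1 p2 del [/andP[u0 uU] /andP[v0 vV] hx hy hn] v0' hu hv hd h1 h2 h3.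
have n0 : 0 <= n := le_trans (normr_ge0 _) hx.
have d0 : 0 <= del by case/andP: hd.
have x0 : 0 <= u - us by rewrite subr_ge0. have y0 : 0 <= vs - v by rewrite subr_ge0.
have u1 : 0 < 1 + u by rewrite ltr_pwDl.
have hG : k * (u - us) <= G be u v / v.
  rewrite G_eq// /k (_ : _ / v = b * (u - us) / (1 + u)); last by field; rewrite !gt_eqF.
  rewrite mulrAC ler_pM ?invr_ge0 ?(ltW U11)//; first by nonneg.
  by rewrite lef_pV2 ?posrE// lerD2l.
have hp2 : p2 / v <= 2 / vs * (del * n).
  by apply: div_bound => //; apply: le_trans (ler_norm _) h2.
have hF : p * (vs - v) - al * U1 * (u - us) <= F al ga u v.
  rewrite F_eq//; have /andP[w0 w1] := frac_itv u0.
  have wp := frac_ge (ltW us_gt0) hu.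
  move: (u / (1 + u)) w0 w1 wp => w w0 w1 wp.
  have a1 : w * (al * (u - us) ^+ 2) <= 1 * (al * (u - us) ^+ 2) by apply: ler_wpM2r => //; nonneg.
  have a2 : 0 <= w * (sl * (u - us)) by nonneg.
  have a3 : p * (vs - v) <= w * (vs - v) by rewrite ler_wpM2r.
  have a4 : al * (u - us) ^+ 2 <= al * U1 * (u - us).
    rewrite expr2 mulrA ler_wpM2r// ler_wpM2l//; have := us_gt0; lra.
  by move: a1 a2 a3 a4; rewrite mul1r; lra.
have h5 : - (2 / vs * (del * n)) + N * (- (del * n)) <= - (p2 / v) + N * - p1.
  apply: lerD; first by rewrite lerN2.
  by rewrite ler_pM2l// lerN2; apply: le_trans (ler_norm _) h1.
apply: le_trans (_ : (G be u v / v + N * F al ga u v) + (- (2 / vs * (del * n)) + N * (- (del * n))) <= _); last first.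
  have -> : (G be u v - p2) / v + N * (F al ga u v - p1) = (G be u v / v + N * F al ga u v) + (- (p2 / v) + N * - p1) by ring.
  by rewrite lerD2l.
apply: (@combine (k / 2) (N * p) mu (2 / vs + N) del n (u - us) (vs - v)) => //.
- by rewrite ge_min lexx.
- by rewrite ge_min lexx orbT.
- by move: hn; rewrite [X in _ + X]distrC !ger0_norm.
- rewrite -mulrN (_ : _ + _ = - ((2 / vs + N) * del * n)); last by ring.
  by rewrite normrN ger0_norm// !mulr_ge0// ltW.
- have : N * (p * (vs - v) - al * U1 * (u - us)) <= N * F al ga u v by rewrite ler_pM2l.
  have -> : N * (p * (vs - v) - al * U1 * (u - us)) = N * p * (vs - v) - k / 2 * (u - us).
    by rewrite /N; field; rewrite !gt_eqF.
  by move: hG; lra.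
Qed.

(** [al * ga] is the height of the prey nullcline on the axis [u = 0]; the difference has the factor
    [u] and a nonnegative cofactor for [u <= us]. *)
Lemma nullcline_le u : 0 <= u -> u <= us -> al * ga <= vs + sl * (u - us) - al * (u - us) ^+ 2.
Proof.
move=> u0 hu.
have -> : vs + sl * (u - us) - al * (u - us) ^+ 2 = al * ga + u * (sl + al * (2 * us - u)).
  by rewrite /slope /vstar /ustar; field; rewrite gt_eqF.
rewrite lerDl; apply: mulr_ge0 => //; apply: addr_ge0 => //; apply: mulr_ge0 => //.
by have := us_gt0; lra.
Qed.

(** The rate of [N * ln u - v]. As [- G] degenerates for small [v], the quadrant is cut at half the
    height [al * ga]. Above the cut the argument is that of the other quadrants. Below it [F / u]
    has a positive lower bound by [nullcline_le], and [n <= U1 + V1] turns this constant into a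
    multiple of [n]. *)
Lemma quadrant3 : exists N mu D : R, [/\ 0 < N, 0 < mu, 0 < D &
  forall u v n p1 p2 del, box_pt u v n -> n <= U1 + V1 -> 0 < u -> u <= us -> v <= vs -> 0 <= del <= D ->
    `|p1| <= del * n -> `|p2| <= del * n -> p1 <= del * u ->
    mu * n <= - (G be u v - p2) + N * ((F al ga u v - p1) / u)].
Proof.
pose g0 := al * ga / 2; have g00 : 0 < g0 by rewrite divr_gt0// mulr_gt0.
pose k := g0 * b / (1 + us); have k0 : 0 < k by rewrite divr_gt0// mulr_gt0.
have ss : 0 < sl + al * us by rewrite addr_gt0// mulr_gt0.
pose N := k / (2 * (sl + al * us)); have N0 : 0 < N by rewrite divr_gt0// !mulr_gt0.
pose mu2 := N * g0 / ((1 + us) * (U1 + V1)).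
have UV : 0 < U1 + V1 by rewrite addr_gt0.
have mu20 : 0 < mu2 by rewrite /mu2; posit.
pose mu := Num.min (Num.min (k / 2) (N / (1 + us))) mu2.
have mu0 : 0 < mu by rewrite !lt_min mu20 andbT; apply/andP; split; posit.
have N10 : 0 < 1 + N * (2 / us) by rewrite addr_gt0// mulr_gt0// divr_gt0.
exists N, (mu / 2), (mu / (2 * (1 + N * (2 / us)))).
split => //; rewrite ?divr_gt0 ?mulr_gt0//.
move=> u v n p1 p2 del [/andP[u0 uU] /andP[v0 vV] hx hy hn] nUV u0' hu hv hd h1 h2 h3.
have n0 : 0 <= n := le_trans (normr_ge0 _) hx.
have d0 : 0 <= del by case/andP: hd.
have x0 : 0 <= us - u by rewrite subr_ge0. have y0 : 0 <= vs - v by rewrite subr_ge0.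
have u1 : 0 < 1 + u by rewrite ltr_pwDl.
have hp1 : p1 / u <= 2 / us * (del * n).
  by apply: div_bound => //; apply: le_trans (ler_norm _) h1.
have hFu : F al ga u v / u = (sl * (u - us) - al * (u - us) ^+ 2 - (v - vs)) / (1 + u).
  by rewrite F_eq//; field; rewrite !gt_eqF.
have hinv : (1 + us)^-1 <= (1 + u)^-1 by rewrite lef_pV2 ?posrE// lerD2l.
have inv1 : (1 + u)^-1 <= 1 by rewrite invf_le1//; lra.
have inv0 : 0 <= (1 + u)^-1 by rewrite invr_ge0 ltW.
have h5 : - (del * n) + N * (- (2 / us * (del * n))) <= p2 + N * - (p1 / u).
  apply: lerD; first by move: h2; rewrite ler_norml => /andP[].
  by rewrite ler_pM2l// lerN2.
apply: le_trans (_ : (- G be u v + N * (F al ga u v / u)) + (- (del * n) + N * (- (2 / us * (del * n)))) <= _); last first.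
  have -> : - (G be u v - p2) + N * ((F al ga u v - p1) / u) = (- G be u v + N * (F al ga u v / u)) + (p2 + N * - (p1 / u)) by ring.
  by rewrite lerD2l.
have herr : `| - (del * n) + N * (- (2 / us * (del * n)))| <= (1 + N * (2 / us)) * del * n.
  rewrite (_ : _ + _ = - ((1 + N * (2 / us)) * del * n)); last by ring.
  by rewrite normrN ger0_norm// !mulr_ge0// ltW.
have hG0 : v * b * (us - u) / (1 + us) <= - G be u v.
  rewrite G_eq// -mulNr -mulrN opprB; apply: ler_wpM2l => //; nonneg.
have [hvg|hvg] := leP g0 v.
- have hG : k * (us - u) <= - G be u v.
    apply: le_trans hG0; rewrite /k mulrAC; apply: ler_wpM2r; first by rewrite invr_ge0 ltW.
    by apply: ler_wpM2r => //; apply: ler_wpM2r.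
  have hF : (1 + us)^-1 * (vs - v) - (sl + al * us) * (us - u) <= F al ga u v / u.
    rewrite hFu; move: ((1 + u)^-1) hinv inv1 inv0 => w hinv inv1 inv0.
    have a1 : (1 + us)^-1 * (vs - v) <= w * (vs - v) by apply: ler_wpM2r.
    have a2 : w * (sl * (us - u) + al * (u - us) ^+ 2) <= 1 * (sl * (us - u) + al * (u - us) ^+ 2).
      by apply: ler_wpM2r => //; nonneg.
    have a3 : al * (u - us) ^+ 2 <= al * us * (us - u).
      rewrite -sqrrN opprB expr2 mulrA; apply: ler_wpM2r => //; apply: ler_wpM2l => //; lra.
    by move: a1 a2 a3; rewrite mul1r; lra.
  apply: (@combine (k / 2) (N / (1 + us)) mu (1 + N * (2 / us)) del n (us - u) (vs - v)) => //.
  + by rewrite !ge_min lexx.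
  + by rewrite !ge_min lexx orbT.
  + by move: hn; rewrite distrC [X in _ + X]distrC !ger0_norm.
  + have : N * ((1 + us)^-1 * (vs - v) - (sl + al * us) * (us - u)) <= N * (F al ga u v / u) by rewrite ler_pM2l.
    have -> : N * ((1 + us)^-1 * (vs - v) - (sl + al * us) * (us - u)) = N / (1 + us) * (vs - v) - k / 2 * (us - u).
      by rewrite /N; field; rewrite !gt_eqF.
    by move: hG; lra.
- have hG : 0 <= - G be u v by apply: le_trans hG0; apply: mulr_ge0; [nonneg|rewrite invr_ge0 ltW].
  have hF : (1 + us)^-1 * g0 <= F al ga u v / u.
    rewrite hFu mulrC; apply: ler_pM => //; rewrite ?invr_ge0 ?(ltW us1_gt0) ?(ltW g00)//.
    by have := nullcline_le u0 hu; move: hvg; rewrite /g0; lra.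
  apply: (@combine mu2 mu2 mu (1 + N * (2 / us)) del n n 0) => //.
  + by rewrite !ge_min lexx orbT.
  + by rewrite !ge_min lexx orbT.
  + by rewrite addr0.
  + rewrite mulr0 addr0; have : N * ((1 + us)^-1 * g0) <= N * (F al ga u v / u) by rewrite ler_pM2l.
    have : mu2 * n <= mu2 * (U1 + V1) by rewrite ler_pM2l.
    have -> : mu2 * (U1 + V1) = N * ((1 + us)^-1 * g0) by rewrite /mu2; field; rewrite !gt_eqF.
    by move: hG; lra.
Qed.

Lemma line_u v p2 del : `|p2| <= del * `|v - vs| -> del < p ->
  (v < vs -> 0 < F al ga us v - p2) /\ (vs < v -> F al ga us v - p2 < 0).
Proof.
move=> h dp; rewrite F_eq// subrr mulr0 expr0n mulr0 subr0 sub0r.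
split=> hv.
- move: h; rewrite [`|v - _|]ltr0_norm ?subr_lt0// ler_norml => /andP[_ h].
  have : del * (vs - v) < p * (vs - v) by rewrite ltr_pM2r ?subr_gt0.
  by move: h; lra.
- move: h; rewrite [`|v - _|]gtr0_norm ?subr_gt0// ler_norml => /andP[h _].
  have : del * (v - vs) < p * (v - vs) by rewrite ltr_pM2r ?subr_gt0.
  by move: h; lra.
Qed.

Lemma line_v u p2 del : 0 <= u -> u <= U1 -> `|p2| <= del * `|u - us| -> del < vs * b / (1 + U1) ->
  (us < u -> 0 < G be u vs - p2) /\ (u < us -> G be u vs - p2 < 0).
Proof.
move=> u0 uU h dk; rewrite G_eq//.
have u1 : 0 < 1 + u by rewrite ltr_pwDl.
have k1 : vs * b / (1 + U1) <= vs * b / (1 + u).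
  by apply: ler_wpM2l; [nonneg|rewrite lef_pV2 ?posrE// lerD2l].
rewrite mulrAC; split=> hv.
- move: h; rewrite [`|u - _|]gtr0_norm ?subr_gt0// ler_norml => /andP[_ h].
  have : del * (u - us) < vs * b / (1 + u) * (u - us).
    by rewrite ltr_pM2r ?subr_gt0//; exact: lt_le_trans k1.
  by move: h; lra.
- move: h; rewrite [`|u - _|]ltr0_norm ?subr_lt0// ler_norml => /andP[h _].
  have : del * (us - u) < vs * b / (1 + u) * (us - u).
    by rewrite ltr_pM2r ?subr_gt0//; exact: lt_le_trans k1.
  by move: h; lra.
Qed.

Lemma F_linear u v n : 0 <= u -> `|u - us| <= n -> `|v - vs| <= n ->
  `|F al ga u v - p * (sl * (u - us) - (v - vs))| <= (sl + al * n + 1 + al) * n ^+ 2.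
Proof.
move=> u0 hx hy; have n0 : 0 <= n := le_trans (normr_ge0 _) hx.
have u1 : 0 < 1 + u by rewrite ltr_pwDl.
have -> : F al ga u v - p * (sl * (u - us) - (v - vs)) =
   (1 + u)^-1 * (1 + us)^-1 * ((u - us) * (sl * (u - us) - al * (u - us) ^+ 2 - (v - vs))) - p * (al * (u - us) ^+ 2).
  by rewrite F_eq//; field; rewrite !gt_eqF.
move: (u - us) (v - vs) hx hy => x y hx hy.
have i1 : 0 <= (1 + u)^-1 * (1 + us)^-1 <= 1.
  have inv1 (w : R) : 0 <= w -> 0 <= (1 + w)^-1 /\ (1 + w)^-1 <= 1.
    move=> w0; have w1 : 0 < 1 + w by rewrite ltr_pwDl.
    by split; [rewrite invr_ge0 ltW|rewrite invf_le1// lerDl].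
  have [j1 j2] := inv1 u u0; have [j3 j4] := inv1 us us_ge0.
  by rewrite mulr_ge0//= mulr_ile1.
have p1 : p <= 1 by case/andP: (frac_itv us_ge0).
case/andP: i1; move: ((1 + u)^-1 * (1 + us)^-1) => i i0 i1.
have x2 : x ^+ 2 <= n ^+ 2 by rewrite -(real_normK (num_real x)) lerXn2r ?nnegrE.
have e1 : `|x * (sl * x - al * x ^+ 2 - y)| <= n * (sl * n + al * n ^+ 2 + n).
  rewrite normrM; apply: ler_pM => //; apply: le_trans (ler_normB _ _) _.
  apply: lerD => //; apply: le_trans (ler_normB _ _) _.
  apply: lerD; first by rewrite normrM gtr0_norm// ler_wpM2l.
  by rewrite ger0_norm ?ler_wpM2l//; nonneg.
have e2 : `|i * (x * (sl * x - al * x ^+ 2 - y))| <= 1 * (n * (sl * n + al * n ^+ 2 + n)).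
  by rewrite normrM (ger0_norm i0); apply: ler_pM.
have e3 : `|p * (al * x ^+ 2)| <= 1 * (al * n ^+ 2).
  rewrite normrM; apply: ler_pM => //; first by rewrite ger0_norm.
  by rewrite ger0_norm ?ler_wpM2l//; nonneg.
apply: le_trans (ler_normB _ _) _; apply: le_trans (lerD e2 e3) _.
rewrite !mul1r le_eqVlt; apply/orP; left; apply/eqP; ring.
Qed.

Local Notation cst_ := (vs * b / (1 + us)).

Lemma G_linear u v n : 0 <= u -> `|u - us| <= n -> `|v - vs| <= n ->
  `|G be u v - cst_ * (u - us)| <= (b * (1 + vs)) * n ^+ 2.
Proof.
move=> u0 hx hy; have n0 : 0 <= n := le_trans (normr_ge0 _) hx.
have u1 : 0 < 1 + u by rewrite ltr_pwDl.
have -> : G be u v - cst_ * (u - us) =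
   b * ((u - us) * ((1 + u)^-1 * (v - vs) - vs * ((1 + u)^-1 * (1 + us)^-1) * (u - us))).
  by rewrite G_eq//; field; rewrite !gt_eqF.
move: (u - us) (v - vs) hx hy => x y hx hy.
have inv1 (w : R) : 0 <= w -> 0 <= (1 + w)^-1 /\ (1 + w)^-1 <= 1.
  move=> w0; have w1 : 0 < 1 + w by rewrite ltr_pwDl.
  by split; [rewrite invr_ge0 ltW|rewrite invf_le1// lerDl].
have [j1 j2] := inv1 u u0; have [j3 j4] := inv1 us us_ge0.
have i0 : 0 <= (1 + u)^-1 * (1 + us)^-1 by rewrite mulr_ge0.
have i1 : (1 + u)^-1 * (1 + us)^-1 <= 1 by rewrite mulr_ile1.
move: ((1 + u)^-1 * (1 + us)^-1) i0 i1 => i i0 i1.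
move: ((1 + u)^-1) j1 j2 => w j1 j2.
have e1 : `|w * y - vs * i * x| <= 1 * n + vs * 1 * n.
  apply: le_trans (ler_normB _ _) _; apply: lerD.
    by rewrite normrM (ger0_norm j1); apply: ler_pM.
  rewrite normrM (ger0_norm (mulr_ge0 vs_ge0 i0)); apply: ler_pM => //; first by rewrite mulr_ge0.
  by rewrite ler_wpM2l.
rewrite normrM (gtr0_norm be_gt1) -[leRHS]mulrA ler_pM2l// normrM.
apply: le_trans (ler_pM _ _ hx e1) _ => //.
rewrite le_eqVlt; apply/orP; left; apply/eqP; ring.
Qed.

(** [A] and [C] solve a Lyapunov equation for the linear part [(p * (sl * x - y), c * x)] of the
    field at E: the mixed term of the derivative cancels and a form in [x ^+ 2] and [y ^+ 2]
    remains, positive because [sl > 0]. Positivity of [disc] makes the quadratic form itself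
    definite. *)
Lemma repelling : exists A C w0 w1 rho kap D : R,
  [/\ 0 < w0, 0 < w1, 0 < rho & 0 < kap] /\ [/\ 0 < D,
    forall x y n, `|x| <= n -> `|y| <= n -> x ^+ 2 - A * x * y + C * y ^+ 2 <= w1 * n ^+ 2,
    forall x y n, n = `|x| \/ n = `|y| -> w0 * n ^+ 2 <= x ^+ 2 - A * x * y + C * y ^+ 2
  & forall u v n p1 p2 del, box_pt u v n -> n <= rho -> 0 <= del <= D ->
     `|p1| <= del * n -> `|p2| <= del * n ->
     kap * ((u - us) ^+ 2 - A * (u - us) * (v - vs) + C * (v - vs) ^+ 2) <=
     (2 * (u - us) - A * (v - vs)) * (F al ga u v - p1) +
     (2 * C * (v - vs) - A * (u - us)) * (G be u v - p2)].
Proof.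
pose c := cst_; have c0 : 0 < c by rewrite /c; posit.
pose A := p * sl / c; have A0 : 0 < A by rewrite /A; posit.
pose C := p / c + p ^+ 2 * sl ^+ 2 / (2 * c ^+ 2).
have C0 : 0 < C by rewrite /C; posit.
have disc : C - A ^+ 2 / 4 = p / c + p ^+ 2 * sl ^+ 2 / (4 * c ^+ 2).
  by rewrite /C /A; field; rewrite !gt_eqF.
have disc0 : 0 < C - A ^+ 2 / 4.
  by rewrite disc; posit.
pose w0 := Num.min (C - A ^+ 2 / 4) ((C - A ^+ 2 / 4) / C).
have w00 : 0 < w0 by rewrite lt_min disc0 divr_gt0.
pose w1 := 1 + A + C; have w10 : 0 < w1 by rewrite /w1; posit.
pose mu := Num.min (p * sl) (p ^+ 2 * sl / c).
have mu0 : 0 < mu.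
  by rewrite lt_min; apply/andP; split; posit.
pose B := 2 + A + 2 * C + A; have B0 : 0 < B by rewrite /B; posit.
pose K := sl + al + 1 + al + b * (1 + vs).
have K0 : 0 < K by rewrite /K; posit.
(* [B] bounds the gradient of the form and [K] the quadratic remainders. The radius and the bound on
   [del] each cost at most [mu / 8 * n ^+ 2] out of [mu / 2 * n ^+ 2]; the remaining
   [mu / 4 * n ^+ 2] is at least [kap] times the form. *)
exists A, C, w0, w1, (Num.min 1 (mu / (8 * B * K))), (mu / (4 * w1)), (mu / (8 * B)).
split; first by split => //; [rewrite lt_min ltr01 /=; posit|posit].
have upper x y n : `|x| <= n -> `|y| <= n -> x ^+ 2 - A * x * y + C * y ^+ 2 <= w1 * n ^+ 2.
  move=> hx hy; have n0 : 0 <= n := le_trans (normr_ge0 _) hx.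
  have x2 : x ^+ 2 <= n ^+ 2 by rewrite -(real_normK (num_real x)) lerXn2r ?nnegrE.
  have y2 : y ^+ 2 <= n ^+ 2 by rewrite -(real_normK (num_real y)) lerXn2r ?nnegrE.
  have xy : - (x * y) <= n ^+ 2.
    rewrite expr2; apply: le_trans (_ : `|x * y| <= _); first by rewrite -normrN ler_norm.
    by rewrite normrM ler_pM.
  have a1 : A * - (x * y) <= A * n ^+ 2 by rewrite ler_pM2l.
  have a2 : C * y ^+ 2 <= C * n ^+ 2 by rewrite ler_pM2l.
  by rewrite /w1; move: a1 a2 x2; lra.
split => //; first by posit.
  move=> x y n [] ->; rewrite real_normK ?num_real//.
  - have -> : x ^+ 2 - A * x * y + C * y ^+ 2 =
      C * (y - A * x / (2 * C)) ^+ 2 + (C - A ^+ 2 / 4) / C * x ^+ 2.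
      by field; rewrite gt_eqF.
    have h1 : 0 <= C * (y - A * x / (2 * C)) ^+ 2 by rewrite mulr_ge0 ?sqr_ge0// ltW.
    have h2 : w0 * x ^+ 2 <= (C - A ^+ 2 / 4) / C * x ^+ 2.
      by rewrite ler_wpM2r ?sqr_ge0// ge_min lexx orbT.
    by lra.
  - have -> : x ^+ 2 - A * x * y + C * y ^+ 2 =
      (x - A / 2 * y) ^+ 2 + (C - A ^+ 2 / 4) * y ^+ 2 by field.
    have h1 : 0 <= (x - A / 2 * y) ^+ 2 by rewrite sqr_ge0.
    have h2 : w0 * y ^+ 2 <= (C - A ^+ 2 / 4) * y ^+ 2.
      by rewrite ler_wpM2r ?sqr_ge0// ge_min lexx.
    by lra.
move=> u v n p1 p2 del [/andP[u0 uU] _ hx hy hn]; rewrite le_min => /andP[n1 nr] /andP[d0 dD] h1 h2.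
have n0 : 0 <= n := le_trans (normr_ge0 _) hx.
pose e := K * n ^+ 2 + del * n.
have n2 : 0 <= n ^+ 2 by rewrite sqr_ge0.
have e1 : `|F al ga u v - p1 - p * (sl * (u - us) - (v - vs))| <= e.
  rewrite addrAC; apply: le_trans (ler_normB _ _) _; apply: lerD => //.
  apply: le_trans (F_linear u0 hx hy) _; apply: ler_wpM2r => //.
  have : al * n <= al * 1 by rewrite ler_wpM2l.
  have : 0 <= b * (1 + vs) by nonneg.
  by rewrite /K; lra.
have e2 : `|G be u v - p2 - c * (u - us)| <= e.
  rewrite addrAC; apply: le_trans (ler_normB _ _) _; apply: lerD => //.
  apply: le_trans (G_linear u0 hx hy) _; apply: ler_wpM2r => //.
  by rewrite /K; have := sl_ge0; have := al_ge0; lra.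
have Ee : B * n * e <= mu / 4 * n ^+ 2.
  have k1 : K * n <= mu / (8 * B).
    move: nr; rewrite ler_pdivlMr ?mulr_gt0// => nr.
    by rewrite ler_pdivlMr ?mulr_gt0//; move: nr; lra.
  have -> : B * n * e = B * (K * n + del) * n ^+ 2 by rewrite /e; ring.
  apply: ler_wpM2r => //; rewrite mulrC -ler_pdivlMr//.
  have -> : mu / 4 / B = mu / (8 * B) + mu / (8 * B) by field; rewrite gt_eqF.
  exact: lerD.
move: (u - us) (v - vs) (F al ga u v - p1) (G be u v - p2) hx hy hn e1 e2 => x y f g hx hy hn e1 e2.
have lin : (2 * x - A * y) * (p * (sl * x - y)) + (2 * C * y - A * x) * (c * x) =
    p * sl * x ^+ 2 + p ^+ 2 * sl / c * y ^+ 2.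
  by rewrite /A /C; field; rewrite !gt_eqF.
have dev : `|(2 * x - A * y) * (f - p * (sl * x - y)) + (2 * C * y - A * x) * (g - c * x)| <= B * n * e.
  apply: le_trans (ler_normD _ _) _; rewrite !normrM.
  have q1 : `|2 * x - A * y| <= 2 * n + A * n.
    apply: le_trans (ler_normB _ _) _; rewrite [`|2 * x|]normrM [`|A * y|]normrM (gtr0_norm A0) ger0_norm//.
    by apply: lerD; apply: ler_wpM2l => //; exact: ltW.
  have q2 : `|2 * C * y - A * x| <= 2 * C * n + A * n.
    have C2 : 0 <= 2 * C by rewrite mulr_ge0// ltW.
    apply: le_trans (ler_normB _ _) _; rewrite [`|2 * C * y|]normrM [`|A * x|]normrM (gtr0_norm A0) (ger0_norm C2).
    by apply: lerD; apply: ler_wpM2l => //; exact: ltW.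
  have -> : B * n * e = (2 * n + A * n) * e + (2 * C * n + A * n) * e by rewrite /B; ring.
  by apply: lerD; apply: ler_pM.
have split_ : (2 * x - A * y) * f + (2 * C * y - A * x) * g =
   (p * sl * x ^+ 2 + p ^+ 2 * sl / c * y ^+ 2) +
   ((2 * x - A * y) * (f - p * (sl * x - y)) + (2 * C * y - A * x) * (g - c * x)).
  by rewrite -lin; ring.
rewrite split_.
have l1 : mu * x ^+ 2 <= p * sl * x ^+ 2 by rewrite ler_wpM2r ?sqr_ge0// ge_min lexx.
have l2 : mu * y ^+ 2 <= p ^+ 2 * sl / c * y ^+ 2 by rewrite ler_wpM2r ?sqr_ge0// ge_min lexx orbT.
have n2le : n ^+ 2 <= 2 * (x ^+ 2 + y ^+ 2).
  have : n ^+ 2 <= (`|x| + `|y|) ^+ 2 by rewrite lerXn2r ?nnegrE.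
  have := sqr_ge0 (`|x| - `|y|).
  rewrite -(real_normK (num_real x)) -(real_normK (num_real y)).
  by rewrite sqrrB sqrrD; lra.
have l3 : mu / (4 * w1) * (x ^+ 2 - A * x * y + C * y ^+ 2) <= mu / 4 * n ^+ 2.
  have -> : mu / 4 * n ^+ 2 = mu / (4 * w1) * (w1 * n ^+ 2) by field; rewrite gt_eqF.
  by rewrite ler_wpM2l ?upper// ltW// divr_gt0// mulr_gt0.
have l4 : mu * n ^+ 2 <= mu * (2 * (x ^+ 2 + y ^+ 2)) by rewrite ler_wpM2l// ltW.
by move: dev; rewrite ler_norml => /andP[l5 _]; lra.
Qed.

Lemma holling_lip u v u' v' n : 0 <= u -> 0 <= v <= V1 -> 0 <= u' ->
  `|u - u'| <= n -> `|v - v'| <= n ->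
  `|u * v / (1 + u) - u' * v' / (1 + u')| <= (V1 + 1) * n.
Proof.
move=> u0 /andP[v0 vV] u0' hu hv.
have u1 : 0 < 1 + u by rewrite ltr_pwDl. have u1' : 0 < 1 + u' by rewrite ltr_pwDl.
have -> : u * v / (1 + u) - u' * v' / (1 + u') =
  v * ((1 + u)^-1 * (1 + u')^-1) * (u - u') + u' / (1 + u') * (v - v').
  by field; rewrite !gt_eqF.
have inv1 (w : R) : 0 <= w -> 0 <= (1 + w)^-1 /\ (1 + w)^-1 <= 1.
  move=> w0; have w1 : 0 < 1 + w by rewrite ltr_pwDl.
  by split; [rewrite invr_ge0 ltW|rewrite invf_le1// lerDl].
have [j1 j2] := inv1 u u0; have [j3 j4] := inv1 u' u0'.
have i0 : 0 <= (1 + u)^-1 * (1 + u')^-1 by rewrite mulr_ge0.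
have i1 : (1 + u)^-1 * (1 + u')^-1 <= 1 by rewrite mulr_ile1.
have /andP[w0 w1] := frac_itv u0'.
rewrite mulrDl mul1r; apply: le_trans (ler_normD _ _) _; rewrite !normrM.
apply: lerD.
  rewrite (ger0_norm v0) -normrM (ger0_norm i0); apply: ler_pM => //.
    by rewrite mulr_ge0.
  by rewrite -[leRHS]mulr1; apply: ler_pM.
by rewrite -normrM (ger0_norm w0) -[leRHS]mul1r; apply: ler_pM.
Qed.

Lemma field_lip : exists2 L : R, 0 < L & forall u v u' v' n,
  0 <= u <= U1 -> 0 <= v <= V1 -> 0 <= u' <= U1 -> 0 <= v' <= V1 ->
  `|u - u'| <= n -> `|v - v'| <= n ->
  `|F al ga u v - F al ga u' v'| <= L * n /\ `|G be u v - G be u' v'| <= L * n.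
Proof.
pose L := al * ga + 2 * al * U1 + be * (V1 + 1) + V1 + 2.
have a1 : 0 < al * ga by posit.
have a2 : 0 < 2 * al * U1 by posit.
have a3 : 0 < be * (V1 + 1) by posit.
have L0 : 0 < L by rewrite /L; posit.
exists L => // u v u' v' n /andP[u0 uU] hv /andP[u0' uU'] hv' hu' hv''.
have n0 : 0 <= n := le_trans (normr_ge0 _) hu'.
have hw := holling_lip u0 hv u0' hu' hv''.
have hs : `|u + u'| <= 2 * U1 by rewrite ger0_norm ?addr_ge0//; lra.
split.
- have -> : F al ga u v - F al ga u' v' = al * ga * (u - u') - al * ((u - u') * (u + u')) -
     (u * v / (1 + u) - u' * v' / (1 + u')) by rewrite /F; ring.
  apply: le_trans (ler_normB _ _) _.
  apply: le_trans (lerD (ler_normB _ _) hw) _.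
  rewrite normrM (gtr0_norm a1) [`|al * _|]normrM (gtr0_norm hal) [`|(u - u') * _|]normrM.
  have e1 : al * ga * `|u - u'| <= al * ga * n by rewrite ler_pM2l.
  have e2 : al * (`|u - u'| * `|u + u'|) <= al * (n * (2 * U1)) by rewrite ler_pM2l// ler_pM.
  have e3 : 0 <= be * (V1 + 1) * n by rewrite mulr_ge0// ltW.
  by rewrite /L; move: e1 e2 e3; lra.
- have -> : G be u v - G be u' v' = be * (u * v / (1 + u) - u' * v' / (1 + u')) - (v - v').
    by rewrite /G; ring.
  apply: le_trans (ler_normB _ _) _.
  rewrite normrM (gtr0_norm hbe).
  have e1 : be * `|u * v / (1 + u) - u' * v' / (1 + u')| <= be * ((V1 + 1) * n) by rewrite ler_pM2l.
  have e2 : 0 <= (al * ga + 2 * al * U1 + V1 + 1) * n.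
    by rewrite mulr_ge0// ltW; posit.
  by apply: le_trans (lerD e1 hv'') _; rewrite /L; move: e2; lra.
Qed.

End VectorField.

(** * Leaving a half plane in bounded time *)

Section Halves.
Context {R : realType}.

(* Along an orbit the quantities [JA] and [JB] grow at a definite rate while [y <= 0] and [y >= 0] respectively, and [y] can only change from negative to positive. *)
Lemma leave_half (x y JA JB dy dA dB : R -> R) (s D c B : R) : 0 < c -> 0 < D -> 2 * B < c * D ->
  {within `[s, s + 2 * D], continuous y} ->
  {within `[s, s + 2 * D], continuous JA} -> {within `[s, s + 2 * D], continuous JB} ->
  (forall t, s < t <= s + 2 * D -> is_derive t 1 y (dy t)) ->
  (forall t, s < t <= s + 2 * D -> is_derive t 1 JA (dA t)) ->
  (forall t, s < t <= s + 2 * D -> is_derive t 1 JB (dB t)) ->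
  (forall t, s <= t <= s + 2 * D -> `|JA t| <= B /\ `|JB t| <= B) ->
  (forall t, s <= t <= s + 2 * D -> 0 < x t -> y t <= 0 -> c <= dA t) ->
  (forall t, s <= t <= s + 2 * D -> 0 < x t -> 0 <= y t -> c <= dB t) ->
  (forall t, s <= t <= s + 2 * D -> 0 < x t -> y t = 0 -> 0 < dy t) ->
  exists2 t, s <= t <= s + 2 * D & x t <= 0.
Proof.
move=> c0 D0 BD cy cA cB hy hA hB bnd iA iB iy.
apply: contrapT => /forall2NP H.
have {}H t : s <= t <= s + 2 * D -> 0 < x t.
  by move=> ht; rewrite ltNge; apply/negP => h; case: (H t).
(* If [y] stayed nonpositive for time [D], then [JA] would increase by at least [c * D > 2 * B],
   against its bound [B]. From [s1] on [y] remains positive, and the same argument for [JB] ends the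
   proof. *)
have [s1 /andP[s1a s1b] ys1] : exists2 s1, s <= s1 <= s + D & 0 < y s1.
  apply: contrapT => /forall2NP H1.
  have {}H1 t : s <= t <= s + D -> y t <= 0.
    by move=> ht; rewrite leNgt; apply/negP => h; case: (H1 t).
  have sub t : s < t < s + D -> s < t <= s + 2 * D.
    by move=> /andP[h1 h2]; apply/andP; split; lra.
  have sD : s <= s + D by lra.
  have sD2 : s + D <= s + 2 * D by lra.
  have := mvt_ge sD (within_sub (lexx s) sD2 cA) (fun t h => hA t (sub t h)) (c := c).
  have -> : s + D - s = D by ring.
  have dA_ge t : s < t < s + D -> c <= dA t.
    by move=> /andP[t1 t2]; apply: iA; [|apply: H|apply: H1]; apply/andP; split; lra.
  move=> /(_ dA_ge) h.
  have [] := bnd s _; first by apply/andP; split; lra.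
  have [] := bnd (s + D) _; first by apply/andP; split; lra.
  by rewrite !ler_norml => /andP[b1 b2] _ /andP[b3 b4] _; lra.
have pos t : s1 <= t <= s1 + D -> 0 < y t.
  move=> /andP[t1 t2].
  have t3 : t <= s + 2 * D by lra.
  apply: (@barrier_strict _ y dy s1 t t1 (within_sub s1a t3 cy)) => //.
  - by move=> u /andP[u1 u2]; apply: hy; apply/andP; split; lra.
  - by move=> u /andP[u1 u2]; apply: iy; [|apply: H]; apply/andP; split; lra.
have sD : s1 <= s1 + D by lra.
have sD2 : s1 + D <= s + 2 * D by lra.
have sub t : s1 < t < s1 + D -> s < t <= s + 2 * D.
  by move=> /andP[h1 h2]; apply/andP; split; lra.
have := mvt_ge sD (within_sub s1a sD2 cB) (fun t h => hB t (sub t h)) (c := c).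
have -> : s1 + D - s1 = D by ring.
have dB_ge t : s1 < t < s1 + D -> c <= dB t.
  by move=> /andP[t1 t2]; apply: iB; [|apply: H|apply/ltW/pos]; apply/andP; split; lra.
move=> /(_ dB_ge) h.
have [] := bnd s1 _; first by apply/andP; split; lra.
have [] := bnd (s1 + D) _; first by apply/andP; split; lra.
by rewrite !ler_norml => /andP[b1 b2] [/andP[b5 b6]] /andP[b3 b4] /andP[b7 b8]; lra.
Qed.

End Halves.

(** * Dynamics of the perturbed system *)

Lemma derive_within {R : realType} (g dg : R -> R) (a b : R) :
  (forall t, a <= t <= b -> is_derive t 1 g (dg t)) -> {within `[a, b], continuous g}.
Proof.
move=> H; apply: derivable_within_continuous => t; rewrite in_itv /= => /H h.
exact: (@ex_derive _ _ _ _ _ _ _ h).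
Qed.

Lemma within_continuousN {R : realType} (A : set R) (g : R -> R) :
  {within A, continuous g} -> {within A, continuous (fun t => - g t)}.
Proof.
move=> cg; have h : {within A, continuous (- g)} by move=> t; apply: continuousN; exact: cg.
exact: h.
Qed.

Section PerturbedSystem.
Context {R : realType}.
Implicit Types (X Y Z : R * R) (x : R -> R * R) (s t u v w : R).
Variables (al be ga r : R).
Hypotheses (hal : 0 < al) (hbe : 0 < be) (hga : 0 < ga) (hr : 0 < r).
Hypothesis hcoex : be + 1 < ga * (be - 1).
Local Notation us := (ustar be).
Local Notation vs := (vstar al be ga).
Local Notation S := (triangle be r).
Local Notation S0 := (triangle0 be r).
Local Notation p := (us / (1 + us)).
Hypothesis hE : be * us + vs < r.
Variables (phi : R * R -> R * R) (del : R).
Hypothesis del0 : 0 <= del.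
Hypothesis phiE : phi (us, vs) = (0, 0).
Hypothesis phi_lip : forall X Y, dist (phi X) (phi Y) <= del * dist X Y.
Local Notation f := (ps_field al be ga phi).
Local Notation E := (us, vs).
Local Notation U1 := (r / be).
Local Notation V1 := r.

Let us0 : 0 < us. Proof. exact: us_gt0 hbe hga hcoex. Qed.
Let vs0 : 0 < vs. Proof. exact: vs_gt0 hal hbe hga hcoex. Qed.
Let us_U1 : us <= U1.
Proof. by rewrite ler_pdivlMr// mulrC; have := hE; have := vs0; lra. Qed.
Let vs_V1 : vs <= V1.
Proof. by have := mulr_gt0 hbe us0; have := hE; lra. Qed.
Let U1_gt0 : 0 < U1. Proof. by rewrite divr_gt0. Qed.

Lemma triangle_box X : S X -> 0 <= X.1 <= U1 /\ 0 <= X.2 <= V1.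
Proof.
move=> [h1 h2 h3]; have := mulr_ge0 (ltW hbe) h1.
by rewrite h1 h2 /= ler_pdivlMr// mulrC => h; split; lra.
Qed.

Lemma triangleE : S0 E.
Proof. by split => //=; split => /=; rewrite ltW. Qed.

Lemma triangle0_sub X : S0 X -> S X. Proof. by case. Qed.

Lemma dist_add X Y : dist X Y <= `|X.1 - Y.1| + `|X.2 - Y.2|.
Proof. by apply: dist_le; rewrite ?lerDl ?lerDr. Qed.

Lemma box_ptE X : S X -> box_pt al be ga U1 V1 X.1 X.2 (dist X E).
Proof.
move=> /triangle_box[h1 h2]; split=> //; [exact: (dist_fst X E)|exact: (dist_snd X E)|].
exact: dist_add.
Qed.

Lemma dist_bound X : S X -> dist X E <= U1 + V1.
Proof.
move=> /triangle_box[/andP[h1 h2] /andP[h3 h4]].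
apply: dist_le => /=; rewrite ler_norml; apply/andP; split;
  have := us0; have := vs0; have := us_U1; have := vs_V1; have := U1_gt0; have := hr; lra.
Qed.

Lemma f_lipschitz : exists2 L : R, 0 < L & forall X Y, S X -> S Y -> dist (f X) (f Y) <= L * dist X Y.
Proof.
have [L L0 hL] := field_lip hal hbe hga hcoex us_U1 vs_V1.
exists (L + del); first by rewrite ltr_pwDl.
move=> X Y /triangle_box[hX1 hX2] /triangle_box[hY1 hY2].
have [h1 h2] := hL _ _ _ _ _ hX1 hX2 hY1 hY2 (dist_fst X Y) (dist_snd X Y).
have h3 := phi_lip X Y.
have e (a b c d : R) : a - b - (c - d) = (a - c) - (b - d) by ring.
rewrite mulrDl; apply: dist_le => /=; rewrite e; apply: le_trans (ler_normB _ _) (lerD _ _) => //.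
- exact: le_trans (dist_fst (phi X) (phi Y)) h3.
- exact: le_trans (dist_snd (phi X) (phi Y)) h3.
Qed.

Lemma fE0 : f E = (0, 0).
Proof.
rewrite /ps_field /= phiE /= !subr0 (@F_eq _ al be ga hbe hga hcoex us vs (ltW us0)) (@G_eq _ be ga hbe hga hcoex us vs (ltW us0)).
by rewrite !subrr expr0n !mulr0 !subr0 mulr0 mul0r.
Qed.

Lemma phi1_le X : S X -> `|(phi X).1| <= del * dist X E.
Proof.
move=> _; have := le_trans (dist_fst _ _) (phi_lip X E).
by rewrite phiE /= subr0.
Qed.

Lemma phi2_le X : S X -> `|(phi X).2| <= del * dist X E.
Proof.
move=> _; have := le_trans (dist_snd _ _) (phi_lip X E).
by rewrite phiE /= subr0.
Qed.

Variable L : R.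
Hypothesis L0 : 0 < L.
Hypothesis f_lip : forall X Y, S X -> S Y -> dist (f X) (f Y) <= L * dist X Y.

Let M := L * (U1 + V1).
Let M0 : 0 < M. Proof. by rewrite mulr_gt0// addr_gt0. Qed.

Lemma f_bound X : S X -> `|(f X).1| <= M /\ `|(f X).2| <= M.
Proof.
move=> SX; have h : dist (f X) (f E) <= M.
  apply: le_trans (f_lip SX (triangle0_sub triangleE)) _.
  by rewrite ler_pM2l// dist_bound.
have := le_trans (dist_fst _ _) h; have := le_trans (dist_snd _ _) h.
by rewrite fE0 /= !subr0.
Qed.

Variable T : R -> R * R -> R * R.
Hypothesis HT : is_semiflow f S T.

Let TS X t := @flow_S _ f S T HT X t.
Let Tmod X s t := @flow_modulus _ f S M f_bound T HT X s t.

(* The semiflow stays in the triangle, so the field cannot point outwards along the axes. *)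
Lemma inward1 v : S (0, v) -> (phi (0, v)).1 <= 0.
Proof.
move=> SX; rewrite leNgt; apply/negP => q0; set q := (phi _).1 in q0.
(* Up to this time the orbit moves by at most [M * t], so the velocity changes by at most
   [L * M * t = q / 2] and stays below [- (q / 2)]; the first coordinate becomes negative. *)
pose t := q / (2 * L * M).
have t0 : 0 < t by rewrite /t; posit.
have hx := flow_traj HT SX.
have f0 : (f (0, v)).1 = - q by rewrite /= /F mulr0 !mul0r subr0 sub0r.
have dec u : 0 < u < t -> (f (T u (0, v))).1 <= - (q / 2).
  move=> /andP[u0 ut].
  have := le_trans (dist_fst _ _) (f_lip (TS SX (ltW u0)) SX).
  have := Tmod SX (ltW u0) (lexx 0); rewrite (flow0 HT)// subr0 gtr0_norm// f0 => h1.
  have h2 : L * dist (T u (0, v)) (0, v) <= L * (M * u) by rewrite ler_pM2l.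
  have h3 : L * (M * u) <= q / 2.
    have -> : q / 2 = L * (M * t) by rewrite /t; field; rewrite !gt_eqF.
    by rewrite !ler_pM2l// ltW.
  by rewrite ler_norml => /andP[_ h4]; lra.
have pos (u : R) : 0 < u < t -> 0 < u by case/andP.
have := mvt_le (ltW t0) (traj_cont1 hx (lexx 0)) (fun u h => traj_derive1 hx (pos u h)) dec.
rewrite (flow0 HT)//= subr0 subr0 mulNr => h.
have [h1 _ _] := TS SX (ltW t0).
by have := mulr_gt0 (_ : 0 < q / 2) t0; rewrite divr_gt0// => /(_ isT); lra.
Qed.

Lemma inward2 u : S (u, 0) -> (phi (u, 0)).2 <= 0.
Proof.
move=> SX; rewrite leNgt; apply/negP => q0; set q := (phi _).2 in q0.
pose t := q / (2 * L * M).
have t0 : 0 < t by rewrite /t; posit.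
have hx := flow_traj HT SX.
have f0 : (f (u, 0)).2 = - q by rewrite /= /G mul0r sub0r.
have dec w : 0 < w < t -> (f (T w (u, 0))).2 <= - (q / 2).
  move=> /andP[w0 wt].
  have := le_trans (dist_snd _ _) (f_lip (TS SX (ltW w0)) SX).
  have := Tmod SX (ltW w0) (lexx 0); rewrite (flow0 HT)// subr0 gtr0_norm// f0 => h1.
  have h2 : L * dist (T w (u, 0)) (u, 0) <= L * (M * w) by rewrite ler_pM2l.
  have h3 : L * (M * w) <= q / 2.
    have -> : q / 2 = L * (M * t) by rewrite /t; field; rewrite !gt_eqF.
    by rewrite !ler_pM2l// ltW.
  by rewrite ler_norml => /andP[_ h4]; lra.
have pos (w : R) : 0 < w < t -> 0 < w by case/andP.
have := mvt_le (ltW t0) (traj_cont2 hx (lexx 0)) (fun w h => traj_derive2 hx (pos w h)) dec.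
rewrite (flow0 HT)//= subr0 subr0 mulNr => h.
have [_ h1 _] := TS SX (ltW t0).
by have := mulr_gt0 (_ : 0 < q / 2) t0; rewrite divr_gt0// => /(_ isT); lra.
Qed.

(** Compare with the foot [(0, X.2)] on the axis, where [inward1] gives the sign. *)
Lemma phi1_axis X : S X -> (phi X).1 <= del * X.1.
Proof.
move=> [h1 h2 h3]; have S1 : S (0, X.2).
  by split => //=; have := mulr_ge0 (ltW hbe) h1; lra.
have := inward1 S1; have := le_trans (dist_fst _ _) (phi_lip X (0, X.2)).
have -> : dist X (0, X.2) = X.1.
  by rewrite /dist prod_normE /= subr0 subrr normr0 ger0_norm//; apply/max_idPl.
by rewrite ler_norml => /andP[_ h4] h5; lra.
Qed.

Lemma phi2_axis X : S X -> (phi X).2 <= del * X.2.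
Proof.
move=> [h1 h2 h3]; have S1 : S (X.1, 0) by split => //=; lra.
have := inward2 S1; have := le_trans (dist_snd _ _) (phi_lip X (X.1, 0)).
have -> : dist X (X.1, 0) = X.2.
  by rewrite /dist prod_normE /= subr0 subrr normr0 ger0_norm//; apply/max_idPr.
by rewrite ler_norml => /andP[_ h4] h5; lra.
Qed.

Hypothesis hinv0 : pos_invariant f S0.

(** [pos_invariant] speaks of solutions on an open interval around 0, while the semiflow starts at
    0. Short times are covered by the Lipschitz bound in time, and the time origin is then moved to
    [s0 > 0]. *)
Lemma flow_S0 X t : S0 X -> 0 <= t -> S0 (T t X).
Proof.
move=> [SX X1 X2] t0; pose s0 := Num.min X.1 X.2 / (2 * M).
have m0 : 0 < Num.min X.1 X.2 by rewrite lt_min X1.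
have s00 : 0 < s0 by rewrite /s0; posit.
have near0 s : 0 <= s <= s0 -> S0 (T s X).
  move=> /andP[s1 s2]; have := Tmod SX s1 (lexx 0).
  rewrite (flow0 HT)// subr0 (ger0_norm s1) => h.
  have h2 : M * s <= Num.min X.1 X.2 / 2.
    have -> : Num.min X.1 X.2 / 2 = M * s0 by rewrite /s0; field; rewrite gt_eqF.
    by rewrite ler_pM2l.
  have m1 : Num.min X.1 X.2 <= X.1 by rewrite ge_min lexx.
  have m2 : Num.min X.1 X.2 <= X.2 by rewrite ge_min lexx orbT.
  have := le_trans (dist_fst (T s X) X) h; have := le_trans (dist_snd (T s X) X) h.
  rewrite !ler_norml => /andP[h3 _] /andP[h4 _].
  by split; [exact: TS|lra|lra].
have [ts|st] := leP t s0; first by apply: near0; rewrite t0.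
have := @hinv0 (- s0) (t - s0 + 1) (fun s => T (s0 + s) X).
rewrite oppr_lt0 addr0 => /(_ s00 _ _ _ (t - s0)); rewrite addrCA subrr addr0; apply.
- by lra.
- move=> s; rewrite /= in_itv /= => /andP[h1 h2].
  have hd := traj_derive (flow_traj HT SX) (_ : 0 < s0 + s).
  by apply: (@is_derive_translate _ (T ^~ X) s s0); apply: hd; lra.
- by apply: near0; rewrite lexx ltW.
- by apply/andP; split; lra.
Qed.

(** * The Lyapunov function at E *)

Section Repelling.
Variables (A C w0 w1 rho kap : R).
Hypotheses (hw0 : 0 < w0) (hw1 : 0 < w1) (hrho : 0 < rho) (hkap : 0 < kap).
Hypothesis W_upper : forall x y n : R, `|x| <= n -> `|y| <= n ->
  x ^+ 2 - A * x * y + C * y ^+ 2 <= w1 * n ^+ 2.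
Hypothesis W_lower : forall x y n : R, n = `|x| \/ n = `|y| ->
  w0 * n ^+ 2 <= x ^+ 2 - A * x * y + C * y ^+ 2.
Hypothesis W_repel : forall u v n p1 p2, box_pt al be ga U1 V1 u v n -> n <= rho ->
  `|p1| <= del * n -> `|p2| <= del * n ->
  kap * ((u - us) ^+ 2 - A * (u - us) * (v - vs) + C * (v - vs) ^+ 2) <=
  (2 * (u - us) - A * (v - vs)) * (F al ga u v - p1) +
  (2 * C * (v - vs) - A * (u - us)) * (G be u v - p2).
Hypothesis rho_box : forall Z, dist Z E <= rho -> S0 Z.

Definition lyap X := (X.1 - us) ^+ 2 - A * (X.1 - us) * (X.2 - vs) + C * (X.2 - vs) ^+ 2.
Local Notation W := lyap.
Definition dlyap X := (2 * (X.1 - us) - A * (X.2 - vs)) * (f X).1 +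
  (2 * C * (X.2 - vs) - A * (X.1 - us)) * (f X).2.
(** Below this level [W] forces the distance to E under [rho], where the repulsion estimate
    holds. *)
Definition lyap_level := w0 * rho ^+ 2.
Local Notation c1 := lyap_level.

Lemma lyap_level_gt0 : 0 < c1. Proof. by rewrite mulr_gt0 ?exprn_gt0. Qed.

Lemma dist_cases X : dist X E = `|X.1 - us| \/ dist X E = `|X.2 - vs|.
Proof. by rewrite /dist prod_normE /=; case: leP => _; [right|left]. Qed.

Lemma lyap_lower X : w0 * dist X E ^+ 2 <= W X.
Proof. exact/W_lower/dist_cases. Qed.

Lemma lyap_ge0 X : 0 <= W X.
Proof. by apply: le_trans (lyap_lower X); rewrite mulr_ge0 ?sqr_ge0// ltW. Qed.

Lemma lyap_small X (e : R) : 0 < e -> W X < w0 * e ^+ 2 -> dist X E < e.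
Proof.
move=> e0 h; have := le_lt_trans (lyap_lower X) h; rewrite ltr_pM2l//.
by rewrite ltr_sqr ?nnegrE ?dist_ge0 ?(ltW e0)//.
Qed.

Lemma lyap_gt0 X : X <> E -> 0 < W X.
Proof.
move=> XE; apply: lt_le_trans (lyap_lower X); rewrite mulr_gt0// exprn_gt0//.
by rewrite lt_neqAle dist_ge0 andbT eq_sym /dist normr_eq0 subr_eq0; apply/eqP.
Qed.

Lemma lyap_E : W E = 0.
Proof. by rewrite /lyap /= !subrr expr0n !mulr0 subr0 addr0. Qed.

Lemma lyap_far : exists2 n0 : R, 0 < n0 & forall X, c1 <= W X -> n0 <= dist X E.
Proof.
have c10 := lyap_level_gt0.
exists (Num.min 1 (c1 / w1)); first by rewrite lt_min ltr01 divr_gt0.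
move=> X hX; rewrite leNgt; apply/negP; rewrite lt_min => /andP[d1 d2].
have := W_upper (dist_fst X E) (dist_snd X E); rewrite -/(W X) => h.
have d0 := dist_ge0 X E.
have : w1 * dist X E ^+ 2 <= w1 * dist X E.
  by rewrite ler_pM2l// expr2 ler_piMr// ltW.
by move: d2; rewrite ltr_pdivlMr// => d2; lra.
Qed.

Lemma lyap_grow X : S X -> W X < c1 -> kap * W X <= dlyap X.
Proof.
move=> SX h; apply: (W_repel (box_ptE SX)) (phi1_le SX) (phi2_le SX).
exact/ltW/lyap_small.
Qed.

Lemma lyap_derive x t : traj f S x -> 0 < t ->
  is_derive t 1 (fun s => W (x s)) (dlyap (x t)).
Proof.
move=> hx t0.
have h1 := is_deriveB (traj_derive1 hx t0) (is_derive_cst us t 1).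
have h2 := is_deriveB (traj_derive2 hx t0) (is_derive_cst vs t 1).
have h3 := is_deriveM (is_derive_cst A t 1) (is_deriveM h1 h2).
have h4 := is_deriveM (is_derive_cst C t 1) (is_deriveX 2 h2).
apply: (is_derive_ext (is_deriveD (is_deriveB (is_deriveX 2 h1) h3) h4)) => [s|].
  by rewrite !fctE /lyap /=; ring.
by rewrite /GRing.scale /= /dlyap !fctE /= !expr1; ring.
Qed.

Lemma lyap_cont x (a b : R) : traj f S x -> 0 <= a -> {within `[a, b], continuous (fun s => W (x s))}.
Proof.
move=> hx a0.
have cst (c : R) : {within `[a, b], continuous (fun _ : R => c)}.
  by apply: continuous_subspaceT => t; exact: cvg_cst.
have h1 := within_continuousB (traj_cont1 (b := b) hx a0) (cst us).
have h2 := within_continuousB (traj_cont2 (b := b) hx a0) (cst vs).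
apply: within_continuousD; last exact: (within_continuousM (cst C) (within_continuousM h2 h2)).
apply: within_continuousB; first exact: (within_continuousM h1 h1).
exact: (within_continuousM (within_continuousM (cst A) h1) h2).
Qed.

(** Below [c1] the derivative of [W] is nonnegative, so [barrier] applies to every level
    [c <= c1]. *)
Lemma lyap_stay x s t (c : R) : traj f S x -> 0 <= s -> s <= t -> c <= c1 ->
  c <= W (x s) -> c <= W (x t).
Proof.
move=> hx s0 st cc1 hs.
have pos (u : R) : s < u < t -> 0 < u by move=> /andP[h _]; exact: le_lt_trans h.
apply: (barrier st (lyap_cont (b := t) hx s0) (fun u h => lyap_derive hx (pos u h))) hs.
move=> u h hc; apply: le_trans (lyap_grow (traj_S hx (ltW (pos u h))) (lt_le_trans hc cc1)).
by rewrite mulr_ge0 ?lyap_ge0// ltW.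
Qed.

(** Integrates [W' >= kap * W] with [W] replaced by its initial, hence smallest, value. This linear
    growth suffices to expel orbits from E and, read backwards, to drive [W] to 0. Smallness is
    asked at the final time only, since [lyap_stay] transfers it to all earlier times. *)
Lemma lyap_lin x s t : traj f S x -> 0 <= s -> s <= t -> W (x t) < c1 ->
  W (x s) * (1 + kap * (t - s)) <= W (x t).
Proof.
move=> hx s0 st ht.
have small u : s <= u <= t -> W (x u) < c1.
  move=> /andP[su ut]; rewrite ltNge; apply/negP => h.
  by have := lyap_stay hx (le_trans s0 su) ut (lexx _) h; rewrite leNgt ht.
have pos (u : R) : s < u < t -> 0 < u by move=> /andP[h _]; exact: le_lt_trans h.
have mono u : s <= u <= t -> W (x s) <= W (x u).
  move=> /andP[su ut]; rewrite leNgt; apply/negP => h.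
  have := @lyap_stay x s u (W (x s)) hx s0 su.
  by rewrite ltW ?small ?lexx// => /(_ isT isT); rewrite leNgt h.
have := mvt_ge st (lyap_cont (b := t) hx s0) (fun u h => lyap_derive hx (pos u h)) (c := kap * W (x s)).
move=> H; have {}H : kap * W (x s) * (t - s) <= W (x t) - W (x s).
  apply: H => u h; have h' : s <= u <= t by case/andP: h => h1 h2; rewrite !ltW.
  apply: le_trans (lyap_grow (traj_S hx (ltW (pos u h))) (small u h')).
  by rewrite ler_pM2l// mono.
by lra.
Qed.

Lemma lyap_escape X : S X -> X <> E -> exists2 t0, 0 <= t0 & forall t, t0 <= t -> c1 <= W (T t X).
Proof.
move=> SX XE; have WX := lyap_gt0 XE; have c10 := lyap_level_gt0.
have hx := flow_traj HT SX.
pose t0 := c1 / (kap * W X).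
have t00 : 0 <= t0 by rewrite divr_ge0 ?mulr_ge0// ltW.
exists t0 => // t tt; rewrite leNgt; apply/negP => h.
have := lyap_lin hx (lexx 0) (le_trans t00 tt) h; rewrite (flow0 HT)// subr0 => h2.
have h3 : W X * (1 + kap * t0) <= W X * (1 + kap * t) by rewrite ler_pM2l// lerD2l ler_pM2l.
have e : W X * (1 + kap * t0) = W X + c1 by rewrite /t0; field; rewrite !gt_eqF.
by clear XE; rewrite e in h3; lra.
Qed.

(** * Rotation around E, uniform away from E and from the axes *)

Section Rotation.
Variables (N1 N2 N3 N4 mu : R).
Hypotheses (hN1 : 0 < N1) (hN2 : 0 < N2) (hN3 : 0 < N3) (hN4 : 0 < N4) (hmu : 0 < mu).
Hypothesis quad1 : forall u v n p1 p2, box_pt al be ga U1 V1 u v n -> us <= u -> vs <= v ->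
  `|p1| <= del * n -> `|p2| <= del * n ->
  mu * n <= (G be u v - p2) - N1 * (F al ga u v - p1).
Hypothesis quad2 : forall u v n p1 p2, box_pt al be ga U1 V1 u v n -> u <= us -> vs <= v ->
  `|p1| <= del * n -> `|p2| <= del * n ->
  mu * n <= - (G be u v - p2) - N2 * (F al ga u v - p1).
Hypothesis quad3 : forall u v n p1 p2, box_pt al be ga U1 V1 u v n -> n <= U1 + V1 ->
  0 < u -> u <= us -> v <= vs -> `|p1| <= del * n -> `|p2| <= del * n -> p1 <= del * u ->
  mu * n <= - (G be u v - p2) + N3 * ((F al ga u v - p1) / u).
Hypothesis quad4 : forall u v n p1 p2, box_pt al be ga U1 V1 u v n -> 0 < v ->
  us <= u -> v <= vs -> `|p1| <= del * n -> `|p2| <= del * n -> p2 <= del * v ->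
  mu * n <= (G be u v - p2) / v + N4 * (F al ga u v - p1).
Hypothesis del_u : del < p.
Hypothesis del_v : del < vs * (be - 1) / (1 + U1).

Lemma cross_u X : S X -> X.1 = us -> (X.2 < vs -> 0 < (f X).1) /\ (vs < X.2 -> (f X).1 < 0).
Proof.
case: X => u v SX /= eu; rewrite eu in SX *; apply: (line_u hbe hga hcoex _ del_u).
have := phi1_le SX; congr (_ <= del * _).
by rewrite /dist prod_normE /= subrr normr0; apply/max_idPr.
Qed.

Lemma cross_v X : S X -> X.2 = vs -> (us < X.1 -> 0 < (f X).2) /\ (X.1 < us -> (f X).2 < 0).
Proof.
case: X => u v SX /= ev; rewrite ev in SX *.
have [/andP[u0 uU] _] := triangle_box SX.
apply: (line_v hal hbe hga hcoex us_U1 u0 uU _ del_v).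
have := phi2_le SX; congr (_ <= del * _).
by rewrite /dist prod_normE /= subrr normr0; apply/max_idPl.
Qed.

(** The region of uniform rotation: the distance [a] to the axes bounds the logarithms, and
    [c1 <= W X] bounds the growth rates from below through [lyap_far]. *)
Definition inner (a : R) X := [/\ S0 X, a <= X.1, a <= X.2 & c1 <= W X].

Lemma ln_bound (a w top : R) : 0 < a -> a <= w -> w <= top -> `|ln w| <= `|ln a| + `|ln top|.
Proof.
move=> a0 aw wt; have w00 := lt_le_trans a0 aw; have t0 := lt_le_trans w00 wt.
have h1 : ln a <= ln w by rewrite ler_ln ?posrE.
have h2 : ln w <= ln top by rewrite ler_ln ?posrE.
have h3 := ler_norm (ln top); have h4 := ler_norm (- ln a); rewrite normrN in h4.
have h5 := normr_ge0 (ln a); have h6 := normr_ge0 (ln top).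
by rewrite ler_norml; apply/andP; split; lra.
Qed.

(** [leave_half] is applied to [ln V + N4 * U] below [vs] and to [V - N1 * U] above it. [B] bounds
    both on the inner region, and [D] is chosen so that [c * D = 2 * B + 1]. *)
Lemma half_right (a : R) : 0 < a -> exists2 D, 0 < D & forall x s, traj f S x -> 0 < s ->
  (forall t, s <= t <= s + 2 * D -> inner a (x t)) ->
  exists2 t, s <= t <= s + 2 * D & (x t).1 <= us.
Proof.
move=> a0; have [n0 n00 hn0] := lyap_far.
pose c := mu * n0; have c0 : 0 < c by rewrite mulr_gt0.
pose B := `|ln a| + `|ln V1| + V1 + (N1 + N4) * U1.
have B0 : 0 < B.
  have h5 := normr_ge0 (ln a); have h6 := normr_ge0 (ln V1).
  by have : 0 < (N1 + N4) * U1; [posit|rewrite /B; have := hr; lra].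
pose D := (2 * B + 1) / c; have D0 : 0 < D by rewrite /D; posit.
exists D => // x s hx s0 K.
have pos t : s <= t <= s + 2 * D -> 0 < t by move=> /andP[h _]; exact: lt_le_trans h.
have pos' t : s < t <= s + 2 * D -> s <= t <= s + 2 * D by move=> /andP[/ltW-> ->].
have SK t : s <= t <= s + 2 * D -> S (x t) by move=> /K[/triangle0_sub].
have d1 t (h : s <= t <= s + 2 * D) := traj_derive1 hx (pos t h).
have d2 t (h : s <= t <= s + 2 * D) := traj_derive2 hx (pos t h).
have dy t : s <= t <= s + 2 * D -> is_derive t 1 (fun t => (x t).2 - vs) (f (x t)).2.
  by move=> h; apply: (is_derive_ext (is_deriveB (d2 t h) (is_derive_cst vs t 1))) => //=; rewrite subr0.
have dA t : s <= t <= s + 2 * D ->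
    is_derive t 1 (fun t => ln (x t).2 + N4 * (x t).1) ((f (x t)).2 / (x t).2 + N4 * (f (x t)).1).
  move=> h; have v0 : 0 < (x t).2 by case: (K t h) => -[].
  have h1 := is_derive1_comp (is_derive1_ln v0) (d2 t h).
  apply: (is_derive_ext (is_deriveD h1 (is_deriveM (is_derive_cst N4 t 1) (d1 t h)))) => //=.
  by rewrite /GRing.scale /=; ring.
have dB t : s <= t <= s + 2 * D ->
    is_derive t 1 (fun t => (x t).2 - N1 * (x t).1) ((f (x t)).2 - N1 * (f (x t)).1).
  move=> h; apply: (is_derive_ext (is_deriveB (d2 t h) (is_deriveM (is_derive_cst N1 t 1) (d1 t h)))) => //=.
  by rewrite /GRing.scale /=; ring.
have BD : 2 * B < c * D.
  have -> : c * D = 2 * B + 1 by rewrite /D; field; rewrite gt_eqF.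
  by rewrite ltrDl.
have bnd t : s <= t <= s + 2 * D ->
    `|ln (x t).2 + N4 * (x t).1| <= B /\ `|(x t).2 - N1 * (x t).1| <= B.
  move=> h; have [[SX _ _] _ aV _] := K t h.
  have [/andP[u0 uU] /andP[v0 vV]] := triangle_box SX.
  have h1 := ln_bound a0 aV vV.
  have h2 : N4 * (x t).1 <= N4 * U1 by rewrite ler_pM2l.
  have h3 : N1 * (x t).1 <= N1 * U1 by rewrite ler_pM2l.
  have h4 : 0 <= N4 * (x t).1 by rewrite mulr_ge0// ltW.
  have h5 : 0 <= N1 * (x t).1 by rewrite mulr_ge0// ltW.
  have h6 := normr_ge0 (ln a); have h7 := normr_ge0 (ln V1); have V0 := hr.
  split; rewrite ler_norml; apply/andP; split; rewrite /B; move: h1; rewrite ler_norml => /andP[k1 k2]; lra.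
have far t : s <= t <= s + 2 * D -> c <= mu * dist (x t) E.
  by move=> /K[_ _ _ /hn0 h]; rewrite ler_pM2l.
have [|||t ht xt] := @leave_half _ (fun t => (x t).1 - us) (fun t => (x t).2 - vs) _ _
  (fun t => (f (x t)).2) _ _ s D c B c0 D0 BD (derive_within dy) (derive_within dA) (derive_within dB)
  (fun t h => dy t (pos' t h)) (fun t h => dA t (pos' t h)) (fun t h => dB t (pos' t h)) bnd; last first.
- by exists t => //; move: xt => /=; lra.
- move=> t h /= x0 y0; apply: (cross_v (SK t h) _).1; first by lra.
  by lra.
- move=> t h /= x0 y0; apply: le_trans (far t h) _.
  by apply: (quad1 (box_ptE (SK t h)) _ _ (phi1_le (SK t h)) (phi2_le (SK t h))); lra.
- move=> t h /= x0 y0; apply: le_trans (far t h) _.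
  have v0 : 0 < (x t).2 by case: (K t h) => -[].
  by apply: (quad4 (box_ptE (SK t h)) v0 _ _ (phi1_le (SK t h)) (phi2_le (SK t h)) (phi2_axis (SK t h))); lra.
Qed.

(** The mirror image of [half_right]: with [us - U] and [vs - V] as coordinates, the downward
    crossing of the level [vs] becomes one from negative to positive. *)
Lemma half_left (a : R) : 0 < a -> exists2 D, 0 < D & forall x s, traj f S x -> 0 < s ->
  (forall t, s <= t <= s + 2 * D -> inner a (x t)) ->
  exists2 t, s <= t <= s + 2 * D & us <= (x t).1.
Proof.
move=> a0; have [n0 n00 hn0] := lyap_far.
pose c := mu * n0; have c0 : 0 < c by rewrite mulr_gt0.
pose B := V1 + N2 * U1 + N3 * (`|ln a| + `|ln U1|).
have B0 : 0 < B.
  have : 0 <= N3 * (`|ln a| + `|ln U1|) by rewrite mulr_ge0 ?addr_ge0// ltW.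
  by have : 0 < N2 * U1; [posit|rewrite /B; have := hr; lra].
pose D := (2 * B + 1) / c; have D0 : 0 < D by rewrite /D; posit.
exists D => // x s hx s0 K.
have pos t : s <= t <= s + 2 * D -> 0 < t by move=> /andP[h _]; exact: lt_le_trans h.
have pos' t : s < t <= s + 2 * D -> s <= t <= s + 2 * D by move=> /andP[/ltW-> ->].
have SK t : s <= t <= s + 2 * D -> S (x t) by move=> /K[/triangle0_sub].
have d1 t (h : s <= t <= s + 2 * D) := traj_derive1 hx (pos t h).
have d2 t (h : s <= t <= s + 2 * D) := traj_derive2 hx (pos t h).
have dy t : s <= t <= s + 2 * D -> is_derive t 1 (fun t => vs - (x t).2) (- (f (x t)).2).
  by move=> h; apply: (is_derive_ext (is_deriveB (is_derive_cst vs t 1) (d2 t h))) => //=; rewrite sub0r.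
have dA t : s <= t <= s + 2 * D ->
    is_derive t 1 (fun t => - (x t).2 - N2 * (x t).1) (- (f (x t)).2 - N2 * (f (x t)).1).
  move=> h; apply: (is_derive_ext (is_deriveB (is_deriveN (d2 t h)) (is_deriveM (is_derive_cst N2 t 1) (d1 t h)))) => //=.
  by rewrite /GRing.scale /=; ring.
have dB t : s <= t <= s + 2 * D ->
    is_derive t 1 (fun t => - (x t).2 + N3 * ln (x t).1) (- (f (x t)).2 + N3 * ((f (x t)).1 / (x t).1)).
  move=> h; have u0 : 0 < (x t).1 by case: (K t h) => -[].
  have h1 := is_derive1_comp (is_derive1_ln u0) (d1 t h).
  apply: (is_derive_ext (is_deriveD (is_deriveN (d2 t h)) (is_deriveM (is_derive_cst N3 t 1) h1))) => //=.
  by rewrite /GRing.scale /=; ring.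
have BD : 2 * B < c * D.
  have -> : c * D = 2 * B + 1 by rewrite /D; field; rewrite gt_eqF.
  by rewrite ltrDl.
have bnd t : s <= t <= s + 2 * D ->
    `|- (x t).2 - N2 * (x t).1| <= B /\ `|- (x t).2 + N3 * ln (x t).1| <= B.
  move=> h; have [[SX _ _] aU _ _] := K t h.
  have [/andP[u0 uU] /andP[v0 vV]] := triangle_box SX.
  have h1 := ln_bound a0 aU uU.
  have h2 : N2 * (x t).1 <= N2 * U1 by rewrite ler_pM2l.
  have h3 : `|N3 * ln (x t).1| <= N3 * (`|ln a| + `|ln U1|) by rewrite normrM (gtr0_norm hN3) ler_pM2l.
  have h4 : 0 <= N2 * (x t).1 by rewrite mulr_ge0// ltW.
  have h5 := normr_ge0 (N3 * ln (x t).1).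
  have V0 := hr.
  split; rewrite ler_norml; apply/andP; split; rewrite /B; move: h3; rewrite ler_norml => /andP[k1 k2]; lra.
have far t : s <= t <= s + 2 * D -> c <= mu * dist (x t) E.
  by move=> /K[_ _ _ /hn0 h]; rewrite ler_pM2l.
have [|||t ht xt] := @leave_half _ (fun t => us - (x t).1) (fun t => vs - (x t).2) _ _
  (fun t => - (f (x t)).2) _ _ s D c B c0 D0 BD (derive_within dy) (derive_within dA) (derive_within dB)
  (fun t h => dy t (pos' t h)) (fun t h => dA t (pos' t h)) (fun t h => dB t (pos' t h)) bnd; last first.
- by exists t => //; move: xt => /=; lra.
- move=> t h /= x0 y0; rewrite oppr_gt0; apply: (cross_v (SK t h) _).2; first by lra.
  by lra.
- move=> t h /= x0 y0; apply: le_trans (far t h) _.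
  have u0 : 0 < (x t).1 by case: (K t h) => -[].
  by apply: (quad3 (box_ptE (SK t h)) (dist_bound (SK t h)) u0 _ _ (phi1_le (SK t h)) (phi2_le (SK t h)) (phi1_axis (SK t h))); lra.
- move=> t h /= x0 y0; apply: le_trans (far t h) _.
  by apply: (quad2 (box_ptE (SK t h)) _ _ (phi1_le (SK t h)) (phi2_le (SK t h))); lra.
Qed.

Lemma inner_nE a X : inner a X -> X <> E.
Proof. by move=> [_ _ _ +] e; rewrite e lyap_E leNgt lyap_level_gt0. Qed.

Lemma inner_u a X : inner a X -> X.1 = us -> X.2 < vs \/ vs < X.2.
Proof.
move=> h e; have [|| e2] := ltgtP X.2 vs; [by left|by right|].
by exfalso; apply: (inner_nE h); rewrite -e -e2; case: X {h e e2}.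
Qed.

(** An orbit on the left can reach the line through E only below E, since above E the field points
    to the left. An orbit on the right returns to the line; if it arrives above E it is pushed to
    the left, and the first case applies. The summand 1 is an arbitrary allowance for leaving the
    line. *)
Lemma hits_below a : 0 < a -> exists2 D, 0 < D & forall x s, traj f S x -> 0 < s ->
  (forall t, s <= t <= s + D -> inner a (x t)) ->
  exists2 t, s <= t <= s + D & below us vs (x t).
Proof.
move=> a0; have [D1 D10 H1] := half_right a0; have [D2 D20 H2] := half_left a0.
have left x s : traj f S x -> 0 < s -> (forall t, s <= t <= s + 2 * D2 -> inner a (x t)) ->
    (x s).1 < us -> exists2 t, s <= t <= s + 2 * D2 & below us vs (x t).
  move=> hx s0 K xs; have [t /andP[st tD] ht] := H2 x s hx s0 K.
  have [t1 [/andP[st1 tt1] e before]] := first_time_ge st (traj_cont1 (b := t) hx (ltW s0)) xs ht.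
  have ht1 : s <= t1 <= s + 2 * D2 by rewrite ltW//= (le_trans tt1).
  exists t1 => //; split => //.
  have [//|h] := inner_u (K t1 ht1) e; exfalso.
  have t10 := lt_trans s0 st1.
  have [+ _ _ _] := K t1 ht1; move=> /triangle0_sub SX.
  have dd := traj_derive1 hx t10.
  have dn : 0 < - (f (x t1)).1 by rewrite oppr_gt0; exact: (cross_u SX e).2.
  have [d d0 [Hd _]] := derive_pos_local (is_deriveN dd) dn.
  pose t2 := Num.max s (t1 - d / 2).
  have m1 : s <= t2 by rewrite le_max lexx.
  have m2 : t1 - d / 2 <= t2 by rewrite le_max lexx orbT.
  have m3 : t2 < t1 by rewrite gt_max st1; lra.
  have := before t2; rewrite m1 m3 => /(_ isT).
  have := Hd t2; rewrite m3 andbT => /(_ _).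
  have -> : t1 - d < t2 by lra.
  by move=> /(_ isT) /=; rewrite !fctE /= ltrN2 e => /lt_trans h1 /h1; rewrite ltxx.
have above x s (e : R) : traj f S x -> 0 < s -> 0 < e -> S (x s) -> (x s).1 = us -> vs < (x s).2 ->
    exists2 t, s <= t <= s + e & (x t).1 < us.
  move=> hx s0 e0 SX xs1 xs2.
  have dn : 0 < - (f (x s)).1 by rewrite oppr_gt0; exact: (cross_u SX xs1).2.
  have [d d0 [_ Hd]] := derive_pos_local (is_deriveN (traj_derive1 hx s0)) dn.
  pose t2 := Num.min (s + e) (s + d / 2).
  have m1 : t2 <= s + e by rewrite ge_min lexx.
  have m2 : t2 <= s + d / 2 by rewrite ge_min lexx orbT.
  have m3 : s < t2 by rewrite lt_min; apply/andP; split; lra.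
  exists t2; first by rewrite m1 ltW.
  have := Hd t2; rewrite m3 /= => /(_ ltac:(lra)).
  by rewrite !fctE /= ltrN2 xs1.
have sub (s s' t e e' : R) : s <= s' -> s' + e' <= s + e -> s' <= t <= s' + e' -> s <= t <= s + e.
  by move=> h1 h2 /andP[h3 h4]; rewrite (le_trans h1 h3) (le_trans h4 h2).
exists (2 * D1 + 1 + 2 * D2); first by rewrite addr_gt0 ?mulr_gt0// addr_gt0 ?mulr_gt0.
move=> x s hx s0 K.
(* once the orbit has reached the line above [E], it meets the line below [E] within time [1 + 2 * D2] *)
have from_above s1 : s <= s1 <= s + 2 * D1 -> (x s1).1 = us -> vs < (x s1).2 ->
    exists2 t, s <= t <= s + (2 * D1 + 1 + 2 * D2) & below us vs (x t).
  move=> /andP[ss1 s1D] e1 e2; have s10 := lt_le_trans s0 ss1.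
  have K1 : s <= s1 <= s + (2 * D1 + 1 + 2 * D2) by rewrite ss1 /=; lra.
  have [+ _ _ _] := K s1 K1; move=> /triangle0_sub SX.
  have [t /andP[t1 t2] ht] := above x s1 1 hx s10 ltr01 SX e1 e2.
  have t0 := lt_le_trans s10 t1.
  have [|t' ht' bt'] := left x t hx t0 _ ht.
    by move=> u hu; apply: K; apply: sub hu; lra.
  by exists t' => //; apply: sub ht'; lra.
have [h|h|h] := ltgtP (x s).1 us.
- have [|t ht bt] := left x s hx s0 _ h.
    by move=> u hu; apply: K; apply: sub hu; lra.
  by exists t => //; apply: sub ht; lra.
- have [|t /andP[st tD] ht] := H1 x s hx s0.
    by move=> u hu; apply: K; apply: sub hu; lra.
  have [|||s1 [/andP[ss1 s1t] e before]] := @first_time_ge _ (fun t => - (x t).1) s t (- us) st.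
  + exact: within_continuousN (traj_cont1 (b := t) hx (ltW s0)).
  + by rewrite ltrN2.
  + by rewrite lerN2.
  have {}e : (x s1).1 = us by apply: oppr_inj.
  have K1 : s <= s1 <= s + (2 * D1 + 1 + 2 * D2) by rewrite ltW//=; lra.
  have [h2|h2] := inner_u (K s1 K1) e; first by exists s1.
  by apply: (from_above s1) => //; rewrite ltW//=; lra.
- have K1 : s <= s <= s + (2 * D1 + 1 + 2 * D2) by rewrite lexx /=; lra.
  have [h2|h2] := inner_u (K s K1) h; first by exists s.
  by apply: (from_above s) => //; rewrite lexx /=; lra.
Qed.

(** * Absorption, the section and the unique periodic orbit *)

Section Attractor.
Variable At : set (R * R).
Hypothesis hAt : is_global_attractor T S0 At.
Variable Gam : set (R * R).
Hypothesis Gam_unique : forall G, periodic_orbit f S G -> G = Gam.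

Let flowS := @flowD _ f S L L0 f_lip T HT.
Let complete_flow' := @complete_flow _ f S L L0 f_lip T HT.

Lemma flow_E t : 0 <= t -> T t E = E.
Proof. exact: (flow_fix L0 f_lip HT (triangle0_sub triangleE) fE0). Qed.

Lemma At_sub Z : At Z -> S0 Z. Proof. by case: hAt => _ h _ _; exact: h. Qed.

(** The attractor is compact and misses the axes, so its points keep a distance [2 * a] from them;
    orbits that come within [a] of it keep the distance [a]. The bound on [W] comes from
    [lyap_escape]. *)
Lemma absorbing : exists a : R, [/\ 0 < a, forall Z, At Z -> a <= Z.1 /\ a <= Z.2 &
  forall X, S0 X -> X <> E -> exists2 t0, 0 < t0 & forall t, t0 <= t -> inner a (T t X)].
Proof.
have [cA AS _ att] := hAt.
have [a a0 ha] : exists2 a : R, 0 < a & forall Z, At Z -> 2 * a <= Z.1 /\ 2 * a <= Z.2.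
  have [A0|/nonemptyPn A0] := pselect (At !=set0); last first.
    by exists 1 => // Z; rewrite A0.
  have [Z1] := @compact_EVT_min _ R (fun Z : R * R => Z.1) At A0 cA
    (continuous_subspaceT (fun Z => @cvg_fst _ _ (nbhs Z.1) (nbhs Z.2) _)).
  rewrite inE => /At_sub[_ Z10 _] h1.
  have [Z2] := @compact_EVT_min _ R (fun Z : R * R => Z.2) At A0 cA
    (continuous_subspaceT (fun Z => @cvg_snd _ _ (nbhs Z.1) (nbhs Z.2) _)).
  rewrite inE => /At_sub[_ _ Z20] h2.
  have m0 : 0 < Num.min Z1.1 Z2.2 by rewrite lt_min Z10.
  exists (Num.min Z1.1 Z2.2 / 2); first by rewrite divr_gt0.
  move=> Z AZ; rewrite mulrC divfK ?pnatr_eq0//.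
  by rewrite !ge_min h1 ?h2 ?orbT ?inE.
exists a; split => // [Z /ha[h1 h2]|X SX XE]; first by split; lra.
have [t1 t10 h1] := lyap_escape (triangle0_sub SX) XE.
have [t2 h2] : exists t2 : R, forall t : R, 0 <= t -> t2 <= t ->
    forall X', [set X] X' -> exists2 Z, At Z & `|T t X' - Z| < a.
  have sX : [set X] `<=` S0 by move=> _ ->.
  exact: (att [set X] (@compact_set1 _ X) sX a a0).
exists (Num.max t1 t2 + 1).
  by rewrite ltr_pwDr// le_max t10.
move=> t ht; have m1 : t1 <= Num.max t1 t2 by rewrite le_max lexx.
have m2 : t2 <= Num.max t1 t2 by rewrite le_max lexx orbT.
have t1t : t1 <= t by lra. have t2t : t2 <= t by lra.
have t0 : 0 <= t := le_trans t10 t1t.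
have [Z /ha[Z1 Z2] hZ] := h2 t t0 t2t X erefl.
have := le_lt_trans (dist_fst (T t X) Z) hZ; have := le_lt_trans (dist_snd (T t X) Z) hZ.
rewrite !ltr_norml => /andP[k1 _] /andP[k2 _].
by split; [exact: flow_S0|clear XE; lra|clear XE; lra|exact: h1].
Qed.

Lemma section_S0 w : 0 < w < vs -> S0 (us, w).
Proof.
move=> /andP[wp wv]; split => //=; split => /=; rewrite ?(ltW us0) ?(ltW wp)//.
by have := hE; lra.
Qed.

(** The horizontal velocity at [(us, w)] is [q > 0]. Points starting within [d] and followed for
    time [d] stay within [(1 + M) * d] of it, where the Lipschitz bound keeps the velocity at least
    [q / 2]. *)
Lemma section_up w : 0 < w < vs -> exists2 d : R, 0 < d & forall Z, S0 Z ->
  dist Z (us, w) < d -> forall t, 0 < t < d -> Z.1 < (T t Z).1.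
Proof.
move=> hw; have /triangle0_sub SP := section_S0 hw; have /andP[_ wv] := hw.
have [/(_ wv) f0 _] := cross_u SP (erefl : (us, w).1 = us).
set q := (f (us, w)).1 in f0.
pose d := q / (2 * L * (1 + M)).
have d0 : 0 < d by rewrite /d; posit.
exists d => // Z /triangle0_sub SZ hZ t /andP[t0 td].
have hx := flow_traj HT SZ.
have pos (u : R) : 0 < u < t -> 0 < u by case/andP.
have inc u : 0 < u < t -> q / 2 <= (f (T u Z)).1.
  move=> /andP[u0 ut].
  have h1 := Tmod SZ (ltW u0) (lexx 0).
  rewrite (flow0 HT)// subr0 (gtr0_norm u0) in h1.
  have h2 := dist_tri Z (T u Z) (us, w).
  have h3 : M * u <= M * d by rewrite ler_pM2l// ltW// (lt_trans ut).
  have h4 := le_trans (dist_fst _ _) (f_lip (TS SZ (ltW u0)) SP).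
  have h5 : L * dist (T u Z) (us, w) <= L * (M * d + d) by rewrite ler_pM2l//; lra.
  have h6 : L * (M * d + d) = q / 2.
    by rewrite /d; field; rewrite !gt_eqF// addr_gt0.
  by move: h4; rewrite -/q ler_norml => /andP[h4 _]; lra.
have := mvt_ge (ltW t0) (traj_cont1 hx (lexx 0)) (fun u h => traj_derive1 hx (pos u h)) inc.
rewrite (flow0 HT)// subr0 => h; have : 0 < q / 2 * t by rewrite mulr_gt0// divr_gt0.
by lra.
Qed.

(** Turns a periodic point of the semiflow into a periodic orbit in the sense of [Gam_unique]; the
    orbit is not constant because [section_up] moves its first coordinate. *)
Lemma below_periodic P th : S0 P -> below us vs P -> 0 < th -> T th P = P ->
  Gam = [set Z | exists2 s, 0 <= s & Z = T s P].
Proof.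
move=> SP bP th0 TP; have SSP := triangle0_sub SP.
have [x [dx x0 per _ hx]] := complete_of_periodic L0 f_lip HT SSP th0 TP.
have Sx t : S (x t) by have [s s0 ->] := hx t; exact: TS.
have xs s : 0 <= s -> x s = T s P by move=> s0; rewrite -{1}[s]add0r complete_flow'// x0.
have e : range x = [set Z | exists2 s, 0 <= s & Z = T s P].
  apply/seteqP; split=> [_ [t _ <-]|Z [s s0 ->]]; first exact: hx.
  by exists s => //; exact: xs.
rewrite -e; apply/esym/Gam_unique; exists x; split => //.
- by split => // _ [t _ <-].
- by exists th.
- have [hw e1] : 0 < P.2 < vs /\ P = (us, P.2).
    by case: SP bP => _ _ h [<- ->]; rewrite h; case: (P).
  have [d d0 /(_ P SP)] := section_up hw.
  rewrite -e1 dist_refl => /(_ d0 (d / 2)).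
  have d2 : 0 < d / 2 < d by apply/andP; split; lra.
  move=> /(_ d2) h; exists (d / 2) => e2.
  case/andP: d2 => d2 _.
  by move: h; rewrite -(xs _ (ltW d2)) e2 x0 ltxx.
Qed.

(** [return_dynamics] applies: recurrence to the half line comes from [absorbing] and [hits_below],
    and the single periodic orbit from [below_periodic]. The upper end [vs - n0] of the trap
    reflects that crossings in the inner region are at distance at least [n0] from E. *)
Lemma pole_exists : exists m th : R, [/\ 0 < m < vs, 0 < th & T th (us, m) = (us, m)] /\
  [/\ forall X, S0 X -> X <> E -> forall e : R, 0 < e -> exists t0,
        forall t, t0 <= t -> 0 <= t -> exists2 s, 0 <= s & dist (T t X) (T s (us, m)) < e,
      forall X, S0 X -> X <> E -> forall s, 0 <= s -> forall e : R, 0 < e ->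
        forall t0, exists t, [/\ t0 <= t, 0 <= t & dist (T t X) (T s (us, m)) < e]
    & forall (x : R -> R * R) (a' b' : R), (forall t, S0 (x t)) ->
      (forall t s, 0 <= s -> x (t + s) = T s (x t)) ->
      (forall t, exists2 s, s < t & below us vs (x s)) -> 0 < a' -> b' < vs ->
      (forall t, below us vs (x t) -> a' <= (x t).2 <= b') ->
      forall t, below us vs (x t) -> x t = (us, m)].
Proof.
have [a [a0 hAa habs]] := absorbing.
have [D D0 hD] := hits_below a0.
have [n0 n00 hn0] := lyap_far.
apply: (@return_dynamics _ S0 T us vs _ _ _ _ _ M M0 _ _ section_S0 triangleE flow_E section_up _ vs0).
- by move=> X /triangle0_sub SX; exact: (flow0 HT SX).
- by move=> X t; exact: flow_S0.
- by move=> X s t /triangle0_sub SX; exact: flowS.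
- by move=> X Y t /triangle0_sub SX /triangle0_sub SY; exact: (flow_inj L0 f_lip HT SX SY).
- move=> D'; have [K K0 HK] := flow_lip L0 f_lip HT D'; exists K => // X Y t.
  by move=> /triangle0_sub SX /triangle0_sub SY; exact: HK.
- by move=> X s t /triangle0_sub SX; exact: Tmod.
- by move=> X [].
- move=> X SX XE t0; have [t1 t10 h1] := habs X SX XE.
  pose s := Num.max t0 t1 + 1.
  have m1 : t0 <= Num.max t0 t1 by rewrite le_max lexx.
  have m2 : t1 <= Num.max t0 t1 by rewrite le_max lexx orbT.
  have [||t /andP[st _] bt] := hD (T ^~ X) s (flow_traj HT (triangle0_sub SX)).
  + by rewrite /s; clear XE; lra.
  + by move=> t /andP[st _]; apply: h1; move: st; rewrite /s; clear XE; lra.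
  by exists t; split => //; move: st; rewrite /s; clear XE; lra.
- move=> q q' th th' hq hq' th0 th0' e e'.
  have e1 := below_periodic (section_S0 hq) (conj erefl (proj2 (andP hq))) th0 e.
  have e2 := below_periodic (section_S0 hq') (conj erefl (proj2 (andP hq'))) th0' e'.
  have : Gam (us, q').
    by rewrite e2; exists 0 => //; rewrite (flow0 HT)//; exact: triangle0_sub (section_S0 hq').
  by rewrite e1 => -[s s0 es]; exists s.
- exists a, (vs - n0); split => //; first by rewrite gtrBl.
  move=> X SX XE; have [t1 t10 h1] := habs X SX XE; exists t1 => t tt _ [b1 b2].
  have [_ _ -> /hn0 h] := h1 t tt; move: h.
  have -> : dist (T t X) E = `|(T t X).2 - vs|.
    by rewrite /dist prod_normE /= b1 subrr normr0; apply/max_idPr.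
  by rewrite ltr0_norm ?subr_lt0//=; clear XE; lra.
Qed.

(** * Description of the attractor through the point [(us, m)] of the periodic orbit *)

Section Pole.
Variables m th : R.
Hypotheses (hm : 0 < m < vs) (th0 : 0 < th) (Tm : T th (us, m) = (us, m)).
Hypothesis omega_up : forall X, S0 X -> X <> E -> forall e : R, 0 < e -> exists t0,
  forall t, t0 <= t -> 0 <= t -> exists2 s, 0 <= s & dist (T t X) (T s (us, m)) < e.
Hypothesis omega_low : forall X, S0 X -> X <> E -> forall s, 0 <= s -> forall e : R, 0 < e ->
  forall t0, exists t, [/\ t0 <= t, 0 <= t & dist (T t X) (T s (us, m)) < e].
Hypothesis alpha_pole : forall (x : R -> R * R) (a' b' : R), (forall t, S0 (x t)) ->
  (forall t s, 0 <= s -> x (t + s) = T s (x t)) ->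
  (forall t, exists2 s, s < t & below us vs (x s)) -> 0 < a' -> b' < vs ->
  (forall t, below us vs (x t) -> a' <= (x t).2 <= b') ->
  forall t, below us vs (x t) -> x t = (us, m).
Local Notation Pm := (us, m).

Let S0m : S0 Pm. Proof. exact: section_S0. Qed.
Let Sm : S Pm. Proof. exact: triangle0_sub S0m. Qed.

Lemma GamE : Gam = [set Z | exists2 s, 0 <= s & Z = T s Pm].
Proof. by case/andP: (hm) => _ mv; exact: below_periodic S0m (conj erefl mv) th0 Tm. Qed.

(** One period parametrizes [Gam] by a compact interval, so the distance to it is attained. *)
Lemma Gam_closed Z : (forall e : R, 0 < e -> exists2 s, 0 <= s & dist Z (T s Pm) < e) -> Gam Z.
Proof.
move=> H; have cont : {within `[0, th], continuous (fun s => dist Z (T s Pm))}.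
  apply: (lipschitz_within M0) => s t /andP[s0 _] /andP[t0 _].
  have h := Tmod Sm s0 t0; apply: le_trans h.
  have h1 := dist_tri (T t Pm) Z (T s Pm); have h2 := dist_tri (T s Pm) Z (T t Pm).
  rewrite (dist_sym (T t Pm)) in h1.
  by rewrite ler_norml; apply/andP; split; move: h1 h2; lra.
have [u] := @EVT_min _ (fun s => dist Z (T s Pm)) 0 th (ltW th0) cont.
rewrite in_itv /= => /andP[u0 uth] hu.
rewrite GamE; exists u => //; apply/eqP; rewrite -subr_eq0 -normr_le0 leNgt; apply/negP => h.
have [s s0 hs] := H _ h; have [v hv e] := periodic_reduce L0 f_lip HT Sm th0 Tm s0.
have : v \in `[0, th] by rewrite in_itv.
by move=> /hu; rewrite -e leNgt hs.
Qed.

Lemma omega_eq x : solves_on f setT x -> (forall t, S0 (x t)) -> x 0 <> E -> cluster (x @ +oo) = Gam.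
Proof.
move=> dx Sx x0; have Sx' t := triangle0_sub (Sx t).
have xE t : 0 <= t -> x t = T t (x 0) by move=> t0; rewrite -complete_flow'// add0r.
apply/seteqP; split=> [Z /cluster_pinfty H|Z].
  apply: Gam_closed => e e0; have e20 : 0 < e / 2 by rewrite divr_gt0.
  have [t0 ht0] := omega_up (Sx 0) x0 e20.
  have [t tt ht] := H _ e20 (Num.max t0 0).
  have m1 : t0 <= t by apply: le_trans tt; rewrite le_max lexx.
  have m2 : 0 <= t by apply: le_trans tt; rewrite le_max lexx orbT.
  have [s s0 hs] := ht0 t m1 m2; exists s => //.
  rewrite -xE// in hs; have := dist_tri (x t) Z (T s Pm); rewrite (dist_sym Z (x t)).
  by clear x0; lra.
rewrite GamE => -[s s0 ->]; apply/cluster_pinfty => e e0 t0.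
have [t [tt t0' ht]] := omega_low (Sx 0) x0 s0 e0 t0.
by exists t => //; rewrite xE.
Qed.

(** By [lyap_lin], [W (x s)] is at most [W (x t0)] divided by [1 + kap * (t0 - s)], which tends to 0
    in the past; so [x] converges to E backwards. *)
Lemma alpha_eq x t0 : solves_on f setT x -> (forall t, S (x t)) -> W (x t0) < c1 ->
  cluster (x @ -oo) = [set E].
Proof.
move=> dx Sx h.
have lin s : s <= t0 -> W (x s) * (1 + kap * (t0 - s)) <= W (x t0).
  move=> st; have := lyap_lin (complete_traj s dx Sx) (lexx 0) (_ : 0 <= t0 - s).
  by rewrite subr_ge0 addr0 addrCA subrr addr0 subr0; apply.
have lim e : 0 < e -> exists s0, forall s, s <= s0 -> dist (x s) E < e.
  move=> e0; have we : 0 < w0 * e ^+ 2 by rewrite mulr_gt0// exprn_gt0.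
  exists (t0 - c1 / (kap * (w0 * e ^+ 2))) => s hs.
  have c10 := lyap_level_gt0.
  have q0 : 0 < c1 / (kap * (w0 * e ^+ 2)) by rewrite divr_gt0// mulr_gt0.
  have st : s <= t0 by lra.
  apply: lyap_small => //; rewrite ltNge; apply/negP => hW.
  have h1 := lin s st.
  have ts : c1 / (kap * (w0 * e ^+ 2)) <= t0 - s by lra.
  have h2 : 1 + kap * (c1 / (kap * (w0 * e ^+ 2))) <= 1 + kap * (t0 - s) by rewrite lerD2l ler_pM2l.
  have k0 : 0 <= 1 + kap * (c1 / (kap * (w0 * e ^+ 2))).
    by rewrite addr_ge0// mulr_ge0// ltW.
  have := ler_pM (ltW we) k0 hW h2.
  have -> : w0 * e ^+ 2 * (1 + kap * (c1 / (kap * (w0 * e ^+ 2)))) = w0 * e ^+ 2 + c1.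
    by field; rewrite !gt_eqF.
  by move=> h3; lra.
apply/seteqP; split=> [Z /cluster_ninfty H|_ ->].
  apply: dist_small_eq => e e0; have e20 : 0 < e / 2 by rewrite divr_gt0.
  have [s0 hs0] := lim _ e20; have [s ss hs] := H _ e20 s0.
  have := hs0 s ss; have := dist_tri (x s) Z E; rewrite (dist_sym Z (x s)).
  by lra.
apply/cluster_ninfty => e e0 s0; have [s1 hs1] := lim _ e0.
exists (Num.min s0 s1); first by rewrite ge_min lexx.
by apply: hs1; rewrite ge_min lexx orbT.
Qed.

Lemma heteroclinic_of x t0 : solves_on f setT x -> (forall t, S0 (x t)) -> x 0 <> E ->
  W (x t0) < c1 -> heteroclinic_orbit f S E Gam (range x).
Proof.
move=> dx Sx x0 h; have Sx' t := triangle0_sub (Sx t).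
exists x; split => //; [by split => // _ [t _ <-]|exact: alpha_eq h|exact: omega_eq].
Qed.

(** Attraction of [K] is uniform. Starting from a visit to [K] far enough in the past, [x s] is as
    close to the attractor as desired, and the attractor is closed. *)
Lemma in_attractor K x : compact K -> K `<=` S0 -> solves_on f setT x -> (forall t, S (x t)) ->
  (forall t0, exists2 t, t <= t0 & K (x t)) -> forall s, At (x s).
Proof.
move=> cK KS dx Sx back s; have [cA _ _ att] := hAt.
apply: compact_dist => // e e0; have [t0 ht0] := att K cK KS e e0.
have [t tt Kt] := back (s - Num.max t0 0).
have m1 : t0 <= Num.max t0 0 by rewrite le_max lexx.
have m2 : 0 <= Num.max t0 0 by rewrite le_max lexx orbT.
have st0 : 0 <= s - t by lra.
have st1 : t0 <= s - t by lra.
have [Z AZ hZ] := ht0 (s - t) st0 st1 (x t) Kt.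
exists Z => //; rewrite dist_sym /dist.
by move: hZ; rewrite -complete_flow'// addrCA subrr addr0.
Qed.

Lemma At_complete X : At X -> exists x, [/\ solves_on f setT x, x 0 = X & forall t, At (x t)].
Proof.
move=> AX; have [_ AS inv _] := hAt.
have pred Z : exists Y, At Z -> At Y /\ T 1 Y = Z.
  have [AZ|nAZ] := pselect (At Z); last by exists Z.
  have [Y AY e] : (T 1 @` At) Z by rewrite inv.
  by exists Y.
have [g hg] := choice pred.
have Ag n : At (iter n g X) by elim: n => //= n /hg[].
have [x dx hx] := complete_of_backward L0 f_lip HT ltr01
  (fun n => triangle0_sub (AS _ (Ag n))) (fun n => proj2 (hg _ (Ag n))).
exists x; split => //; first by rewrite (hx 0%N) mul0r addr0// (flow0 HT)//; exact: triangle0_sub (AS _ AX).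
move=> t; pose n := Num.bound `|t|.
have hn : 0 <= t + n%:R * 1.
  by have := archi_boundP (normr_ge0 t); rewrite -/n ltr_norml => /andP[h _]; lra.
have : (T (t + n%:R * 1) @` At) (x t) by rewrite (hx n)//; exists (iter n g X).
by rewrite inv.
Qed.

Lemma At_cases X : At X -> [\/ X = E, Gam X |
  exists2 H, heteroclinic_orbit f S E Gam H & H X].
Proof.
move=> AX; have [x [dx x0 Ax]] := At_complete AX.
have [XE|XE] := pselect (X = E); first by apply: Or31.
have Sx t : S0 (x t) := At_sub (Ax t); have Sx' t := triangle0_sub (Sx t).
have [[t0 ht0]|nsmall] := pselect (exists t, W (x t) < c1).
  apply: Or33; exists (range x); last by exists 0.
  by apply: (heteroclinic_of dx Sx _ ht0); rewrite x0.
have big t : c1 <= W (x t) by rewrite leNgt; apply/negP => h; apply: nsmall; exists t.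
have [a [a0 ha _]] := absorbing; have [D D0 hD] := hits_below a0.
have [n0 n00 hn0] := lyap_far.
have inn t : inner a (x t) by have [h1 h2] := ha _ (Ax t); split.
have back t : exists2 s, s < t & below us vs (x s).
  (* The orbit is started at [t - D - 2] and observed from time 1 on; it crosses within [D], hence
     before [t]. *)
  have [s /andP[s1 s2] bs] := hD _ 1 (complete_traj (t - D - 2) dx Sx') ltr01 (fun s _ => inn _).
  by exists (t - D - 2 + s) => //; clear XE; lra.
have vn : vs - n0 < vs by rewrite gtrBl.
have bnd t : below us vs (x t) -> a <= (x t).2 <= vs - n0.
  move=> [b1 b2]; have [_ _ -> /hn0 h] := inn t; move: h.
  have -> : dist (x t) E = `|(x t).2 - vs|.
    by rewrite /dist prod_normE /= b1 subrr normr0; apply/max_idPr.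
  by rewrite ltr0_norm ?subr_lt0//=; clear XE; lra.
have [s s0 bs] := back 0.
have s0' : 0 <= - s by rewrite oppr_ge0 ltW.
have xs := alpha_pole Sx (fun t s => @complete_flow' x t s dx Sx') back a0 vn bnd bs.
apply: Or32; rewrite GamE; exists (- s) => //.
by rewrite -x0 -xs -complete_flow'// addrN.
Qed.

Lemma At_E : At E.
Proof.
have K : [set E] `<=` S0 by move=> _ ->; exact: triangleE.
apply: (@in_attractor [set E] (fun=> E) (@compact_set1 _ E) K _ _ _ 0).
- by move=> t _; rewrite fE0; exact: is_derive_cst.
- by move=> _; exact: triangle0_sub triangleE.
- by move=> t0; exists t0.
Qed.

Lemma Gam_At Z : Gam Z -> At Z.
Proof.
rewrite GamE => -[s s0 ->].
have [x [dx x0 per back hx]] := complete_of_periodic L0 f_lip HT Sm th0 Tm.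
have Sx t : S (x t) by have [u u0 ->] := hx t; exact: TS.
have -> : T s Pm = x s by rewrite -x0 -complete_flow'// add0r.
have K : [set Pm] `<=` S0 by move=> _ ->.
apply: (@in_attractor [set Pm] x (@compact_set1 _ Pm) K dx Sx _ s) => t0.
have := archi_boundP (divr_ge0 (normr_ge0 t0) (ltW th0)).
set n := Num.bound _; rewrite ltr_pdivrMr// ltr_norml => /andP[h _].
by exists (- (n%:R * th)); [exact: ltW|exact: back].
Qed.

(** Its past keeps visiting the closed ball of radius [rho] around E, a compact subset of
    [triangle0] by [rho_box]. *)
Lemma heteroclinic_At H Z : heteroclinic_orbit f S E Gam H -> H Z -> At Z.
Proof.
move=> [x [[dx Sx] hal_ _ ->]] [s _ <-].
have Sx' t : S (x t) by apply: Sx; exists t.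
apply: (@in_attractor [set Y | dist Y E <= rho] x (@compact_box _ E rho) _ dx Sx' _ s) => [Y /rho_box //|t0].
have /cluster_ninfty/(_ _ hrho t0)[t tt ht] : cluster (x @ -oo) E by rewrite hal_.
by exists t => //; exact: ltW.
Qed.

Lemma attractor_eq : At = [set E] `|` Gam `|`
  \bigcup_(H in [set H | heteroclinic_orbit f S E Gam H]) H.
Proof.
apply/seteqP; split=> [X /At_cases[->|GX|[H hH HX]]|X [[->|]|[H hH HX]]].
- by left; left.
- by left; right.
- by right; exists H.
- exact: At_E.
- exact: Gam_At.
- exact: heteroclinic_At hH HX.
Qed.

(** The level guarantees a distance below [rho / 2], so [flow_local_onto] gives a preimage under
    [T d]. By [lyap_lin] its value of [W] is not larger, so the construction can be repeated
    forever. *)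
Lemma small_complete X : W X < w0 * (rho / 2) ^+ 2 ->
  exists x, [/\ solves_on f setT x, x 0 = X & forall t, S0 (x t)].
Proof.
move=> hX; have rho2 : 0 < rho / 2 by rewrite divr_gt0.
have c2c1 : w0 * (rho / 2) ^+ 2 <= c1.
  rewrite ler_pM2l// ler_sqr ?nnegrE ?(ltW rho2) ?(ltW hrho)//.
  by move: hrho; lra.
have [d d0 onto] := flow_local_onto L0 f_lip HT fE0 hrho (fun Z h => triangle0_sub (rho_box h)).
have pred Y : exists Z, W Y < w0 * (rho / 2) ^+ 2 -> [/\ W Z < w0 * (rho / 2) ^+ 2, S0 Z & T d Z = Y].
  have [WY|nWY] := pselect (W Y < w0 * (rho / 2) ^+ 2); last by exists Y.
  have [Z hZ TZ] := onto Y (ltW (lyap_small rho2 WY)).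
  exists Z => _; have SZ := rho_box hZ; split => //.
  have := lyap_lin (flow_traj HT (triangle0_sub SZ)) (lexx 0) (ltW d0).
  rewrite (flow0 HT) ?TZ; last exact: triangle0_sub.
  move=> /(_ (lt_le_trans WY c2c1)); rewrite subr0 => h.
  apply: le_lt_trans WY; apply: le_trans h.
  by rewrite ler_peMr ?lyap_ge0// lerDl mulr_ge0// ltW.
have [g hg] := choice pred.
have Wg n : W (iter n g X) < w0 * (rho / 2) ^+ 2 by elim: n => //= n /hg[].
have Sg n : S0 (iter n g X).
  by apply: rho_box; apply: le_trans (ltW (lyap_small rho2 (Wg n))) _; move: hrho; lra.
have Tg n : T d (iter n.+1 g X) = iter n g X by have [] := hg _ (Wg n).
have [x dx hx] := complete_of_backward L0 f_lip HT d0 (fun n => triangle0_sub (Sg n)) Tg.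
exists x; split => //.
  by rewrite (hx 0%N) mul0r addr0// (flow0 HT)//; exact: triangle0_sub (Sg 0%N).
move=> t; pose n := Num.bound (`|t| / d).
have hn : 0 <= t + n%:R * d.
  have := archi_boundP (divr_ge0 (normr_ge0 t) (ltW d0)); rewrite -/n ltr_pdivrMr//.
  by rewrite ltr_norml => /andP[h _]; lra.
by rewrite (hx n)//; exact: flow_S0.
Qed.

Lemma level_unique x s t : solves_on f setT x -> (forall t, S (x t)) -> W (x s) < c1 ->
  0 < W (x s) -> W (x t) = W (x s) -> x t = x s.
Proof.
wlog st : s t / s <= t.
  move=> H dx Sx h1 h2 e; have [h|/ltW h] := leP s t; first exact: H.
  by apply/esym; apply: H => //; rewrite ?e.
move=> dx Sx h1 h2 e; have ts : 0 <= t - s by rewrite subr_ge0.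
have := lyap_lin (complete_traj s dx Sx) (lexx 0) ts.
rewrite addr0 addrCA subrr addr0 subr0 e => /(_ h1).
rewrite -[X in _ <= X]mulr1 ler_pM2l// gerDl pmulr_rle0// subr_le0 => h.
by congr x; apply/eqP; rewrite eq_le h st.
Qed.

Lemma infinite_heteroclinics : infinite_set [set H | heteroclinic_orbit f S E Gam H].
Proof.
have rho2 : 0 < rho / 2 by rewrite divr_gt0.
pose lvl := w0 * (rho / 2) ^+ 2 / 2.
have hl0 : 0 < w0 * (rho / 2) ^+ 2 by rewrite mulr_gt0// exprn_gt0.
have lvl0 : 0 < lvl by rewrite divr_gt0.
have lvl2 : lvl < w0 * (rho / 2) ^+ 2 by rewrite /lvl; lra.
have lvl1 : lvl < c1.
  apply: lt_le_trans lvl2 _; rewrite ler_pM2l// ler_sqr ?nnegrE ?(ltW rho2) ?(ltW hrho)//.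
  by move: hrho; lra.
(* [X k] lies on the ray from E in direction [(1, k)]. [q k] is the value of the quadratic form at
   this vector, and [lam k] scales it to the common level [lvl]. *)
pose q (k : nat) : R := 1 - A * k%:R + C * k%:R ^+ 2.
have q0 k : 0 < q k.
  have := W_lower (x := 1) (y := k%:R) (or_introl erefl).
  rewrite normr1 !expr1n !mulr1; exact: lt_le_trans.
pose lam k := Num.sqrt (lvl / q k).
have lam0 k : 0 < lam k by rewrite sqrtr_gt0 divr_gt0.
pose X k : R * R := (us + lam k, vs + lam k * k%:R).
have WX k : W (X k) = lvl.
  have e : lam k ^+ 2 = lvl / q k by rewrite sqr_sqrtr// divr_ge0// ltW.
  have -> : W (X k) = lam k ^+ 2 * q k.
    by rewrite /lyap /X /q /= ![_ + _ - _]addrAC !subrr !add0r; ring.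
  by rewrite e divfK// gt_eqF.
have XE k : X k <> E by move=> e; have := lvl0; rewrite -(WX k) e lyap_E ltxx.
have ex k : exists x, [/\ solves_on f setT x, x 0 = X k & forall t, S0 (x t)].
  by apply: small_complete; rewrite WX.
have [x hx] := choice ex.
pose H k : set (R * R) := range (x k).
have hH k : heteroclinic_orbit f S E Gam (H k).
  have [dx x0 Sx] := hx k.
  by apply: (heteroclinic_of (t0 := 0) dx Sx); rewrite x0; [exact: XE|rewrite WX].
have injH : {in H @^-1` [set G | heteroclinic_orbit f S E Gam G] &, injective H}.
  move=> k j _ _ e; have [dx x0 Sx] := hx k; have [dy y0 Sy] := hx j.
  have [t _ ht] : H j (X k) by rewrite -e; exists 0.
  have e1 : x j t = x j 0.
    apply: (level_unique dy (fun t => triangle0_sub (Sy t))); rewrite ?y0 ?WX//.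
    by rewrite ht WX.
  move: ht; rewrite e1 y0 => -[e2 e3].
  have {}e2 : lam j = lam k by move: e2; lra.
  have : lam k * j%:R = lam k * k%:R by move: e3; rewrite e2; lra.
  by move/(mulfI (lt0r_neq0 (lam0 k)))/eqP; rewrite eqr_nat => /eqP.
move=> fin; apply: infinite_nat; have := finite_preimage injH fin.
by have -> : H @^-1` [set G | heteroclinic_orbit f S E Gam G] = setT by apply/seteqP; split => // k _; exact: hH.
Qed.

End Pole.
End Attractor.
End Rotation.
End Repelling.
End PerturbedSystem.

(** * The center manifold at equilibria *)

Lemma triangle0_box {R : realType} (be r u v n0 : R) : 0 < be -> 0 < u -> 0 < v ->
  be * u + v < r -> 0 < n0 -> exists2 n, 0 < n &
  n <= n0 /\ forall Z, dist Z (u, v) <= n -> triangle0 be r Z.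
Proof.
move=> be0 u0 v0 huv hn0; have be1 : 0 < be + 1 by rewrite addr_gt0.
pose m := (r - (be * u + v)) / (be + 1).
have m0 : 0 < m by rewrite divr_gt0// subr_gt0.
exists (Num.min (Num.min n0 m) (Num.min (u / 2) (v / 2))).
  by rewrite !lt_min hn0 m0 !divr_gt0.
split=> [|[x y] hZ]; first by rewrite !ge_min lexx.
have := le_trans (dist_fst _ _) hZ; have := le_trans (dist_snd _ _) hZ => /= {hZ}.
rewrite !le_min !ler_norml => /andP[/andP[_ /andP[_ y1]] /andP[_ /andP[y2 _]]].
move=> /andP[/andP[_ /andP[_ x1]] /andP[/andP[x2 _] _]].
have e : m * (be + 1) = r - (be * u + v) by rewrite divfK// gt_eqF.
have x3 : be * (x - u) <= be * m by rewrite ler_wpM2l// ltW.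
have x0 : 0 < x by move: u0 x2; clear; lra.
have y0 : 0 < y by move: v0 y2; clear; lra.
by split=> //=; split=> /=; [exact: ltW|exact: ltW|move: e x3 y1; clear; lra].
Qed.

Section CenterManifold.
Context {R : realType}.
Variables (d al be ga r : R).
Hypotheses (hd : 0 < d) (hal : 0 < al) (hbe : 0 < be) (hga : 0 < ga).
Hypothesis hcoex : be + 1 < ga * (be - 1).
Variables (rho chi : R -> R) (eta epst : R) (k : nat) (Phi : R -> R * R -> R * R).
Hypothesis eta0 : 0 < eta.
Hypothesis hPhi : center_manifold_maps d al be ga rho chi r eta epst k Phi.
Variable eps : R.
Hypothesis heps : 0 <= eps <= epst.
Local Notation us := (ustar be).
Local Notation vs := (vstar al be ga).
Hypothesis SE : triangle be r (us, vs).

Lemma F_star : F al ga us vs = 0.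
Proof.
rewrite (F_eq al hbe hga hcoex); last exact/ltW/(us_gt0 hbe hga hcoex).
by rewrite !subrr expr0n !mulr0 !subr0 mulr0.
Qed.

Lemma G_star : G be us vs = 0.
Proof.
rewrite (G_eq hbe hga hcoex); last exact/ltW/(us_gt0 hbe hga hcoex).
by rewrite subrr mulr0 mul0r.
Qed.

(** The constant solution at [((us, vs), (0, 0))] is bounded, so the last clause of
    [center_manifold_maps] places it on the graph of [Phi eps]. *)
Lemma center_manifold_star : Phi eps (us, vs) = (0, 0).
Proof.
have [_ _ _ h4] := hPhi.
have H := h4 eps heps (fun=> (us, vs)) (fun=> (0, 0)) (fun=> SE); apply/esym.
apply: (H _ _ 0).
- move=> t _; rewrite /ts_field F_star G_star subrr /h mul0r mulr0 mul0r.
  rewrite /P /Q F_star G_star !subrr !mulr0 addr0 !mul0r !mulr0 !mul0r addr0 oppr0 mul0r.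
  exact: is_derive_cst.
- exists `|((us, vs), (0, 0)) : (R * R) * (R * R)| => t.
  rewrite ler_piMl// -expR0 ler_expR mulNr oppr_le0 mulr_ge0// ltW//.
Qed.

(** An equilibrium of (PS) rests under the reduced system, so its lift rests under the truncated
    one. There [P] and [Q] vanish, and the last two components of the field reduce to [- U2 / d] and
    [- V2]. *)
Lemma center_manifold_equilibrium X : triangle be r X ->
  ps_field al be ga (Phi eps) X = (0, 0) -> Phi eps X = (0, 0).
Proof.
move=> SX [/eqP + /eqP]; rewrite !subr_eq0 => /eqP eF /eqP eG.
have [_ _ h3 _] := hPhi.
have H := h3 eps heps setT (fun=> X) openT _ (fun t _ => SX).
have {}H : solves_on (ts_field d al be ga rho chi eps) setT (fun=> (X, Phi eps X)).
  apply: H => [? ? ? //|t _].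
  by rewrite /reduced_field -eF -eG !subrr /h !mul0r !mulr0 !mul0r; exact: is_derive_cst.
have [_ e1] := H 0 I.
have [_ e2] := is_derive_cst (X, Phi eps X) (0 : R) 1.
have : ts_field d al be ga rho chi eps (X, Phi eps X) = 0 by rewrite -e1 -[RHS]e2.
move: eF eG; case: X SX {H e1 e2} => u v _; case: (Phi eps (u, v)) => u2 v2 /= eF eG.
rewrite /P /Q eF eG !subrr /h !mulr0 !addr0 !mul0r !mulr0 !mul0r !addr0 => -[].
move=> /eqP; rewrite mulf_eq0 invr_eq0 (gt_eqF hd) orbF oppr_eq0 => /eqP -> /eqP.
by rewrite oppr_eq0 => /eqP ->.
Qed.

Lemma equilibria_unique : triangle0 be r (us, vs) ->
  [set X | triangle0 be r X /\ ps_field al be ga (Phi eps) X = (0, 0)] = [set (us, vs)].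
Proof.
move=> S0E; apply/seteqP; split=> [[u v] [[SX u0 v0] fX]|_ ->]; last first.
  by split => //; rewrite /ps_field center_manifold_star /= F_star G_star subrr.
have := fX; rewrite /ps_field (center_manifold_equilibrium SX fX) /= !subr0 => -[].
have us0 := us_gt0 hbe hga hcoex; have b0 := be_gt1 hbe hga hcoex.
rewrite /= in u0 v0; have u1 : 0 < 1 + u by rewrite addr_gt0.
move=> eF; rewrite (G_eq hbe hga hcoex)//; last exact: ltW.
move=> /eqP; rewrite mulf_eq0 invr_eq0 (gt_eqF u1) orbF !mulf_eq0 (gt_eqF v0) (gt_eqF b0) /= subr_eq0 => /eqP eu.
move: eF; rewrite eu (F_eq al hbe hga hcoex); last exact: ltW.
rewrite subrr expr0n !mulr0 subr0 sub0r => /eqP.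
by rewrite mulf_eq0 (gt_eqF (p_gt0 hbe hga hcoex)) /= oppr_eq0 subr_eq0 => /eqP ->.
Qed.

End CenterManifold.

(** * Choice of the thresholds and assembly *)

Unset Implicit Arguments.

Theorem theorem3p16 (R : realType)
  (d al be ga : R)
  (hd : 0 < d) (hal : 0 < al) (hbe : 0 < be) (hga : 0 < ga)
  (hcoex : 1 < ga * (be - 1))
  (r : R) (hr : 0 < r)
  (hr_in : forall u v : R, 0 <= u -> 0 <= v -> r <= be * u + v ->
     be * F al ga u v + G be u v < 0)
  (hr_eq1 : triangle be r (ga, 0))
  (hr_eq2 : triangle be r (interior_eq al be ga))
  (L : R) (hL : L_bound al be ga r <= L)
  (rho chi : R -> R) (hrho : is_rho rho) (hchi : is_chi L chi)
  (* the center manifold maps *)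
  (eta : R) (heta : 0 < eta < Num.min 1 d^-1)
  (k : nat) (hk : (1 <= k)%N)
  (epst : R) (hepst : 0 < epst)
  (Phi : R -> R * R -> R * R)
  (hPhi : center_manifold_maps d al be ga rho chi r eta epst k Phi)
  (hPhi0 : forall X, Phi 0 X = (0, 0))
  (* the perturbed planar system and its semiflow *)
  (eps0 : R) (heps0 : 0 < eps0 <= epst)
  (hinv : forall eps : R, 0 <= eps <= eps0 ->
     [/\ pos_invariant (ps_field al be ga (Phi eps)) (triangle be r),
         pos_invariant (ps_field al be ga (Phi eps))
           (triangle be r `&` [set X | X.2 = 0]),
         pos_invariant (ps_field al be ga (Phi eps))
           (triangle be r `&` [set X | X.1 = 0])
       & pos_invariant (ps_field al be ga (Phi eps)) (triangle0 be r)])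
  (T : R -> R -> R * R -> R * R)
  (hT : forall eps : R, 0 <= eps <= eps0 ->
     is_semiflow (ps_field al be ga (Phi eps)) (triangle be r) (T eps))
  (hTcont : {within [set z : R * R * (R * R) |
       [/\ 0 <= z.1.1 <= eps0, 0 <= z.1.2 & triangle be r z.2]],
     continuous (fun z : R * R * (R * R) => T z.1.1 z.1.2 z.2)})
  (* uniform persistence and the interior attractors *)
  (eps1 Theta : R) (heps1 : 0 < eps1 <= eps0) (hTheta : 0 < Theta)
  (hpers : forall (eps : R) (X : R * R), 0 <= eps <= eps1 -> triangle0 be r X ->
     (Theta%:E <=
        limf_einf (fun t : R => edist_inf (bdry0 be r) (T eps t X)) +oo%R)%E)
  (A0 : R -> set (R * R))
  (hA0 : forall eps : R, 0 <= eps <= eps1 ->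
     is_global_attractor (T eps) (triangle0 be r) (A0 eps))
  (* the known existence and uniqueness of the periodic orbit *)
  (hper : be + 1 < ga * (be - 1) -> exists2 e : R, 0 < e &
     forall eps : R, 0 < eps < e -> eps <= eps0 -> exists Gam,
       [/\ periodic_orbit (ps_field al be ga (Phi eps)) (triangle be r) Gam,
           forall Gam',
             periodic_orbit (ps_field al be ga (Phi eps)) (triangle be r) Gam' ->
             Gam' = Gam
         & surrounds Gam (interior_eq al be ga)]) :
  be + 1 < ga * (be - 1) ->
  exists2 eps2 : R, 0 < eps2 <= eps1 &
    forall eps : R, 0 < eps < eps2 ->
      let f := ps_field al be ga (Phi eps) in
      let E := interior_eq al be ga in
      [set X | triangle0 be r X /\ f X = (0, 0)] = [set E] /\
      exists Gam : set (R * R),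
        [/\ [set Gam' | periodic_orbit f (triangle be r) Gam'] = [set Gam],
            surrounds Gam E,
            A0 eps = [set E] `|` Gam `|`
              \bigcup_(H in [set H | heteroclinic_orbit f (triangle be r) E Gam H]) H
          & infinite_set [set H | heteroclinic_orbit f (triangle be r) E Gam H]].
Proof.
move=> hcoex'.
have us0 := us_gt0 hbe hga hcoex'; have vs0 := vs_gt0 hal hbe hga hcoex'.
have be1 : 0 < be - 1 := be_gt1 hbe hga hcoex'.
have SE : triangle be r (ustar be, vstar al be ga) := hr_eq2.
(* E lies strictly below the slanted edge: from the edge outwards [be * F + G] is negative, whereas
   both terms vanish at E. *)
have hE : be * ustar be + vstar al be ga < r.
  rewrite ltNge; apply/negP => hle; have := hr_in _ _ (ltW us0) (ltW vs0) hle.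
  by rewrite (F_star al hbe hga hcoex') (G_star al hbe hga hcoex') mulr0 addr0 ltxx.
have U10 : 0 < r / be by rewrite divr_gt0.
have bus : 0 < be * ustar be by rewrite mulr_gt0.
have us_U1 : ustar be <= r / be by rewrite ler_pdivlMr// mulrC; lra.
have vs_V1 : vstar al be ga <= r by lra.
have S0E : triangle0 be r (ustar be, vstar al be ga) by [].
have [N1 [m1 [D1 [hN1 hm1 hD1 quad1]]]] := quadrant1 hal hbe hga hcoex' r us_U1.
have [N2 [m2 [D2 [hN2 hm2 hD2 quad2]]]] := quadrant2 hal hbe hga hcoex' (r / be) vs_V1.
have [N3 [m3 [D3 [hN3 hm3 hD3 quad3]]]] := quadrant3 hal hbe hga hcoex' us_U1 vs_V1.
have [N4 [m4 [D4 [hN4 hm4 hD4 quad4]]]] := quadrant4 hal hbe hga hcoex' r us_U1.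
have [A [C [w0 [w1 [rho0 [kap [D0 [[hw0 hw1 hrho0 hkap] [hD0 W_upper W_lower W_repel]]]]]]]]] :=
  repelling hal hbe hga hcoex' (r / be) r.
(* The radius of repulsion is reduced so that the closed ball around E lies in [triangle0]. *)
have [rh hrh [hrh0 rho_box]] := triangle0_box hbe us0 vs0 hE hrho0.
pose mu := Num.min (Num.min m1 m2) (Num.min m3 m4).
have hmu : 0 < mu by rewrite !lt_min hm1 hm2 hm3 hm4.
have [mu1 mu2 mu3 mu4] : [/\ mu <= m1, mu <= m2, mu <= m3 & mu <= m4].
  by rewrite /mu; split; rewrite !ge_min lexx ?orbT.
pose b1 := ustar be / (1 + ustar be); pose b2 := vstar al be ga * (be - 1) / (1 + r / be).
have hb1 : 0 < b1 by rewrite divr_gt0// addr_gt0.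
have hb2 : 0 < b2 by apply: divr_gt0; [exact: mulr_gt0|exact: addr_gt0].
(* [del] meets the threshold of every estimate at once; [b1] and [b2] are halved because [del_u] and
   [del_v] are strict. *)
pose del := Num.min (Num.min (Num.min D1 D2) (Num.min D3 D4))
  (Num.min D0 (Num.min (b1 / 2) (b2 / 2))).
have del_gt0 : 0 < del.
  by rewrite !lt_min hD1 hD2 hD3 hD4 hD0 (divr_gt0 hb1)// (divr_gt0 hb2).
have [[d1 d2 d3 d4] [d5 d6 d7]] : [/\ del <= D1, del <= D2, del <= D3 & del <= D4] /\
    [/\ del <= D0, del <= b1 / 2 & del <= b2 / 2].
  by rewrite /del; split; split; rewrite !ge_min lexx ?orbT.
have del_u : del < b1 by lra.
have del_v : del < b2 by lra.
have dd (D : R) : del <= D -> 0 <= del <= D by rewrite (ltW del_gt0).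
have mono (m n b : R) : mu <= m -> 0 <= n -> m * n <= b -> mu * n <= b.
  by move=> h1 h2; apply: le_trans; rewrite ler_wpM2r.
have box_ge0 (u v n : R) : box_pt al be ga (r / be) r u v n -> 0 <= n.
  by case=> _ _ h _ _; exact: le_trans h.
have [_ hsmall _ _] := hPhi.
have [e1 e10 he1] := hsmall _ del_gt0.
have [e2 e20 he2] := hper hcoex'.
have [eps10 eps1le] := andP heps1; have [eps00 eps0le] := andP heps0.
exists (Num.min eps1 (Num.min e1 e2)); first by rewrite !lt_min eps10 e10 e20 ge_min lexx.
move=> eps /andP[eps_gt0]; rewrite !lt_min => /and3P[lt1 lt2 lt3] f E.
have le0 : eps <= eps0 by rewrite (le_trans _ eps1le)// ltW.
have het : 0 <= eps <= epst by rewrite ltW//= (le_trans le0).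
have he0 : 0 <= eps <= eps0 by rewrite ltW.
have he1' : 0 <= eps <= eps1 by rewrite !ltW.
have eta0 : 0 < eta by case/andP: heta.
have phiE := center_manifold_star hbe hga hcoex' eta0 hPhi het SE.
have [_ Phi_lip] := he1 eps het lt2.
have phi_lip X Y : dist (Phi eps X) (Phi eps Y) <= del * dist X Y.
  exact: (Phi_lip (X, Y) (conj I I)).
split; first exact: (equilibria_unique hd hbe hga hcoex' eta0 hPhi het SE S0E).
have [Gam [hGam Gam_unique Gam_sur]] := he2 eps (introT andP (conj eps_gt0 lt3)) le0.
have [L' L'0 f_lip] := f_lipschitz hal hbe hga hcoex' hE (ltW del_gt0) phi_lip.
have [_ _ _ hinv0] := hinv eps he0.
have At := hA0 eps he1'.
(* The quadrant estimates are specialised to [del] and weakened to the common rate [mu], the form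
   assumed in the study of the rotation. *)
have q1 u v n p1 p2 : box_pt al be ga (r / be) r u v n -> ustar be <= u -> vstar al be ga <= v ->
    `|p1| <= del * n -> `|p2| <= del * n ->
    mu * n <= (G be u v - p2) - N1 * (F al ga u v - p1).
  by move=> h1 h2 h3 h4 h5; apply: mono mu1 (box_ge0 _ _ _ h1) _; exact: quad1 (dd _ d1) h4 h5.
have q2 u v n p1 p2 : box_pt al be ga (r / be) r u v n -> u <= ustar be -> vstar al be ga <= v ->
    `|p1| <= del * n -> `|p2| <= del * n ->
    mu * n <= - (G be u v - p2) - N2 * (F al ga u v - p1).
  by move=> h1 h2 h3 h4 h5; apply: mono mu2 (box_ge0 _ _ _ h1) _; exact: quad2 (dd _ d2) h4 h5.
have q3 u v n p1 p2 : box_pt al be ga (r / be) r u v n -> n <= r / be + r ->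
    0 < u -> u <= ustar be -> v <= vstar al be ga -> `|p1| <= del * n -> `|p2| <= del * n ->
    p1 <= del * u -> mu * n <= - (G be u v - p2) + N3 * ((F al ga u v - p1) / u).
  move=> h1 h2 h3 h4 h5 h6 h7 h8; apply: mono mu3 (box_ge0 _ _ _ h1) _.
  exact: quad3 (dd _ d3) h6 h7 h8.
have q4 u v n p1 p2 : box_pt al be ga (r / be) r u v n -> 0 < v ->
    ustar be <= u -> v <= vstar al be ga -> `|p1| <= del * n -> `|p2| <= del * n ->
    p2 <= del * v -> mu * n <= (G be u v - p2) / v + N4 * (F al ga u v - p1).
  move=> h1 h2 h3 h4 h5 h6 h7; apply: mono mu4 (box_ge0 _ _ _ h1) _.
  exact: quad4 (dd _ d4) h5 h6 h7.
have W_rep u v n p1 p2 : box_pt al be ga (r / be) r u v n -> n <= rh ->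
    `|p1| <= del * n -> `|p2| <= del * n ->
    kap * ((u - ustar be) ^+ 2 - A * (u - ustar be) * (v - vstar al be ga) +
           C * (v - vstar al be ga) ^+ 2) <=
    (2 * (u - ustar be) - A * (v - vstar al be ga)) * (F al ga u v - p1) +
    (2 * C * (v - vstar al be ga) - A * (u - ustar be)) * (G be u v - p2).
  by move=> h1 h2 h3 h4; exact: W_repel h1 (le_trans h2 hrh0) (dd _ d5) h3 h4.
have HT := hT eps he0.
have [m [th [[hm th0 Tm] [om_up om_low alpha_pole]]]] :=
  pole_exists hal hbe hga hr hcoex' hE phiE phi_lip L'0 f_lip HT hinv0 hw0 hw1 hrh hkap
    W_upper W_lower W_rep hN1 hN2 hN3 hN4 hmu q1 q2 q3 q4 del_u del_v At Gam_unique.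
exists Gam; split => //.
- by apply/seteqP; split=> [G' /Gam_unique|_ ->].
- exact: (attractor_eq hal hbe hga hr hcoex' hE phiE phi_lip L'0 f_lip HT hinv0 hw0 hw1 hrh hkap
    W_upper W_lower W_rep rho_box hN1 hN2 hN3 hN4 hmu q1 q2 q3 q4 del_u del_v At Gam_unique hm th0 Tm om_up om_low alpha_pole).
- apply: (infinite_heteroclinics hal hbe hga hr hcoex' hE phiE phi_lip L'0 f_lip HT hinv0 hw0 hrh hkap
    W_lower W_rep rho_box del_u Gam_unique hm th0 Tm om_up om_low).
Qed.
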